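(* Let $f$ be an SGF on $\mathbb{R}^d$ or $\mathbb{Z}^d$ with spectral measure $\mu$ such that $\mu_{a.c.}\neq0$ and $\lim_{\delta\to0}\frac{\log\mu[B(\delta)]}{\log\delta}=\alpha$ for some $\alpha\in(0,d)$. Then, as $T\to\infty$, $$\theta_\mu(T)=T^{\alpha+o(1)}.$$
   Context: An SGF on $\mathbb{R}^d$ or $\mathbb{Z}^d$ is a continuous (in the case of $\mathbb{R}^d$), centred, non-degenerate, stationary Gaussian field $f$. Its covariance kernel is $K(x)=\mathbb{E}[f(0)f(x)]$; its spectral measure $\mu$ is the unique non-negative, finite, symmetric measure with $K=\mathcal{F}[\mu]$, where $\mathcal{F}[\mu](x)=\int e^{-2\pi i\langle\lambda,x\rangle}d\mu(\lambda)$. It lives on $\mathbb{R}^d$ for fields on $\mathbb{R}^d$, and on the torus $\mathbb{R}^d/\mathbb{Z}^d$ for fields on $\mathbb{Z}^d$. $\mu_{a.c.}$ is the absolutely continuous part of $\mu$. $B(r)$ is the closed Euclidean ball of radius $r$ about the origin; for fields on $\mathbb{Z}^d$, a spatial domain $B(T)$ is understood as $B(T)\cap\mathbb{Z}^d$. $\theta_\mu(T)=-\log\mathbb{P}[f(x)\ge0\text{ for all }x\in B(T)]$. *)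

(* Defs.v *)
From HB Require Import structures.
From mathcomp Require Import all_boot all_order all_algebra.
From mathcomp Require Import generic_quotient.
From mathcomp Require Import all_classical all_reals all_analysis.
From mathcomp Require Import complex.

Set Implicit Arguments.
Unset Strict Implicit.
Unset Printing Implicit Defensive.

Import Order.TTheory GRing.Theory Num.Theory.
Import numFieldNormedType.Exports.

Local Open Scope classical_set_scope.
Local Open Scope ring_scope.

Section gaussian_fields.
Context {R : realType} {dOm : measure_display} {Om : measurableType dOm}.
Variable P : probability Om R.

(* [normal_prob m 0] is the uniform law on [0, 1] in the library, whereas the
   Gaussian law of variance 0 is a Dirac mass. *)
Definition gaussian_law (m s : R) (A : set R) : \bar R :=
  if s == 0 then \d_m A else normal_prob m s A.

Variable V : zmodType.
Implicit Type f : V -> {RV P >-> R}.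

Definition gaussian_field f := forall (n : nat) (x : 'I_n -> V) (a : 'I_n -> R),
  exists m s : R, forall A : set R, measurable A ->
    P [set w | A (\sum_(i < n) a i * f (x i) w)] = gaussian_law m s A.

Definition centred f := forall x, ('E_P[f x] = 0)%E.

(* Equality of finite-dimensional laws, tested on measurable rectangles. *)
Definition stationary f :=
  forall (h : V) (n : nat) (x : 'I_n -> V) (A : 'I_n -> set R),
    (forall i, measurable (A i)) ->
    P [set w | forall i, A i (f (x i + h) w)] =
    P [set w | forall i, A i (f (x i) w)].

Definition cov_kernel f (x : V) : R := fine ('E_P[(f 0%R \* f x)%R])%E.

Definition nondegenerate f := cov_kernel f 0 != 0.

Definition SGF f :=
  [/\ gaussian_field f, centred f, stationary f & nondegenerate f].

Definition theta f (D : set V) : \bar R :=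
  (- lne (P [set w | forall x, D x -> (0 <= f x w)%R]))%E.

End gaussian_fields.

Section euclidean.
Variables (R : realType) (d : nat).

Definition dotr (u v : 'rV[R]_d) : R := \sum_(i < d) u 0 i * v 0 i.

(* The norm [`|x|] of the library is the sup norm on matrices. *)
Definition eball (r : R) : set 'rV[R]_d := [set x | Num.sqrt (dotr x x) <= r].

Definition lattice_eball (r : R) : set 'rV[int]_d :=
  [set n | eball r (map_mx intr n)].

Definition borel_rV := g_sigma_algebraType (@open 'rV[R]_d).

End euclidean.

(* Lebesgue measure on R^d as a d-fold iterated integral (Tonelli); only its
   values on Borel sets are meaningful. *)
Fixpoint lebesgue_rV (R : realType) (d : nat) : set 'rV[R]_d -> \bar R :=
  match d return set 'rV[R]_d -> \bar R with
  | 0 => fun A => (\1_A 0)%:E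
  | d'.+1 => fun A => (\int[lebesgue_measure]_t
      lebesgue_rV [set v : 'rV[R]_d' | A (row_mx (t%:M : 'rV[R]_1) v)])%E
  end.

Section torus.
Local Open Scope quotient_scope.
Variables (R : realType) (d : nat).

Definition congZ (u v : 'rV[R]_d) : bool :=
  [forall i, (u 0 i - v 0 i) \is a Num.int].

Lemma congZ_refl : reflexive congZ.
Proof. by move=> u; apply/forallP => i; rewrite subrr. Qed.

Lemma congZ_sym : symmetric congZ.
Proof.
by move=> u v; apply: eq_forallb => i; rewrite -opprB rpredN.
Qed.

Lemma congZ_trans : transitive congZ.
Proof.
move=> v u w /forallP uv /forallP vw; apply/forallP => i.
by rewrite -(subrK (v 0 i) (u 0 i)) -addrA rpredD.
Qed.

Canonical congZ_equiv := EquivRel congZ congZ_refl congZ_sym congZ_trans.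

Definition torus := quotient_topology {eq_quot congZ_equiv}.

Definition to_torus (u : 'rV[R]_d) : torus := \pi_({eq_quot congZ_equiv}) u.

Definition torus_repr (t : torus) : 'rV[R]_d := repr (t : {eq_quot congZ_equiv}).

Definition torus_opp (t : torus) : torus := to_torus (- torus_repr t).

Definition borel_torus := g_sigma_algebraType (@open torus).

Definition torus_ball (r : R) : set torus := to_torus @` eball r.

Definition lebesgue_torus (A : set torus) : \bar R :=
  lebesgue_rV [set u : 'rV[R]_d |
    (forall i, 0 <= u 0 i < 1) /\ A (to_torus u)].

End torus.

Section spectral.
Variable R : realType.

Local Open Scope complex_scope.

(* [int exp (-2 i pi (phase x)) dm(x)] *)
Definition exp_transform {dT : measure_display} {T : measurableType dT}
    (m : {measure set T -> \bar R}) (phase : T -> R) : R[i] :=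
  (\int[m]_x cos (2 * pi * phase x))%R -i* (\int[m]_x sin (2 * pi * phase x))%R.

Definition spectral_rV (d : nat) (K : 'rV[R]_d -> R)
    (mu : {finite_measure set (borel_rV R d) -> \bar R}) :=
  (forall A : set (borel_rV R d), measurable A ->
     mu [set l | A (- (l : 'rV[R]_d))] = mu A) /\
  (forall x, (K x)%:C = exp_transform mu (fun l => dotr l x)).

(* The pairing with an integer vector is defined up to an integer, so the choice
   of the representative is immaterial. *)
Definition spectral_torus (d : nat) (K : 'rV[int]_d -> R)
    (mu : {finite_measure set (borel_torus R d) -> \bar R}) :=
  (forall A : set (borel_torus R d), measurable A ->
     mu [set t | A (torus_opp t)] = mu A) /\
  (forall n, (K n)%:C =
     exp_transform mu (fun t => dotr (torus_repr t) (map_mx intr n))).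

End spectral.

(* Lebesgue decomposition: [nu] is the part of [mu] absolutely continuous with
   respect to [leb]. *)
Definition ac_part {dT : measure_display} {T : measurableType dT} {R : realType}
    (mu nu : {finite_measure set T -> \bar R}) (leb : set T -> \bar R) :=
  nu `<< leb /\
  exists sing : {finite_measure set T -> \bar R},
    (exists N, [/\ measurable N, leb N = 0%E & sing (~` N) = 0%E]) /\
    (forall A, measurable A -> mu A = (nu A + sing A)%E).

(* [F T = T^(a + o(1))] as [T --> +oo] *)
Definition power_growth (R : realType) (F : R -> \bar R) (a : R) :=
  exists2 eps : R -> R, eps T @[T --> +oo] --> (0 : R) &
    \forall T \near +oo, F T = (T `^ (a + eps T))%:E.

(* Main.v *)
(** Both bounds average [f] against a probability kernel [q], a product of powers
    of Fejer kernels, supported in a ball of radius [1 / (8 rho)], whose symbol is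
    nonnegative, at least 1/2 on [B(rho)] and negligible far from it.

    For [theta <= T^(alpha + o(1))], take [rho] slightly smaller than [1 / T] and let
    [Z] be the average of [f].  On [B(T)] the covariance [h] of [f] and [Z] is
    comparable to [v = Var Z], both being [T^(- alpha + o(1))], and the field
    [f - (h / v) Z], which is independent of [Z], is at most [T^o(1)] with probability
    at least 1/2 by Fernique's inequality.  So it suffices that [Z] be larger than
    [T^o(1)], an event of probability [exp (- T^(alpha + o(1)))].

    For [theta >= T^(alpha - o(1))], average [f] against [q] with [rho] slightly larger
    than [1 / T] and over about [T^d] integer points.  The variance is at most
    [T^(- alpha + o(1))], so this average is below a given constant up to probability
    [exp (- T^(alpha - o(1)))].  If it is, and [f >= 0] on [B(T)], then most of the
    values of [f] along a translate of the integer points are small.  The absolutely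
    continuous part of [mu] dominates a nonzero measure with bounded density, for
    which exponentials at integer points satisfy a Bessel inequality; hence a positive
    proportion of these values is conditionally nondegenerate, and they are all small
    with probability at most [exp (- c T^d)], which is negligible as [alpha < d]. *)

Require Import Defs.
From HB Require Import structures.
From mathcomp Require Import all_boot all_order all_algebra.
From mathcomp Require Import generic_quotient.
From mathcomp Require Import all_classical all_reals all_analysis.
From mathcomp Require Import complex.
From mathcomp Require Import measurable_realfun ring lra.

Set Implicit Arguments.
Unset Strict Implicit.
Unset Printing Implicit Defensive.

Import Order.TTheory GRing.Theory Num.Theory.
Import numFieldNormedType.Exports.

Local Open Scope classical_set_scope.
Local Open Scope ring_scope.

(** * Functions determined by the moment generating function *)

(** The field is known only through the laws of its linear combinations. Joint statements
    (independence of uncorrelated combinations, rotation invariance of two independent copies) are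
    therefore read off moment generating functions and transferred to a class of functions
    containing the needed indicators. The Fejer kernels are raised to a power [M] because their
    leakage [(rho / r) ^+ M] must be negligible before masses of order T^(-alpha + o(1)), while
    [rho] and [r] differ only by a small power of T. On R^d the measure [mu] may decay at no rate. A
    kernel on a grid of step [s] sees frequencies only modulo 1/s, so [s] is taken small enough for
    the frequencies beyond 1/(2s) to carry mass at most [tau]. The number of points of the kernel is
    then uncontrolled, and no estimate may depend on it. Fernique's inequality is used on one unit
    cube, where continuity provides a quantile; the polynomially many translates cost only a
    logarithm. Both settings are instances of one argument for a group [V] and a spectral space [L],
    each with coordinates in R^d. *)

Section mgf_class.
Context {R : realType} {I : finType}.
Implicit Types (a x : I -> R) (F : (I -> R) -> R).

Definition dot a x := \sum_i a i * x i.
Definition norm1 x := \sum_i `|x i|.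

(* Functions whose integral is determined by the moment generating function; the
   domination in [mgf_lim] makes every member integrable under Gaussian laws. *)
Inductive mgf_class : ((I -> R) -> R) -> Prop :=
| mgf_exp a : mgf_class (fun x => expR (dot a x))
| mgf_add F G : mgf_class F -> mgf_class G -> mgf_class (fun x => F x + G x)
| mgf_scale c F : mgf_class F -> mgf_class (fun x => c * F x)
| mgf_lim (F : nat -> (I -> R) -> R) G C c : (forall k, mgf_class (F k)) ->
    (forall k x, `|F k x| <= C * expR (c * norm1 x)) ->
    (forall x, F ^~ x @ \oo --> G x) -> mgf_class G.

Lemma norm1_ge0 x : 0 <= norm1 x.
Proof. exact: sumr_ge0. Qed.

Lemma dot_norm1 a x : `|dot a x| <= norm1 a * norm1 x.
Proof.
rewrite /dot mulr_sumr; apply: le_trans (ler_norm_sum _ _ _) _.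
apply: ler_sum => i _; rewrite normrM ler_wpM2r//.
by rewrite /norm1 (bigD1 i)//= lerDl sumr_ge0.
Qed.

Lemma dotDl a b x : dot (fun i => a i + b i) x = dot a x + dot b x.
Proof. by rewrite /dot -big_split/=; apply: eq_bigr => i _; rewrite mulrDl. Qed.

Lemma dotZl c a x : dot (fun i => c * a i) x = c * dot a x.
Proof. by rewrite /dot mulr_sumr; apply: eq_bigr => i _; rewrite mulrA. Qed.

Lemma mgf_ext F G : mgf_class F -> F =1 G -> mgf_class G.
Proof. by move=> cF /funext <-. Qed.

(** Nonnegative constants let the bounds of two members be added. The bound survives a limit because
    [mgf_lim] demands it uniformly in [k]; absolute values repair constants of unknown sign. *)
Lemma mgf_bound F : mgf_class F ->
  exists C c, [/\ 0 <= C, 0 <= c & forall x, `|F x| <= C * expR (c * norm1 x)].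
Proof.
elim=> [a|G H _ [C [c [C0 c0 GC]]] _ [D [d [D0 d0 HD]]]|k G _ [C [c [C0 c0 GC]]]|
  Fk G C c cF _ FC FG].
- exists 1, (norm1 a); split => //; first exact: norm1_ge0.
  move=> x; rewrite mul1r ger0_norm ?expR_ge0// ler_expR.
  by rewrite (le_trans (ler_norm _)) ?dot_norm1.
- exists (C + D), (c + d); split; rewrite ?addr_ge0// => x.
  apply: le_trans (ler_normD _ _) _; rewrite mulrDl; apply: lerD.
    apply: le_trans (GC x) _; rewrite ler_wpM2l// ler_expR.
    by rewrite ler_wpM2r ?norm1_ge0// lerDl.
  apply: le_trans (HD x) _; rewrite ler_wpM2l// ler_expR.
  by rewrite ler_wpM2r ?norm1_ge0// lerDr.
- exists (`|k| * C), c; split; rewrite ?mulr_ge0// => x.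
  by rewrite normrM -mulrA ler_wpM2l.
- exists `|C|, `|c|; split => // x.
  have key : forall k, `|Fk k x| <= `|C| * expR (`|c| * norm1 x).
    move=> k; apply: le_trans (FC k x) _.
    apply: ler_pM; rewrite ?expR_ge0 ?ler_norm//.
      have := FC k x; move/(le_trans (normr_ge0 _)).
      by rewrite pmulr_lge0 ?expR_gt0.
    by rewrite ler_expR ler_wpM2r ?norm1_ge0// ler_norm.
  have cn : (fun k => `|Fk k x|) @ \oo --> `|G x| by apply: cvg_norm; exact: FG.
  rewrite -(cvg_lim _ cn)//; apply: limr_le; first by apply/cvg_ex; exists `|G x|.
  by apply: nearW => k; exact: key.
Qed.

(** Nested induction: when [F] is an exponential, induct on [G], the base case being that a product
    of exponentials is an exponential. In the limit cases the domination is multiplied by an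
    exponential bound of the other factor. *)
Lemma mgf_mul F G : mgf_class F -> mgf_class G -> mgf_class (fun x => F x * G x).
Proof.
move=> cF; elim: cF G => {F} [a|F H _ IF _ IH|k F _ IF|F H C c _ IF FC FH] G cG.
- elim: cG => {G} [b|G H _ IF _ IH|k G _ IF|G H D d cG IG GD GH].
  + apply: (mgf_ext (mgf_exp (fun i => a i + b i))) => x.
    by rewrite dotDl expRD.
  + by apply: (mgf_ext (mgf_add IF IH)) => x; rewrite mulrDr.
  + by apply: (mgf_ext (mgf_scale k IF)) => x; rewrite mulrCA.
  + apply: (mgf_lim (C := D) (c := norm1 a + d) IG).
      move=> k x; rewrite normrM mulrDl expRD mulrCA.
      apply: ler_pM => //; rewrite ger0_norm ?expR_ge0// ler_expR.
      by rewrite (le_trans (ler_norm _)) ?dot_norm1.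
    by move=> x; apply: cvgM; [exact: cvg_cst|exact: GH].
- by apply: (mgf_ext (mgf_add (IF _ cG) (IH _ cG))) => x; rewrite mulrDl.
- by apply: (mgf_ext (mgf_scale k (IF _ cG))) => x; rewrite mulrA.
- have [D [d [D0 d0 GD]]] := mgf_bound cG.
  apply: (mgf_lim (C := C * D) (c := c + d) (fun k => IF k _ cG)).
    move=> k x; rewrite normrM mulrDl expRD mulrACA.
    by apply: ler_pM.
  by move=> x; apply: cvgM; [exact: FH|exact: cvg_cst].
Qed.

Lemma mgf_cst c : mgf_class (fun=> c).
Proof.
apply: (mgf_ext (mgf_scale c (mgf_exp (fun=> 0)))) => x.
by rewrite /dot big1 ?expR0 ?mulr1// => i _; rewrite mul0r.
Qed.

Lemma mgf_sub F G : mgf_class F -> mgf_class G -> mgf_class (fun x => F x - G x).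
Proof.
move=> cF cG; apply: (mgf_ext (mgf_add cF (mgf_scale (-1) cG))) => x.
by rewrite mulN1r.
Qed.

Lemma mgf_prod (J : Type) (s : seq J) (P : pred J) (F : J -> (I -> R) -> R) :
  (forall j, mgf_class (F j)) -> mgf_class (fun x => \prod_(j <- s | P j) F j x).
Proof.
move=> cF; elim: s => [|j s IH].
  by apply: (mgf_ext (mgf_cst 1)) => x; rewrite big_nil.
have [Pj|Pj] := boolP (P j).
  by apply: (mgf_ext (mgf_mul (cF j) IH)) => x; rewrite big_cons Pj.
by apply: (mgf_ext IH) => x; rewrite big_cons (negbTE Pj).
Qed.

Lemma mgf_exprn F n : mgf_class F -> mgf_class (fun x => F x ^+ n).
Proof.
move=> cF; elim: n => [|n IH]; first exact: mgf_cst.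
by apply: (mgf_ext (mgf_mul cF IH)) => x; rewrite exprS.
Qed.

Lemma mgf_sum (F : nat -> (I -> R) -> R) n : (forall j, mgf_class (F j)) ->
  mgf_class (fun x => \sum_(0 <= j < n) F j x).
Proof.
move=> cF; elim: n => [|n IH].
  by apply: (mgf_ext (mgf_cst 0)) => x; rewrite big_nil.
by apply: (mgf_ext (mgf_add IH (cF n))) => x; rewrite big_nat_recr.
Qed.

Lemma expRB1_le (u : R) : `|expR u - 1| <= `|u| * expR `|u|.
Proof.
have h (v : R) : 0 <= v -> expR v - 1 <= v * expR v.
  move=> v0; have := expR_ge1Dx (- v); rewrite expRN => h.
  have := expR_gt0 v => e0.
  rewrite -subr_ge0; have -> : v * expR v - (expR v - 1) =
    expR v * ((expR v)^-1 - (1 - v)) by field; rewrite gt_eqF.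
  by rewrite mulr_ge0 ?(ltW e0)// subr_ge0.
have [u0|u0] := leP 0 u.
  rewrite !ger0_norm//; first exact: h.
  by rewrite subr_ge0 -expR0 ler_expR.
rewrite ler0_norm; last by rewrite subr_le0 -expR0 ler_expR ltW.
rewrite ltr0_norm// opprB.
have h1 := expR_ge1Dx u; apply: le_trans (_ : - u * 1 <= _); first by lra.
by rewrite ler_wpM2l ?oppr_ge0 ?(ltW u0)// -expR0 ler_expR oppr_ge0 ltW.
Qed.

Lemma expR_diff_cvg (a : nat -> R) (u : R) : (forall n, 0 < a n) ->
  a @ \oo --> 0 -> (fun n => (a n)^-1 * (expR (a n * u) - 1)) @ \oo --> u.
Proof.
move=> a0 ca.
have c0 : (fun n : nat => a n * u) @ \oo --> (0 : R).
  by rewrite -(mul0r u); apply: cvgMr_tmp.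
apply: (@squeeze_cvgr _ _ _ _ (fun=> u) (fun n : nat => u * expR (a n * u))); last 2 first.
- exact: cvg_cst.
- rewrite -[X in _ --> X]mulr1; apply: cvgMl_tmp.
  rewrite -[X in _ --> X](@expR0 R).
  exact: (cvg_comp _ _ c0 (@continuous_expR R 0)).
apply: nearW => n; set t : R := a n * u.
have uE : u = (a n)^-1 * t by rewrite /t mulrA mulVf ?mul1r// gt_eqF.
rewrite [X in X <= _ <= _]uE [X in _ <= _ <= X * _]uE -mulrA.
have an : 0 < (a n)^-1 by rewrite invr_gt0.
rewrite !(ler_pM2l an).
apply/andP; split; first by rewrite lerBrDl expR_ge1Dx.
have := expR_ge1Dx (- t); rewrite expRN => h.
have := expR_gt0 t => e0.
rewrite -subr_ge0; have -> : t * expR t - (expR t - 1) =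
  expR t * ((expR t)^-1 - (1 - t)) by field; rewrite gt_eqF.
by rewrite mulr_ge0 ?(ltW e0)// subr_ge0.
Qed.

Lemma mul_expR_le (u : R) : `|u| * expR `|u| <= expR (2 * `|u|).
Proof.
rewrite mulr_natl mulr2n expRD ler_wpM2r ?expR_ge0//.
by apply: le_trans (expR_ge1Dx _); rewrite lerDr.
Qed.

(** A linear form is the derivative at 0 of [expR (t * dot a x)], hence a limit of difference
    quotients with steps [n.+1%:R^-1]; these are dominated through [|e^u - 1| <= |u| e^|u|]. *)
Lemma mgf_dot a : mgf_class (dot a).
Proof.
apply: (@mgf_lim (fun n x => n.+1%:R * (expR (dot (fun i => n.+1%:R^-1 * a i) x) - 1))
  _ 1 (2 * norm1 a)).
- by move=> n; apply: mgf_scale; apply: mgf_sub; [exact: mgf_exp|exact: mgf_cst].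
- move=> n x; rewrite dotZl mul1r normrM.
  have n0 : (0 : R) < n.+1%:R by rewrite ltr0n.
  rewrite (ger0_norm (ltW n0)).
  apply: (@le_trans _ _ (n.+1%:R * (`|n.+1%:R^-1 * dot a x| * expR `|n.+1%:R^-1 * dot a x|))).
    by rewrite ler_wpM2l ?(ltW n0)// expRB1_le.
  rewrite normrM ger0_norm ?invr_ge0 ?(ltW n0)// 2!mulrA divff ?gt_eqF// mul1r.
  apply: (@le_trans _ _ (expR `|dot a x| * expR `|dot a x|)).
    apply: ler_pM; rewrite ?expR_ge0//.
      by apply: le_trans (expR_ge1Dx _); rewrite lerDr.
    by rewrite ler_expR ler_piMl// invf_le1// ler1n.
  rewrite -expRD ler_expR -mulrA mulr_natl -mulr2n lerMn2r/=.
  exact: dot_norm1.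
- move=> x; rewrite (_ : (fun n => _) = (fun n : nat => (n.+1%:R^-1)^-1 *
    (expR (n.+1%:R^-1 * dot a x) - 1))); last first.
    by apply/funext => n; rewrite dotZl invrK.
  apply: (@expR_diff_cvg (fun n => n.+1%:R^-1)) => [n|].
    by rewrite invr_gt0.
  exact: cvg_harmonic.
Qed.

Lemma series_exp_coeff_le (u : R) n : 0 <= u -> series (exp_coeff u) n <= expR u.
Proof.
move=> u0; apply: nondecreasing_cvgn_le; last exact: is_cvg_series_exp_coeff.
by apply: nondecreasing_series => k _ _; exact: exp_coeff_ge0.
Qed.

(** Coefficients below [1 / k!] keep every partial sum under [expR |u|], which is the domination
    required by [mgf_lim]. *)
Lemma mgf_trig_series (s : nat -> R) (f : R -> R) a :
  (forall k, `|s k| <= k`!%:R^-1) ->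
  (forall u, series (fun k => s k * u ^+ k) @ \oo --> f u) ->
  mgf_class (fun x => f (dot a x)).
Proof.
move=> sk sf; apply: (@mgf_lim (fun n x => \sum_(0 <= k < n) s k * dot a x ^+ k)
  _ 1 (norm1 a)).
- move=> n; apply: (@mgf_sum (fun k x => s k * dot a x ^+ k)) => k.
  by apply: mgf_scale; apply: mgf_exprn; exact: mgf_dot.
- move=> n x; rewrite mul1r; apply: le_trans (ler_norm_sum _ _ _) _.
  apply: (@le_trans _ _ (series (exp_coeff `|dot a x|) n)).
    apply: ler_sum => k _; rewrite normrM normrX /exp_coeff/= mulrC.
    by rewrite ler_wpM2l// exprn_ge0.
  apply: le_trans (series_exp_coeff_le _ _) _ => //.
  by rewrite ler_expR dot_norm1.
- by move=> x; exact: sf.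
Qed.

Lemma mgf_cos a : mgf_class (fun x => cos (dot a x)).
Proof.
apply: (@mgf_trig_series (fun k => (~~ odd k)%:R * (-1) ^+ k./2 * (k`!%:R)^-1)).
  move=> k; rewrite normrM normrM normrX normrN normr1 expr1n mulr1.
  rewrite [X in _ * X]ger0_norm ?invr_ge0// ler_piMl ?invr_ge0//.
  by case: odd; rewrite ?normr0 ?normr1.
by move=> u; rewrite cosE /pseries; exact: (is_cvg_series_cos_coeff u) || (
  rewrite -cos_coeffE; exact: is_cvg_series_cos_coeff).
Qed.

Lemma mgf_sin a : mgf_class (fun x => sin (dot a x)).
Proof.
apply: (@mgf_trig_series (fun k => (odd k)%:R * (-1) ^+ k.-1./2 * (k`!%:R)^-1)).
  move=> k; rewrite normrM normrM normrX normrN normr1 expr1n mulr1.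
  rewrite [X in _ * X]ger0_norm ?invr_ge0// ler_piMl ?invr_ge0//.
  by case: odd; rewrite ?normr0 ?normr1.
by move=> u; rewrite sinE /pseries -sin_coeffE; exact: is_cvg_series_sin_coeff.
Qed.

(** With [w] the square root of [z], one factor [w ^+ n] absorbs [n] by Bernoulli's inequality and
    the other tends to 0. *)
Lemma cvg_natM_exprn (z : R) : 0 <= z < 1 ->
  (fun n : nat => n%:R * z ^+ n) @ \oo --> (0 : R).
Proof.
move=> /andP[z0 z1].
have [->|zN0] := eqVneq z 0.
  rewrite (_ : (fun _ => _) = fun=> 0); first exact: cvg_cst.
  by apply/funext => -[|n]; rewrite ?mul0r// exprS mul0r mulr0.
have zp : 0 < z by rewrite lt_neqAle eq_sym zN0.
pose w := Num.sqrt z; have w0 : 0 < w by rewrite sqrtr_gt0.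
have w1 : w < 1 by rewrite -(sqrtr1 R) ltr_sqrt.
have [h h0 wh] : exists2 h, 0 < h & w = (1 + h)^-1.
  exists (w^-1 - 1); first by rewrite subr_gt0 invf_gt1.
  by rewrite addrC subrK invrK.
have bern n : n%:R * h <= (1 + h) ^+ n.
  elim: n => [|n IH]; first by rewrite mul0r expr0.
  rewrite exprS -natr1 mulrDl [leRHS]mulrDl !mul1r; apply: lerD => //.
  rewrite ler_peMr ?(ltW h0)//.
  by apply: exprn_ege1; rewrite lerDl ltW.
apply: (@squeeze_cvgr _ _ _ _ (fun=> 0) (fun n => h^-1 * w ^+ n)).
- apply: nearW => n; rewrite mulr_ge0 ?exprn_ge0//=.
  have -> : z = w * w by rewrite -expr2 sqr_sqrtr.
  rewrite exprMn mulrA ler_wpM2r ?exprn_ge0 ?(ltW w0)//.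
  rewrite {1}wh exprVn ler_pdivrMr ?exprn_gt0 ?addr_gt0//.
  by rewrite mulrC ler_pdivlMr.
- exact: cvg_cst.
- rewrite -[X in _ --> X](mulr0 h^-1); apply: cvgMl_tmp.
  by apply: cvg_expr; rewrite ger0_norm ?ltW.
Qed.

Lemma bernoulli_le (z : R) m : 0 <= z <= 1 -> 1 - m%:R * z <= (1 - z) ^+ m.
Proof.
move=> /andP[z0 z1]; elim: m => [|m IH]; first by rewrite mul0r subr0.
rewrite exprS -natr1; apply: (@le_trans _ _ ((1 - z) * (1 - m%:R * z))).
  have : 0 <= z * (m%:R * z) by rewrite !mulr_ge0.
  nra.
by rewrite ler_wpM2l// subr_ge0.
Qed.

(** Since [(1 - z)(1 + z) <= 1], the power is at most the inverse of [(1 + z) ^+ m], to which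
    Bernoulli's inequality applies. *)
Lemma bernoulli_ge (z : R) m : 0 <= z <= 1 -> (1 - z) ^+ m <= (1 + m%:R * z)^-1.
Proof.
move=> /andP[z0 z1].
have mz : 0 < 1 + m%:R * z by rewrite ltr_wpDr ?mulr_ge0.
rewrite -[leRHS]mul1r ler_pdivlMr//.
apply: (@le_trans _ _ ((1 - z) ^+ m * (1 + z) ^+ m)).
  rewrite ler_wpM2l ?exprn_ge0 ?subr_ge0//.
  elim: m {mz} => [|m IH]; first by rewrite mul0r addr0.
  rewrite exprS -natr1; apply: (@le_trans _ _ ((1 + z) * (1 + m%:R * z))).
    have : 0 <= z * (m%:R * z) by rewrite !mulr_ge0.
    nra.
  by rewrite ler_wpM2l// addr_ge0.
rewrite -exprMn; apply: exprn_ile1.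
  by rewrite mulr_ge0 ?subr_ge0 ?addr_ge0.
nra.
Qed.

(* Bernoulli's inequality makes indicators bounded limits of polynomials. *)
Lemma half_threshold (y : R) : 0 <= y <= 1 ->
  (fun n : nat => (1 - y ^+ n) ^+ (n * 2 ^ n)) @ \oo --> ((y < 2^-1)%R%:R : R).
Proof.
move=> /andP[y0 y1].
have yn n : 0 <= y ^+ n <= 1 by rewrite exprn_ge0//= exprn_ile1.
(* The exponent times [y ^+ n] is [n (2 y)^n]: it tends to 0 for [y < 1/2] and is at least [n] for
   [y >= 1/2]. *)
have [yh|yh] := ltP y 2^-1.
  apply: (@squeeze_cvgr _ _ _ _ (fun n : nat => 1 - n%:R * (2 * y) ^+ n) (fun=> 1)).
  - apply: nearW => n; apply/andP; split; last first.
      apply: exprn_ile1; rewrite ?subr_ge0 ?lerBlDr ?lerDl; have /andP[]// := yn n.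
    apply: le_trans (bernoulli_le _ (yn n)).
    by rewrite exprMn natrM natrX mulrA.
  - rewrite -[X in _ --> X]subr0; apply: cvgB; first exact: cvg_cst.
    apply: cvg_natM_exprn; rewrite mulr_ge0//=.
    by move: yh; rewrite -(@ltr_pM2l _ 2)// mulfV.
  - exact: cvg_cst.
apply: (@squeeze_cvgr _ _ _ _ (fun=> 0) (fun n : nat => n.+1%:R^-1)).
- apply: nearW => n; apply/andP; split.
    by apply: exprn_ge0; rewrite subr_ge0; have /andP[] := yn n.
  apply: le_trans (bernoulli_ge _ (yn n)) _.
  have n2 : n%:R <= (n * 2 ^ n)%:R * y ^+ n.
    rewrite natrM natrX -mulrA -exprMn ler_peMr//.
    by apply: exprn_ege1; lra.
  have -> : n.+1%:R = 1 + n%:R :> R by rewrite -natr1 addrC.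
  rewrite lef_pV2 ?posrE ?lerD2l// ltr_wpDr//.
  by rewrite (le_trans _ n2).
- exact: cvg_cst.
- exact: cvg_harmonic.
Qed.

Lemma mgf_half F : mgf_class F -> (forall x, 0 <= F x <= 1) ->
  mgf_class (fun x => (F x < 2^-1)%R%:R).
Proof.
move=> cF F01.
apply: (@mgf_lim (fun n x => (1 - F x ^+ n) ^+ (n * 2 ^ n)) _ 1 0).
- by move=> n; apply: mgf_exprn; apply: mgf_sub; [exact: mgf_cst|exact: mgf_exprn].
- move=> n x; rewrite mul0r expR0 mulr1.
  have /andP[a b] : 0 <= F x ^+ n <= 1.
    by have /andP[? ?] := F01 x; rewrite exprn_ge0//= exprn_ile1.
  rewrite ger0_norm; last by rewrite exprn_ge0// subr_ge0.
  by apply: exprn_ile1; rewrite ?subr_ge0// lerBlDr lerDl.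
- by move=> x; exact: half_threshold.
Qed.

(** A half-line has to be detected by bounded members of the class. The sine of
    [(dot a x - r) / n.+1] has the sign of [dot a x - r] once the argument lies within [pi], and
    [(1 - sin) / 2 < 1/2] tests that sign with values in [0, 1]. *)
Lemma mgf_gt a r : mgf_class (fun x => (r < dot a x)%R%:R).
Proof.
apply: (@mgf_lim (fun n x =>
   ((1 - sin (n.+1%:R^-1 * (dot a x - r))) / 2 < 2^-1)%R%:R) _ 1 0).
- move=> n; apply: mgf_half.
    pose b i := n.+1%:R^-1 * a i; pose t : R := n.+1%:R^-1 * r.
    apply: (mgf_ext (F := fun x => 2^-1 *
      (1 - (cos t * sin (dot b x) - sin t * cos (dot b x))))).
      apply: mgf_scale; apply: mgf_sub; first exact: mgf_cst.
      by apply: mgf_sub; apply: mgf_scale; [exact: mgf_sin|exact: mgf_cos].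
    move=> x; rewrite /b dotZl.
    have -> : n.+1%:R^-1 * (dot a x - r) = n.+1%:R^-1 * dot a x - t by rewrite mulrBr.
    move: (_ * dot a x) => u; rewrite sinB.
    by move: (cos t) (sin t) (cos u) (sin u) => p q v w; field.
  move=> x; have := sin_geN1 (n.+1%:R^-1 * (dot a x - r)).
  have := sin_le1 (n.+1%:R^-1 * (dot a x - r)); move: (sin _) => s; lra.
- by move=> n x; rewrite mul0r expR0 mulr1 ger0_norm// lern1 leq_b1.
- move=> x; set u := dot a x - r.
  have uE : (r < dot a x) = (0 < u) by rewrite subr_gt0.
  rewrite uE; apply: cvg_near_cst.
  have c0 : (fun n : nat => n.+1%:R^-1 * u) @ \oo --> (0 : R).
    rewrite -(mul0r u); apply: cvgMr_tmp; exact: cvg_harmonic.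
  near=> n.
  have vpi : `|n.+1%:R^-1 * u| < pi.
    near: n; have /cvgrPdist_lt /(_ _ (@pi_gt0 R)) := c0.
    by under eq_near do rewrite sub0r normrN.
  have -> : (0 < u) = (0 < n.+1%:R^-1 * u) by rewrite pmulr_rgt0// invr_gt0 ltr0n.
  move: vpi; set v := _ * u => vpi.
  rewrite ltr_pdivrMr// mulVf// ltrBlDr ltrDl.
  have [v0|v0] := ltP 0 v.
    by rewrite sin_gt0_pi// v0/= (le_lt_trans (ler_norm _) vpi).
  suff -> : (0 < sin v) = false by [].
  apply/negbTE; rewrite -leNgt -oppr_ge0 -sinN sin_ge0_pi// oppr_ge0 v0/=.
  by rewrite ltW// (le_lt_trans _ vpi)// -normrN ler_norm.
Unshelve. all: by end_near. Qed.

Lemma mgf_ge a r : mgf_class (fun x => (r <= dot a x)%R%:R).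
Proof.
apply: (mgf_ext (mgf_sub (mgf_cst 1) (mgf_gt (fun i => -1 * a i) (- r)))) => x.
by rewrite dotZl mulN1r ltrN2 leNgt; case: ltP; rewrite ?subr0 ?subrr.
Qed.

Lemma mgf_norm_le a r : mgf_class (fun x => (`|dot a x| <= r)%R%:R).
Proof.
apply: (mgf_ext (mgf_mul (mgf_ge a (- r)) (mgf_ge (fun i => -1 * a i) (- r)))) => x.
by rewrite dotZl mulN1r lerN2 ler_norml -natrM mulnb.
Qed.

End mgf_class.

Section mgf_integral.
Context {R : realType} {I : finType} d {T : measurableType d}.
Variables (P : {measure set T -> \bar R}) (X : T -> I -> R).
Hypothesis mX : forall i, measurable_fun setT (fun w => X w i).
Hypothesis eX : forall a, (\int[P]_w (expR (dot a (X w)))%:E < +oo)%E.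

Lemma measurable_dot a : measurable_fun setT (fun w => dot a (X w)).
Proof.
by apply: measurable_sum => i; apply: measurable_funM => //; exact: measurable_cst.
Qed.

Lemma measurable_norm1 : measurable_fun setT (fun w => norm1 (X w)).
Proof.
by apply: measurable_sum => i; apply: measurableT_comp => //; exact: mX.
Qed.

Lemma integrable_expR_dot a : P.-integrable setT (fun w => (expR (dot a (X w)))%:E).
Proof.
apply/integrableP; split.
  by apply/measurable_EFinP; apply: measurableT_comp => //; exact: measurable_dot.
by under eq_integral do rewrite gee0_abs ?lee_fin ?expR_ge0//.
Qed.

(** Bound [e^(c|x|)] by [e^(cx) + e^(-cx)] in each coordinate; the product expands, one coordinate
    at a time, into exponentials of linear forms. *)
Lemma integrable_expR_norm1 c : P.-integrable setT (fun w => (expR (c * norm1 (X w)))%:E).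
Proof.
wlog c0 : c / 0 <= c.
  move=> h; apply: (@le_integrable _ _ _ _ _ measurableT _
    (fun w => (expR (`|c| * norm1 (X w)))%:E)); last exact: h.
    apply/measurable_EFinP; apply: measurableT_comp => //.
    by apply: measurable_funM; [exact: measurable_cst|exact: measurable_norm1].
  move=> w _; rewrite !abse_EFin lee_fin !(ger0_norm (expR_ge0 _)) ler_expR.
  by rewrite ler_wpM2r ?norm1_ge0// ler_norm.
have prodi (s : seq I) a : P.-integrable setT (fun w =>
    (\prod_(i <- s) (expR (c * X w i) + expR (- c * X w i)) * expR (dot a (X w)))%:E).
  elim: s a => [|i s IH] a.
    by under eq_fun do rewrite big_nil mul1r; exact: integrable_expR_dot.
  have dot1 e w : e * X w i = dot (fun j => if j == i then e else 0) (X w).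
    rewrite /dot (bigD1 i)//= eqxx big1 ?addr0// => j ji.
    by rewrite (negbTE ji) mul0r.
  rewrite (_ : (fun w => _) = (fun w =>
    (\prod_(j <- s) (expR (c * X w j) + expR (- c * X w j)) *
       expR (dot (fun j => (if j == i then c else 0) + a j) (X w)))%:E +
    (\prod_(j <- s) (expR (c * X w j) + expR (- c * X w j)) *
       expR (dot (fun j => (if j == i then - c else 0) + a j) (X w)))%:E)%E).
    exact: (integrableD measurableT (IH _) (IH _)).
  apply/funext => w; rewrite big_cons -EFinD !dotDl !expRD -!dot1.
  by congr (_%:E); ring.
apply: (@le_integrable _ _ _ _ _ measurableT _ _ _ _ (prodi (index_enum I) (fun=> 0))).
  apply/measurable_EFinP; apply: measurableT_comp => //.
  by apply: measurable_funM; [exact: measurable_cst|exact: measurable_norm1].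
move=> w _; rewrite !abse_EFin lee_fin.
have -> : dot (fun=> 0) (X w) = 0 by apply: big1 => i _; rewrite mul0r.
rewrite expR0 mulr1 ger0_norm ?expR_ge0// ger0_norm; last first.
  by apply: prodr_ge0 => i _; rewrite addr_ge0 ?expR_ge0.
rewrite /norm1 mulr_sumr expR_sum; apply: ler_prod => i _; rewrite expR_ge0/=.
have [x0|x0] := leP 0 (X w i).
  by rewrite ger0_norm// lerDl expR_ge0.
by rewrite ltr0_norm// mulrN mulNr lerDr expR_ge0.
Qed.

Lemma mgf_integrable F : mgf_class F -> P.-integrable setT (fun w => (F (X w))%:E).
Proof.
move=> cF.
have mF : measurable_fun setT (fun w => F (X w)).
  elim: cF => [a|G H _ IG _ IH|c G _ IG|G H C c _ IG GC GH].
  - by apply: measurableT_comp => //; exact: measurable_dot.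
  - exact: measurable_funD.
  - by apply: measurable_funM => //; exact: measurable_cst.
  - by apply: (measurable_fun_cvg IG) => w _; exact: GH.
have [C [c [C0 c0 FC]]] := mgf_bound cF.
apply: (@le_integrable _ _ _ _ _ measurableT _
    (fun w => (C%:E * (expR (c * norm1 (X w)))%:E)%E)).
- exact/measurable_EFinP.
- move=> w _; rewrite -EFinM !abse_EFin lee_fin [leRHS]ger0_norm ?mulr_ge0 ?expR_ge0//.
- by apply: integrableZl => //; exact: integrable_expR_norm1.
Qed.

Lemma mgf_dominated F G C c : (forall k, mgf_class (F k)) ->
  (forall k x, `|F k x| <= C * expR (c * norm1 x)) ->
  (forall x, F ^~ x @ \oo --> G x) ->
  (fun n => \int[P]_w (F n (X w))%:E)%E @ \oo --> (\int[P]_w (G (X w))%:E)%E.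
Proof.
move=> cF FC FG; have cG := mgf_lim cF FC FG.
have [] := @dominated_convergence _ _ _ P setT measurableT
  (fun n w => (F n (X w))%:E) (fun w => (G (X w))%:E)
  (fun w => (C * expR (c * norm1 (X w)))%:E) => //.
- by move=> n; apply: measurable_int; exact: (mgf_integrable (cF n)).
- by apply: measurable_int; exact: (mgf_integrable cG).
- by apply: aeW => w _; apply: cvg_EFin; [exact: nearW|exact: FG].
- under eq_fun do rewrite EFinM.
  by apply: integrableZl => //; exact: integrable_expR_norm1.
- by apply: aeW => w n _; rewrite abse_EFin lee_fin; exact: FC.
Qed.

End mgf_integral.

Section mgf_transfer.
Context {R : realType} {I : finType} d1 d2 {T1 : measurableType d1} {T2 : measurableType d2}.
Variables (P1 : {measure set T1 -> \bar R}) (X1 : T1 -> I -> R).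
Variables (P2 : {measure set T2 -> \bar R}) (X2 : T2 -> I -> R).
Hypothesis mX1 : forall i, measurable_fun setT (fun w => X1 w i).
Hypothesis mX2 : forall i, measurable_fun setT (fun w => X2 w i).
Hypothesis eX1 : forall a, (\int[P1]_w (expR (dot a (X1 w)))%:E < +oo)%E.
Hypothesis eX12 : forall a,
  (\int[P1]_w (expR (dot a (X1 w)))%:E = \int[P2]_w (expR (dot a (X2 w)))%:E)%E.

Let eX2 a : (\int[P2]_w (expR (dot a (X2 w)))%:E < +oo)%E.
Proof. by rewrite -eX12. Qed.

(** Plays the role of the uniqueness theorem for moment generating functions, with dominated
    convergence in the limit case of the induction. Two random vectors, possibly on different
    spaces, get compared on all of the class. *)
Lemma mgf_transfer F : mgf_class F ->
  (\int[P1]_w (F (X1 w))%:E = \int[P2]_w (F (X2 w))%:E)%E.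
Proof.
elim=> [a|G H cG IG cH IH|c G cG IG|G H C c cG IG GC GH].
- exact: eX12.
- under eq_integral do rewrite EFinD; under [RHS]eq_integral do rewrite EFinD.
  by rewrite !integralD ?IG ?IH//; exact: mgf_integrable.
- under eq_integral do rewrite EFinM; under [RHS]eq_integral do rewrite EFinM.
  by rewrite !integralZl ?IG//; exact: mgf_integrable.
have l1 := mgf_dominated mX1 eX1 cG GC GH; have l2 := mgf_dominated mX2 eX2 cG GC GH.
have {}l1 : (fun n => \int[P2]_w (G n (X2 w))%:E)%E @ \oo --> (\int[P1]_w (H (X1 w))%:E)%E.
  by under eq_fun do rewrite -IG.
exact: (cvg_unique _ l1 l2).
Qed.

End mgf_transfer.

(** * Normal laws *)

Section density.
Context d {T : measurableType d} {R : realType}.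
Variables (mu nu : {measure set T -> \bar R}) (g : T -> R).
Hypothesis mg : measurable_fun setT g.
Hypothesis g0 : forall x, 0 <= g x.
Hypothesis nuE : forall A, measurable A -> nu A = (\int[mu]_(x in A) (g x)%:E)%E.

Import HBNNSimple.
Local Open Scope ereal_scope.

Lemma ge0_integral_density (f : T -> \bar R) : measurable_fun setT f ->
  (forall x, 0 <= f x) -> \int[nu]_x f x = \int[mu]_x (f x * (g x)%:E).
Proof.
move=> mf f0; pose h := nnsfun_approx measurableT mf.
have Eg : measurable_fun setT (EFin \o g) by exact/measurable_EFinP.
have -> : \int[nu]_x f x = lim (\int[nu]_x (h n x)%:E @[n --> \oo]).
  rewrite -monotone_convergence//=.
  - apply: eq_integral => x _; apply/esym/cvg_lim => //=.
    exact: cvg_nnsfun_approx.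
  - by move=> n; exact/measurable_EFinP/measurable_funTS.
  - by move=> n x _; rewrite lee_fin.
  - by move=> x _ a b ab; rewrite lee_fin; exact/lefP/nd_nnsfun_approx.
have -> : \int[mu]_x (f x * (g x)%:E) =
    lim (\int[mu]_x ((h n x)%:E * (g x)%:E) @[n --> \oo]).
  rewrite -monotone_convergence//=.
  - apply: eq_integral => x _; apply/esym/cvg_lim => //=.
    by apply: cvgeZr => //; exact: cvg_nnsfun_approx.
  - move=> n; apply: emeasurable_funM => //; exact/measurable_EFinP.
  - by move=> n x _; rewrite mule_ge0 ?lee_fin.
  - move=> x _ a b ab; rewrite lee_wpmul2r ?lee_fin//.
    exact/lefP/nd_nnsfun_approx.
congr (lim (_ @ \oo)); apply/funext => n.
under eq_integral do rewrite fimfunE -fsumEFin//.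
rewrite ge0_integral_fsum//; last 2 first.
- by move=> r; exact/measurable_EFinP/measurableT_comp.
- by move=> r x _; rewrite EFinM nnfun_muleindic_ge0.
under [RHS]eq_integral.
  move=> x _; rewrite fimfunE -fsumEFin// ge0_mule_fsuml; last first.
    by move=> r; rewrite EFinM nnfun_muleindic_ge0.
  over.
rewrite ge0_integral_fsum//; last 2 first.
- move=> r; apply: emeasurable_funM => //.
  exact/measurable_EFinP/measurableT_comp.
- by move=> r x _; rewrite mule_ge0 ?lee_fin// -lee_fin EFinM nnfun_muleindic_ge0.
apply: eq_fsbigr => r /[!inE] rh.
have r0 : (0 <= r)%R by move: rh => [t _ <-].
under eq_integral do rewrite EFinM.
under [RHS]eq_integral do rewrite EFinM -muleA.
rewrite integralZl_indic_nnsfun// integral_indic// setIT.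
rewrite ge0_integralZl//.
- congr (_ * _); rewrite nuE// [LHS]integral_mkcond; apply: eq_integral => x _.
  rewrite patchE indicE; case: ifPn => xh; first by rewrite mul1e.
  by rewrite mul0e.
- by apply: emeasurable_funM => //; exact/measurable_EFinP.
- by move=> x _; rewrite mule_ge0 ?lee_fin.
Qed.

End density.

Section normal.
Context {R : realType}.

(** Completing the square: the exponential tilt shifts the mean to [m + s ^+ 2 * t]. *)
Lemma normal_mgf (m s t : R) : s != 0 ->
  (\int[normal_prob m s]_x (expR (t * x))%:E = (expR (t * m + s ^+ 2 * t ^+ 2 / 2))%:E)%E.
Proof.
move=> s0.
rewrite (@ge0_integral_density _ _ _ lebesgue_measure _ (normal_pdf m s)) => //; last first.
- apply/measurable_EFinP; apply: measurableT_comp => //.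
- exact: normal_pdf_ge0.
- exact: measurable_normal_pdf.
rewrite (_ : (fun x => _) = fun x => ((expR (t * m + s ^+ 2 * t ^+ 2 / 2))%:E *
    (normal_pdf (m + s ^+ 2 * t) s x)%:E)%E); last first.
  apply/funext => x; rewrite -!EFinM; congr (_%:E).
  rewrite !normal_pdfE// /normal_fun mulrCA [RHS]mulrCA -!expRD; congr (_ * expR _).
  by field.
rewrite integralZl//; first by rewrite integral_normal_pdf mule1.
exact: integrable_normal_pdf.
Qed.

Lemma normal_prob_norm (m s : R) : normal_prob m `|s| = normal_prob m s.
Proof.
apply/funext => A; apply: eq_integral => x _.
by rewrite /normal_pdf /normal_peak /normal_fun normr_eq0 real_normK ?num_real.
Qed.

Lemma normal_le (m s a b : R) : s != 0 -> a <= b ->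
  (normal_prob m s `[a, b]%classic <= ((b - a) * normal_peak s)%:E)%E.
Proof.
move=> s0 ab; rewrite /normal_prob.
apply: (@le_trans _ _ (\int[lebesgue_measure]_(x in `[a, b]) (normal_peak s)%:E)%E).
  apply: ge0_le_integral => //=.
  - by move=> x _; rewrite lee_fin normal_pdf_ge0.
  - by apply/measurable_EFinP/measurable_funTS; exact: measurable_normal_pdf.
  - by move=> x _; rewrite lee_fin normal_pdf_ub.
rewrite integral_cst//= lebesgue_measure_itv/= lte_fin.
case: ltgtP ab => // [ab _|-> _]; first by rewrite -EFinB -EFinM mulrC.
by rewrite mule0 subrr mul0r.
Qed.

(** Keep only [[r, r + s]], where the density is at least its value at the right end; the length [s]
    cancels the factor [1 / s] of the density. *)
Lemma normal_ge (s r : R) : 0 < s -> 0 <= r ->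
  (((Num.sqrt (pi *+ 2))^-1 * expR (- (r / s + 1) ^+ 2 / 2))%:E <=
  normal_prob 0 s `[r, +oo[%classic)%E.
Proof.
move=> s0 r0.
have sN0 : s != 0 by rewrite gt_eqF.
apply: (@le_trans _ _ (normal_prob 0 s `[r, r + s]%classic)); last first.
  apply: le_measure; rewrite ?inE//.
  by apply: subset_itvl; rewrite bnd_simp.
rewrite /normal_prob.
have e1 : (((Num.sqrt (pi *+ 2))^-1 * expR (- (r / s + 1) ^+ 2 / 2))%:E <=
    \int[lebesgue_measure]_(x in `[r, (r + s)%R])
    (normal_peak s * expR (- (r / s + 1) ^+ 2 / 2))%:E :> \bar R)%E.
  rewrite integral_cst//= lebesgue_measure_itv/= lte_fin ltrDl s0 -EFinB -EFinM lee_fin.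
  rewrite [r + s]addrC addrK mulrAC ler_wpM2r ?expR_ge0//.
  rewrite /normal_peak -mulrnAr sqrtrM ?sqr_ge0// sqrtr_sqr gtr0_norm// invfM.
  by rewrite mulrAC mulVf// mul1r.
apply: (le_trans e1); apply: ge0_le_integral => //=.
- by move=> x _; rewrite lee_fin mulr_ge0 ?normal_peak_ge0 ?expR_ge0.
- by apply/measurable_EFinP/measurable_funTS; exact: measurable_normal_pdf.
- move=> x; rewrite in_itv/= => /andP[rx xs].
  rewrite lee_fin normal_pdfE// ler_wpM2l ?normal_peak_ge0// /normal_fun subr0.
  rewrite ler_expR !mulNr lerN2.
  have -> : s ^+ 2 *+ 2 = s ^+ 2 * 2 by rewrite mulr_natr.
  rewrite invfM mulrA ler_wpM2r// -expr_div_n.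
  have x0 : 0 <= x / s by rewrite divr_ge0 ?(le_trans r0 rx)// ltW.
  have r1 : 0 <= r / s + 1 by rewrite addr_ge0// divr_ge0// ltW.
  rewrite ler_sqr ?nnegrE//.
  by rewrite -[X in _ <= _ + X](divff sN0) -mulrDl ler_wpM2r// invr_ge0 ltW.
Qed.

End normal.

Section gaussian_rv.
Context {R : realType} d {T : measurableType d} (P : probability T R).
Variable X : T -> R.
Hypothesis mX : measurable_fun setT X.

Lemma gaussian_law_mgf m s :
  (forall A, measurable A -> P [set w | A (X w)] = gaussian_law m s A) ->
  forall t, (\int[P]_w (expR (t * X w))%:E = (expR (t * m + s ^+ 2 * t ^+ 2 / 2))%:E)%E.
Proof.
move=> law t.
pose X' : T -> measurableTypeR R := X.
have mX' : measurable_fun setT X' by exact: mX.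
have mE : measurable_fun setT (fun x : measurableTypeR R => (expR (t * x))%:E).
  by apply/measurable_EFinP; apply: measurableT_comp => //.
have -> : (\int[P]_w (expR (t * X w))%:E = \int[pushforward P X']_x (expR (t * x))%:E)%E.
  by rewrite ge0_integral_pushforward// => x _; rewrite lee_fin expR_ge0.
rewrite /gaussian_law in law; case: eqVneq law => [->|s0] law.
  rewrite (@eq_measure_integral _ (measurableTypeR R) _ _ (\d_(m : measurableTypeR R))) => [|A mA _]; last exact: law.
  by rewrite integral_dirac// diracT mul1e expr0n !mul0r addr0.
rewrite -(normal_mgf m t s0); apply: eq_measure_integral => A mA _.
exact: law.
Qed.

Variable s : R.
Hypothesis law : forall A, measurable A -> P [set w | A (X w)] = gaussian_law 0 s A.

Let X1 (w : T) (u : unit) := X w.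

Let dot1 a w : dot a (X1 w) = a tt * X w.
Proof. by rewrite /dot (bigD1 tt)//= big1 ?addr0// => -[]. Qed.

Let norm11 (x : unit -> R) : norm1 x = `|x tt|.
Proof. by rewrite /norm1 (bigD1 tt)//= big1 ?addr0// => -[]. Qed.

Let mX1 i : measurable_fun setT (fun w => X1 w i).
Proof. exact: mX. Qed.

Let eX1 a : (\int[P]_w (expR (dot a (X1 w)))%:E < +oo)%E.
Proof.
under eq_integral do rewrite dot1.
by rewrite (gaussian_law_mgf law) ltry.
Qed.

(** The symmetric second difference quotient [F n] of the exponentials converges to the square, and
    its integral is known from the moment generating function. The factorised form [FE] reduces both
    the domination and the limit to first differences. *)
Lemma gaussian_second_moment : (\int[P]_w (X w ^+ 2)%:E = (s ^+ 2)%:E)%E.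
Proof.
pose h (n : nat) : R := n.+1%:R^-1.
have h0 n : 0 < h n by rewrite invr_gt0.
have hc : h @ \oo --> 0 by exact: cvg_harmonic.
have h2c : (fun n => h n * h n) @ \oo --> 0 by rewrite -[X in _ --> X](mulr0 0); exact: cvgM.
have cE t : mgf_class (fun x : unit -> R => expR (t * x tt)).
  apply: (mgf_ext (mgf_exp (fun=> t))) => x.
  by rewrite /dot (bigD1 tt)//= big1 ?addr0// => -[].
pose F n (x : unit -> R) := (h n)^-2 * (expR (h n * x tt) + expR (- h n * x tt) - 2).
have FE n x : F n x = expR (- h n * x tt) *
    (((h n)^-1 * (expR (h n * x tt) - 1)) * ((h n)^-1 * (expR (h n * x tt) - 1))).
  rewrite /F mulNr expRN.
  by field; rewrite ?gt_eqF ?expR_gt0.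
have cF n : mgf_class (F n).
  apply: mgf_scale; apply: mgf_sub; last exact: mgf_cst.
  by apply: mgf_add; exact: cE.
have FB n x : `|F n x| <= 1 * expR (5 * norm1 x).
  rewrite FE mul1r norm11 normrM ger0_norm ?expR_ge0//.
  have le1 : `|h n * x tt| <= `|x tt|.
    rewrite normrM ger0_norm ?(ltW (h0 n))// ler_piMl//.
    by rewrite /h invf_le1// ler1n.
  have le2 : `|(h n)^-1 * (expR (h n * x tt) - 1)| <= expR (2 * `|x tt|).
    apply: le_trans (mul_expR_le _).
    rewrite normrM ger0_norm ?invr_ge0 ?(ltW (h0 n))// -ler_pdivlMl ?invr_gt0// invrK.
    apply: le_trans (expRB1_le _) _; rewrite mulrA ler_pM//.
      by rewrite normrM ger0_norm// ltW.
    by rewrite ler_expR.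
  (* One unit for the factor [expR (- h n * x tt)], two for each of the two difference quotients. *)
  have -> : 5 * `|x tt| = `|x tt| + (2 * `|x tt| + 2 * `|x tt|) by ring.
  rewrite !expRD; apply: ler_pM => //.
    by rewrite ler_expR (le_trans (ler_norm _))// mulNr normrN.
  by rewrite normrM; apply: ler_pM.
have FC x : F ^~ x @ \oo --> x tt ^+ 2.
  rewrite (_ : F ^~ x = fun n => expR (- h n * x tt) *
    (((h n)^-1 * (expR (h n * x tt) - 1)) * ((h n)^-1 * (expR (h n * x tt) - 1)))); last first.
    by apply/funext => n; rewrite FE.
  rewrite -[X in _ --> X]mul1r; apply: cvgM.
    rewrite -(@expR0 R).
    apply: (cvg_comp _ expR); last exact: continuous_expR.
    rewrite -(mul0r (x tt)); apply: cvgMr_tmp.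
    by rewrite -[X in _ --> X]oppr0; exact: cvgN.
  by rewrite expr2; apply: cvgM; exact: expR_diff_cvg.
have := mgf_dominated mX1 eX1 cF FB FC.
have -> : (fun n => \int[P]_w (F n (X1 w))%:E)%E =
    (fun n => (2 * ((h n * h n)^-1 * (expR (h n * h n * (s ^+ 2 / 2)) - 1)))%:E).
  apply/funext => n; rewrite /F /X1.
  have iE t : P.-integrable setT (fun w => (expR (t * X w))%:E).
    exact: (mgf_integrable mX1 eX1 (cE t)).
  under eq_integral do rewrite EFinM EFinB EFinD.
  rewrite integralZl//; last first.
    apply: integrableB => //; first exact: integrableD.
    exact: finite_measure_integrable_cst.
  rewrite integralB//; last 2 first.
  - exact: integrableD.
  - exact: finite_measure_integrable_cst.
  rewrite integralD// !(gaussian_law_mgf law) integral_cst//= probability_setT mule1.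
  rewrite -!EFinD -EFinM; congr (_%:E).
  have -> : h n * 0 + s ^+ 2 * h n ^+ 2 / 2 = h n * h n * (s ^+ 2 / 2) by field.
  have -> : - h n * 0 + s ^+ 2 * (- h n) ^+ 2 / 2 = h n * h n * (s ^+ 2 / 2) by field.
  by field; rewrite gt_eqF.
move=> /cvg_lim <- //.
have l : (fun n => 2 * ((h n * h n)^-1 * (expR (h n * h n * (s ^+ 2 / 2)) - 1))) @ \oo -->
    2 * (s ^+ 2 / 2).
  apply: cvgMl_tmp; apply: (@expR_diff_cvg _ (fun n => h n * h n)) => // n.
  by rewrite mulr_gt0.
have e : 2 * (s ^+ 2 / 2) = s ^+ 2 by field.
rewrite e in l.
by apply/cvg_lim => //; apply: cvg_EFin; [exact: nearW|exact: l].
Qed.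

End gaussian_rv.

(** From [e^(tX) >= 1 + tX] the moment generating function is at least 1 for every [t], so the
    exponent [t m + s^2 t^2 / 2] never becomes negative; testing it at its minimum forces
    [m = 0]. *)
Lemma gaussian_centred {R : realType} d {T : measurableType d} (P : probability T R)
  (X : T -> R) m s : measurable_fun setT X ->
  (forall A, measurable A -> P [set w | A (X w)] = gaussian_law m s A) ->
  (\int[P]_w (X w)%:E = 0)%E -> P.-integrable setT (EFin \o X) -> m = 0.
Proof.
move=> mX law EX iX.
have key t : 0 <= t * m + s ^+ 2 * t ^+ 2 / 2.
  rewrite -ler_expR expR0 -lee_fin -(gaussian_law_mgf mX law).
  have -> : 1%:E = (\int[P]_w (1 + t%:E * (X w)%:E))%E.
    rewrite integralD//; last 2 first.
    - exact: finite_measure_integrable_cst.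
    - exact: integrableZl.
    rewrite integral_cst//= probability_setT mule1 integralZl//.
    by rewrite [X in (_ * X)%E]EX mule0 adde0.
  apply: le_integral => //.
  - apply: integrableD => //; first exact: finite_measure_integrable_cst.
    exact: integrableZl.
  - apply/integrableP; split.
      by apply/measurable_EFinP; apply: measurableT_comp => //; exact: measurable_funM.
    under eq_integral do rewrite gee0_abs ?lee_fin ?expR_ge0//.
    by rewrite (gaussian_law_mgf mX law) ltry.
  - by move=> w _; rewrite -EFinM -EFinD lee_fin expR_ge1Dx.
have [s0|s0] := eqVneq s 0.
  have := key (- m); rewrite s0 expr0n/= !mul0r addr0 mulNr oppr_ge0 -expr2.
  by move=> h; apply/eqP; rewrite -sqrf_eq0 eq_le h sqr_ge0.
have s2 : 0 < s ^+ 2 by rewrite exprn_even_gt0.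
have := key (- m / s ^+ 2).
have -> : - m / s ^+ 2 * m + s ^+ 2 * (- m / s ^+ 2) ^+ 2 / 2 = - (m ^+ 2 / (s ^+ 2 * 2)).
  by field.
have c0 : 0 < (s ^+ 2 * 2)^-1 by rewrite invr_gt0 (mulr_gt0 s2).
rewrite oppr_ge0 pmulr_lle0// => h.
by apply/eqP; rewrite -sqrf_eq0 eq_le h sqr_ge0.
Qed.

(** * Isonormal Gaussian processes *)

Lemma integral_bool {R : realType} d {T : measurableType d}
    (P : {measure set T -> \bar R}) (b : T -> bool) :
  measurable [set w | b w] -> (\int[P]_w ((b w)%:R)%:E)%E = P [set w | b w].
Proof.
move=> mb; rewrite -[in RHS](setIT [set w | b w]) -integral_indic//.
by apply: eq_integral => w _; rewrite indicE mem_setE.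
Qed.

(** * Positive semidefinite bilinear forms *)

Section psd_form.
Context {R : realType} {E : lmodType R}.
Variable B : E -> E -> R.

Record psd_form : Prop := PsdForm {
  psd_sym : forall e f, B e f = B f e;
  psd_lin : forall t e f g, B (t *: e + f) g = t * B e g + B f g;
  psd_ge0 : forall e, 0 <= B e e }.

Hypothesis pB : psd_form.

Lemma psdDl e f g : B (e + f) g = B e g + B f g.
Proof. by have := psd_lin pB 1 e f g; rewrite scale1r mul1r. Qed.

Lemma psd0l g : B 0 g = 0.
Proof. by have := psdDl 0 0 g; rewrite addr0 => /eqP; rewrite -subr_eq subrr => /eqP. Qed.

Lemma psdZl t e g : B (t *: e) g = t * B e g.
Proof. by have := psd_lin pB t e 0 g; rewrite addr0 psd0l addr0. Qed.

Lemma psdDr e f g : B g (e + f) = B g e + B g f.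
Proof. by rewrite !(psd_sym pB g) psdDl. Qed.

Lemma psdZr t e g : B g (t *: e) = t * B g e.
Proof. by rewrite !(psd_sym pB g) psdZl. Qed.

Lemma psd_suml (I : Type) (s : seq I) (P : pred I) (F : I -> E) g :
  B (\sum_(i <- s | P i) F i) g = \sum_(i <- s | P i) B (F i) g.
Proof. by apply: (big_morph (B^~ g)) => [e f|]; [exact: psdDl|exact: psd0l]. Qed.

Lemma psd_cauchy e f : B e f ^+ 2 <= B e e * B f f.
Proof.
have key t : 0 <= t ^+ 2 * B e e + 2 * t * B e f + B f f.
  have := psd_ge0 pB (t *: e + f).
  rewrite psdDl !psdDr !psdZl !psdZr (psd_sym pB f e).
  by rewrite (_ : _ + _ + _ = t ^+ 2 * B e e + 2 * t * B e f + B f f)//; ring.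
have [e0|e0] := eqVneq (B e e) 0.
  rewrite e0 mul0r; have [->|ef0] := eqVneq (B e f) 0; first by rewrite expr0n.
  (* When [B e e = 0] the quadratic is affine in [t]; this value of [t] makes it equal to -1. *)
  have := key (- (B f f + 1) / (2 * B e f)); rewrite e0 mulr0 add0r.
  have -> : 2 * (- (B f f + 1) / (2 * B e f)) * B e f = - (B f f + 1) by field.
  by move=> h; exfalso; move: h; lra.
have ep : 0 < B e e by rewrite lt_neqAle eq_sym e0 (psd_ge0 pB).
have := key (- B e f / B e e).
have -> : (- B e f / B e e) ^+ 2 * B e e + 2 * (- B e f / B e e) * B e f + B f f =
   (B e e * B f f - B e f ^+ 2) / B e e by field.
by rewrite pmulr_lge0 ?invr_gt0// subr_ge0.
Qed.

End psd_form.

Section isonormal.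
Context {R : realType} {E : lmodType R} d {T : measurableType d}.
Variable P : probability T R.

(** Only one-dimensional laws are prescribed: since [X] is linear at every sample point, they
    already determine the moment generating function of every finite family. The form may be
    degenerate, whence the Dirac case of [gaussian_law]. *)
Record isonormal (X : E -> T -> R) (B : E -> E -> R) : Prop := Isonormal {
  iso_psd : psd_form B;
  iso_meas : forall e, measurable_fun setT (X e);
  iso_lin : forall t e f w, X (t *: e + f) w = t * X e w + X f w;
  iso_law : forall e (A : set R), measurable A ->
    P [set w | A (X e w)] = gaussian_law 0 (Num.sqrt (B e e)) A }.

Variables (X : E -> T -> R) (B : E -> E -> R).
Hypothesis iX : isonormal X B.
Let pB := iso_psd iX.

Lemma isoD e f w : X (e + f) w = X e w + X f w.
Proof. by have := iso_lin iX 1 e f w; rewrite scale1r mul1r. Qed.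

Lemma iso0 w : X 0 w = 0.
Proof. by have := isoD 0 0 w; rewrite addr0 => /eqP; rewrite -subr_eq subrr => /eqP. Qed.

Lemma isoZ t e w : X (t *: e) w = t * X e w.
Proof. by have := iso_lin iX t e 0 w; rewrite addr0 iso0 addr0. Qed.

Lemma iso_sum (I : Type) (s : seq I) (Q : pred I) (F : I -> E) w :
  X (\sum_(i <- s | Q i) F i) w = \sum_(i <- s | Q i) X (F i) w.
Proof. by apply: (big_morph (X^~ w)) => [e f|]; [exact: isoD|exact: iso0]. Qed.

Lemma iso_mgf e : (\int[P]_w (expR (X e w))%:E = (expR (B e e / 2))%:E)%E.
Proof.
have := gaussian_law_mgf (iso_meas iX e) (iso_law iX e) 1.
rewrite mulr0 add0r expr1n mulr1 sqr_sqrtr ?(psd_ge0 pB)// => <-.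
by apply: eq_integral => w _; rewrite mul1r.
Qed.

Lemma iso_second_moment e : (\int[P]_w (X e w ^+ 2)%:E = (B e e)%:E)%E.
Proof.
rewrite (gaussian_second_moment (iso_meas iX e) (iso_law iX e)).
by rewrite sqr_sqrtr ?(psd_ge0 pB).
Qed.

Lemma iso_meas_le e (t : R) : measurable [set w | `|X e w| <= t].
Proof.
have -> : [set w | `|X e w| <= t] = (fun w => `|X e w|) @^-1` `]-oo, t].
  by apply/seteqP; split => w /=; rewrite in_itv.
rewrite -[X in measurable X]setTI; apply: (measurableT_comp _ (iso_meas iX e)) => //.
Qed.

Lemma iso_meas_all (I : finType) (b : I -> E) (t : R) :
  measurable [set w | [forall i, `|X (b i) w| <= t]].
Proof.
have -> : [set w | [forall i, `|X (b i) w| <= t]] =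
    \bigcap_(i in [set: I]) [set w | `|X (b i) w| <= t].
  apply/seteqP; split => w /=; first by move=> /forallP h i _; exact: h.
  by move=> h; apply/forallP => i; exact: h.
by apply: fin_bigcap_measurable => // i _; exact: iso_meas_le.
Qed.

Let PP := (P \x P)%E.

Let mX1 e : measurable_fun setT (fun z : T * T => X e z.1).
Proof. exact: measurableT_comp (iso_meas iX e) measurable_fst. Qed.

Let mX2 e : measurable_fun setT (fun z : T * T => X e z.2).
Proof. exact: measurableT_comp (iso_meas iX e) measurable_snd. Qed.

Lemma iso_prod_mgf e f :
  (\int[PP]_z (expR (X e z.1 + X f z.2))%:E = (expR ((B e e + B f f) / 2))%:E)%E.
Proof.
rewrite /PP fubini_tonelli1//=; last first.
- by apply/measurable_EFinP; apply: measurableT_comp => //; exact: measurable_funD.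
have mE g : measurable_fun setT (fun w => (expR (X g w))%:E).
  by apply/measurable_EFinP; apply: measurableT_comp => //; exact: iso_meas iX g.
have inner w : (\int[P]_v (expR (X e w + X f v))%:E =
    (expR (X e w))%:E * (expR (B f f / 2))%:E)%E.
  rewrite -iso_mgf -ge0_integralZl ?lee_fin ?expR_ge0//.
  by apply: eq_integral => v _; rewrite expRD EFinM.
rewrite /fubini_F/=; under eq_integral do rewrite inner.
rewrite ge0_integralZr ?lee_fin ?expR_ge0//.
by rewrite iso_mgf -EFinM -expRD mulrDl.
Qed.

(** At [v = w] this is the joint vector; over the product space its two blocks are independent.
    Independence is the equality of the two expectations. *)
Definition split2 (I : finType) (b : I -> E) (y : E) (v w : T) (o : I + unit) : R :=
  if o is inl i then X (b i) v else X y w.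

Lemma dot_split2 (I : finType) (b : I -> E) (y : E) a v w : dot a (split2 b y v w) =
  X (\sum_i a (inl i) *: b i) v + X (a (inr tt) *: y) w.
Proof.
rewrite /dot big_sumType/= iso_sum isoZ; congr (_ + _).
  by apply: eq_bigr => i _; rewrite isoZ.
by rewrite (bigD1 tt)//= big1 ?addr0// => -[].
Qed.

(** Orthogonality removes the cross terms of the variance, so the joint moment generating function
    is the one computed on the product space. *)
Lemma iso_independent (I : finType) (b : I -> E) (y : E) F :
  (forall i, B (b i) y = 0) -> mgf_class F ->
  (\int[P]_w (F (split2 b y w w))%:E = \int[PP]_z (F (split2 b y z.1 z.2))%:E)%E.
Proof.
move=> by0 cF.
have orth a : B (\sum_i a (inl i) *: b i) (a (inr tt) *: y) = 0.
  rewrite (psd_suml pB) big1// => i _.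
  by rewrite (psdZl pB) (psdZr pB) by0 !mulr0.
have mgfE a : (\int[P]_w (expR (dot a (split2 b y w w)))%:E =
    \int[PP]_z (expR (dot a (split2 b y z.1 z.2)))%:E)%E.
  under eq_integral do rewrite dot_split2 -isoD.
  under [RHS]eq_integral do rewrite dot_split2.
  rewrite iso_mgf iso_prod_mgf; congr (expR (_ / 2))%:E.
  by rewrite (psdDl pB) !(psdDr pB) (psd_sym pB (_ *: y)) orth addr0 add0r.
apply: mgf_transfer => //.
- by case=> [i|?]; exact: iso_meas iX _.
- by case=> [i|?]; [exact: mX1|exact: mX2].
- move=> a; under eq_integral do rewrite dot_split2 -isoD.
  by rewrite iso_mgf ltry.
Qed.

Definition rot2 (I : finType) (b : I -> E) (c s : R) (v w : T) (o : I + I) : R :=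
  match o with inl i => c * X (b i) v - s * X (b i) w
             | inr i => s * X (b i) v + c * X (b i) w end.

Lemma dot_rot2 (I : finType) (b : I -> E) c s a v w : dot a (rot2 b c s v w) =
  X (c *: (\sum_i a (inl i) *: b i) + s *: (\sum_i a (inr i) *: b i)) v +
  X (c *: (\sum_i a (inr i) *: b i) - s *: (\sum_i a (inl i) *: b i)) w.
Proof.
rewrite /dot big_sumType/= -scaleNr !isoD !isoZ !iso_sum.
under [X in X + _ = _]eq_bigr do rewrite mulrBr.
under [X in _ + X = _]eq_bigr do rewrite mulrDr.
rewrite sumrB big_split/= !mulr_sumr.
rewrite [RHS]addrACA [X in _ = _ + X]addrC [RHS]addrA [LHS]addrA.
rewrite -!sumrN -!big_split/=; apply: eq_bigr => i _.
by rewrite !isoZ; ring.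
Qed.

Lemma measurable_rot2 (I : finType) (b : I -> E) (c s : R) i :
  measurable_fun setT (fun z : T * T => rot2 b c s z.1 z.2 i).
Proof.
by case: i => i; [apply: measurable_funB|apply: measurable_funD]; apply: measurable_funM => //.
Qed.

Lemma rot2_mgf (I : finType) (b : I -> E) (c s : R) a : c ^+ 2 + s ^+ 2 = 1 ->
  (\int[PP]_z (expR (dot a (rot2 b c s z.1 z.2)))%:E =
    (expR ((B (\sum_i a (inl i) *: b i) (\sum_i a (inl i) *: b i) +
            B (\sum_i a (inr i) *: b i) (\sum_i a (inr i) *: b i)) / 2))%:E)%E.
Proof.
move=> cs; under eq_integral do rewrite dot_rot2.
rewrite iso_prod_mgf; congr (expR (_ / 2))%:E.
rewrite -scaleNr !(psdDl pB) !(psdDr pB) !(psdZl pB) !(psdZr pB).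
set u := \sum_i _; set v := \sum_i _; rewrite (psd_sym pB v u).
move: (B u u) (B u v) (B v v) => p q r.
by rewrite -[RHS]mul1r -cs; ring.
Qed.

Lemma rot2_lty (I : finType) (b : I -> E) (c s : R) a : c ^+ 2 + s ^+ 2 = 1 ->
  (\int[PP]_z (expR (dot a (rot2 b c s z.1 z.2)))%:E < +oo)%E.
Proof. by move=> cs; rewrite rot2_mgf// ltry. Qed.

(** The moment generating function found in [rot2_mgf] does not involve the angle. *)
Lemma iso_rotate (I : finType) (b : I -> E) (c s : R) F : c ^+ 2 + s ^+ 2 = 1 ->
  mgf_class F ->
  (\int[PP]_z (F (rot2 b 1 0 z.1 z.2))%:E = \int[PP]_z (F (rot2 b c s z.1 z.2))%:E)%E.
Proof.
move=> cs cF; have c1 : 1 ^+ 2 + 0 ^+ 2 = 1 :> R by rewrite expr1n expr0n addr0.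
apply: mgf_transfer => //.
- exact: measurable_rot2.
- exact: measurable_rot2.
- by move=> a; exact: rot2_lty.
- by move=> a; rewrite !rot2_mgf.
Qed.

Lemma measurable_fun_rot2 (I : finType) (b : I -> E) (c s : R) F : c ^+ 2 + s ^+ 2 = 1 ->
  mgf_class F -> measurable_fun setT (fun z : T * T => (F (rot2 b c s z.1 z.2))%:E).
Proof.
move=> cs cF; apply: (measurable_int PP).
apply: (mgf_integrable (X := fun z => rot2 b c s z.1 z.2)) => //.
- exact: measurable_rot2.
- by move=> a; exact: rot2_lty.
Qed.

(* Rotating two independent copies by 45 degrees: if [|v - w|] is small and
   [|v + w|] is large (up to [sqrt 2]), then both [v] and [w] are large. *)
Lemma fernique (I : finType) (b : I -> E) (s t : R) :
  (P [set w | [forall i, (`|X (b i) w| <= s)%R]] *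
   P (~` [set w | [forall i, (`|X (b i) w| <= t)%R]]) <=
   P (~` [set w | [forall i, (`|X (b i) w| <= (t - s) / Num.sqrt 2)%R]]) ^+ 2)%E.
Proof.
pose A (u : R) := [set w | [forall i, `|X (b i) w| <= u]].
have mA (u : R) : measurable (A u) by exact: iso_meas_all.
have memA v (u : R) : (v \in A u) = [forall i, `|X (b i) v| <= u] by apply/idP/idP; rewrite inE.
pose g (u : R) (x : I -> R) : R := \prod_i (`|x i| <= u)%R%:R.
have gE (u : R) x : g u x = [forall i, `|x i| <= u]%R%:R.
  rewrite /g; case: (boolP [forall i, _]) => [/forallP h|].
    by rewrite big1// => i _; rewrite h.
  rewrite negb_forall => /existsP[i /negbTE h].
  by rewrite (bigD1 i)//= h mul0r.
have cg (J : finType) (u : R) (j : I -> J) : mgf_class (fun x : J -> R => g u (x \o j)).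
  apply: mgf_prod => i; apply: (mgf_ext (mgf_norm_le (fun k => (k == j i)%:R) u)) => x.
  rewrite /dot (bigD1 (j i))//= eqxx mul1r big1 ?addr0// => k /negbTE ->.
  by rewrite mul0r.
pose F (x : I + I -> R) := g s (x \o inl) * (1 - g t (x \o inr)).
have cF : mgf_class F.
  by apply: mgf_mul => //; apply: mgf_sub => //; exact: mgf_cst.
pose c : R := (Num.sqrt 2)^-1.
have c0 : 0 < c by rewrite invr_gt0 sqrtr_gt0.
have c2 : c ^+ 2 = 2^-1 by rewrite exprVn sqr_sqrtr.
have cs : c ^+ 2 + c ^+ 2 = 1 by rewrite c2; field.
have FE (x : I + I -> R) : F x =
    ([forall i, (`|x (inl i)| <= s)%R] && ~~ [forall i, (`|x (inr i)| <= t)%R])%:R.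
  rewrite /F !gE /=; do 2 case: [forall i, _];
  by rewrite ?subr0 ?subrr ?mulr1 ?mulr0.
have lhs : (\int[PP]_z (F (rot2 b 1 0 z.1 z.2))%:E = P (A s) * P (~` A t))%E.
  rewrite -product_measure1E//; last exact: measurableC.
  rewrite -[in RHS](setIT (_ `*` _)) -integral_indic//; last first.
    by apply: measurableX => //; exact: measurableC.
  apply: eq_integral => -[v w] _; rewrite FE indicE in_setX/= in_setC !memA.
  congr ((nat_of_bool (_ && ~~ _))%:R%:E); apply: eq_forallb => i.
    by rewrite mul1r mul0r subr0.
  by rewrite mul1r mul0r add0r.
pose u := (t - s) / Num.sqrt 2.
have rhs : (\int[PP]_z (F (rot2 b c c z.1 z.2))%:E <= P (~` A u) * P (~` A u))%E.
  have mAu : measurable (~` A u) by exact: measurableC.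
  rewrite -product_measure1E// -[leRHS](congr1 _ (setIT (_ `*` _))) -integral_indic//; last first.
    exact: measurableX.
  apply: ge0_le_integral => //.
  - by move=> z _; rewrite FE lee_fin.
  - exact: (measurable_fun_rot2 b cs cF).
  - by apply/measurable_EFinP; apply: measurable_indic; exact: measurableX.
  - move=> [v w] _; rewrite FE indicE in_setX/= !in_setC !memA lee_fin.
    case: (boolP (_ && _)) => // /andP[/forallP h1 /forallPn[j]].
    rewrite /rot2 -mulrDr -ltNge normrM (ger0_norm (ltW c0)) => h2.
    have := h1 j; rewrite /rot2 -mulrBr normrM (ger0_norm (ltW c0)) => h3.
    have uE : u = (t - s) * c by [].
    (* By symmetry the same bound holds with [a'] in place of [a], so a large sum and a small
       difference make both terms large. *)
    have key (a a' : R) : `|a + a'| <= `|a - a'| + 2 * `|a|.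
      have -> : a + a' = (a' - a) + 2 * a by ring.
      apply: le_trans (ler_normD _ _) _.
      by rewrite distrC normrM ger0_norm.
    have k1 (a a' : R) : c * `|a - a'| <= s -> t < c * `|a + a'| -> u < `|a|.
      move=> p1 p2; have p3 : c * `|a + a'| <= c * (`|a - a'| + 2 * `|a|).
        by rewrite ler_wpM2l ?(ltW c0).
      have p4 : (t - s) < 2 * c * `|a| by move: p1 p2 p3; rewrite mulrDr; lra.
      have : c * (t - s) < c * (2 * c * `|a|) by rewrite ltr_pM2l.
      have -> : c * (2 * c * `|a|) = c ^+ 2 * 2 * `|a| by ring.
      by rewrite c2 mulVf// mul1r uE mulrC.
    have n1 : ~~ [forall i, (`|X (b i) v| <= u)%R].
      by apply/forallPn; exists j; rewrite -ltNge; exact: (k1 _ (X (b j) w)).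
    have n2 : ~~ [forall i, (`|X (b i) w| <= u)%R].
      apply/forallPn; exists j; rewrite -ltNge; apply: (k1 _ (X (b j) v)).
        by rewrite distrC.
      by rewrite addrC.
    by rewrite n1 n2.
by rewrite -lhs (iso_rotate b cs cF) expe2.
Qed.

(** The span as a recursion along the list, matching the inductions that peel off its head. *)
Fixpoint lincomb (l : seq E) (z : E) : Prop :=
  if l is b :: l' then exists t y, lincomb l' y /\ z = t *: b + y else z = 0.

Lemma lincomb_nth l z : lincomb l z -> exists c : 'I_(size l) -> R,
  z = \sum_(i < size l) c i *: l`_i.
Proof.
elim: l z => [|b l IH] z /=; first by move=> ->; exists (fun=> 0); rewrite big_ord0.
move=> [t [y [/IH[c ->] ->]]].
exists (fun i => if unlift ord0 i is Some j then c j else t).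
rewrite big_ord_recl unlift_none; congr (_ + _).
by apply: eq_bigr => i _; rewrite liftK.
Qed.

(* Each vector keeps, after removal of its projection on the span of the
   following ones, a squared norm at least [c0]. *)
Fixpoint far_apart (c0 : R) (l : seq E) : Prop :=
  if l is b :: l' then far_apart c0 l' /\
    exists y z, [/\ b = y + z, lincomb l' z, (forall i : 'I_(size l'), B l'`_i y = 0) &
      c0 <= B y y]
  else True.

(** The Gaussian density never exceeds its peak, which decreases in the variance. The shift [r] is
    arbitrary because it will hold the part fixed by conditioning. *)
Lemma iso_anticoncentration (c0 : R) y (r : R) (eta : R) : 0 < c0 -> c0 <= B y y -> 0 <= eta ->
  (P [set w | (`|X y w + r| <= eta)%R] <= (2 * eta * normal_peak (Num.sqrt c0))%:E)%E.
Proof.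
move=> c0p c0y e0.
have s0 : 0 < Num.sqrt (B y y) by rewrite sqrtr_gt0 (lt_le_trans c0p).
have -> : [set w | (`|X y w + r| <= eta)%R] = [set w | `[(- eta - r), (eta - r)]%classic (X y w)].
  by apply/seteqP; split => w /=; rewrite in_itv/= ler_norml lerBlDr lerBrDr.
rewrite (iso_law iX)// /gaussian_law gt_eqF//.
apply: le_trans (normal_le 0 _ _) _; rewrite ?gt_eqF//; first by rewrite lerD2r; lra.
rewrite lee_fin (_ : eta - r - (- eta - r) = 2 * eta); last by ring.
rewrite ler_wpM2l ?mulr_ge0// /normal_peak lef_pV2 ?posrE ?sqrtr_gt0.
- by rewrite ler_wsqrtr// lerMn2r/= ler_wpM2r ?pi_ge0// !sqr_sqrtr// ?(ltW c0p)// (psd_ge0 pB).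
- by rewrite pmulrn_lgt0// mulr_gt0 ?pi_gt0// exprn_gt0.
- by rewrite pmulrn_lgt0// mulr_gt0 ?pi_gt0// exprn_gt0// sqrtr_gt0.
Qed.

(* Condition successively on the tail of the list: the component of the head
   orthogonal to the tail is independent of it and anticoncentrates. *)
Lemma small_ball_count (c0 eta M : R) (l : seq E) : 0 < c0 -> 0 <= eta -> 0 <= M ->
  far_apart c0 l ->
  (\int[P]_w (\prod_(b <- l) (1 + M * (`|X b w| <= eta)%R%:R))%:E <=
   ((1 + M * (2 * eta * normal_peak (Num.sqrt c0))) ^+ size l)%:E)%E.
Proof.
move=> c0p eta0 M0; set k := 2 * eta * _.
have k0 : 0 <= k by rewrite !mulr_ge0// normal_peak_ge0.
elim: l => [_|b l IH /= [sl [y [z [bE /lincomb_nth[c zE] orth cy]]]]].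
  under eq_integral do rewrite big_nil.
  by rewrite integral_cst//= probability_setT mule1.
pose I := 'I_(size l).
pose bb (i : I) := l`_i.
(* The product of these weights is [1 + M] to the number of small values: an exponential moment of
   that number. *)
pose G (x : R) : R := 1 + M * (`|x| <= eta)%R%:R.
have G0 x : 0 <= G x by rewrite addr_ge0// mulr_ge0.
have cG (J : finType) (a : J -> R) : mgf_class (fun x => G (dot a x)).
  by apply: mgf_add; [exact: mgf_cst|apply: mgf_scale; exact: mgf_norm_le].
pose F (x : I + unit -> R) := (\prod_i G (x (inl i))) *
   G (x (inr tt) + \sum_i c i * x (inl i)).
have cF : mgf_class F.
  apply: mgf_mul.
    apply: mgf_prod => i; apply: (mgf_ext (cG _ (fun o => (o == inl i)%:R))) => x.
    rewrite /dot (bigD1 (inl i))//= eqxx mul1r big1 ?addr0// => k' /negbTE ->.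
    by rewrite mul0r.
  apply: (mgf_ext (cG _ (fun o => if o is inl i then c i else 1))) => x.
  rewrite /dot big_sumType/= addrC; congr (G (_ + _)).
  by rewrite (bigD1 tt)//= mul1r big1 ?addr0// => -[].
have XE v : \prod_(b' <- l) G (X b' v) = \prod_i G (X (bb i) v).
  by rewrite (big_nth 0) big_mkord.
have zX v : X z v = \sum_i c i * X (bb i) v.
  by rewrite zE iso_sum; apply: eq_bigr => i _; rewrite isoZ.
have FE v w : F (split2 bb y v w) = (\prod_(b' <- l) G (X b' v)) * G (X y w + X z v).
  by rewrite /F /split2 XE zX.
have F0 z' : (0 <= (F (split2 bb y z'.1 z'.2))%:E)%E.
  by rewrite lee_fin FE mulr_ge0// prodr_ge0.
have mGX e : measurable_fun setT (fun w => G (X e w)).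
  apply: measurable_funD => //; apply: measurable_funM => //.
  have -> : (fun w => (`|X e w| <= eta)%R%:R) = \1_[set w | `|X e w| <= eta] :> (T -> R).
    by apply/funext => w; rewrite indicE mem_setE.
  by apply: measurable_indic; exact: iso_meas_le.
have mGr r : measurable_fun setT (fun w => G (X y w + r)).
  apply: measurable_funD => //; apply: measurable_funM => //.
  have mr : measurable [set w | (`|X y w + r| <= eta)%R].
    have -> : [set w | (`|X y w + r| <= eta)%R] = X y @^-1` `[(- eta - r), (eta - r)]%classic.
      by apply/seteqP; split => w /=; rewrite in_itv/= ler_norml lerBlDr lerBrDr.
    by rewrite -[X in measurable X]setTI; exact: (iso_meas iX y).
  have -> : (fun w => (`|X y w + r| <= eta)%R%:R) = \1_[set w | `|X y w + r| <= eta] :> (T -> R).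
    by apply/funext => w; rewrite indicE mem_setE.
  exact: measurable_indic.
have inner r : (\int[P]_w (G (X y w + r))%:E <= (1 + M * k)%:E)%E.
  rewrite /G; under eq_integral do rewrite EFinD EFinM.
  have mr : measurable [set w | (`|X y w + r| <= eta)%R].
    have -> : [set w | (`|X y w + r| <= eta)%R] = X y @^-1` `[(- eta - r), (eta - r)]%classic.
      by apply/seteqP; split => w /=; rewrite in_itv/= ler_norml lerBlDr lerBrDr.
    by rewrite -[X in measurable X]setTI; exact: (iso_meas iX y).
  have mb : measurable_fun setT (fun w => ((`|X y w + r| <= eta)%R%:R)%:E : \bar R).
    have -> : (fun w => (`|X y w + r| <= eta)%R%:R%:E) = EFin \o \1_[set w | `|X y w + r| <= eta] :> (T -> \bar R).
      by apply/funext => w /=; rewrite indicE mem_setE.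
    exact/measurable_EFinP/measurable_indic.
  rewrite ge0_integralD//; last 2 first.
  - by move=> w _; rewrite -EFinM lee_fin mulr_ge0.
  - exact: emeasurable_funM.
  rewrite integral_cst//= probability_setT mule1 ge0_integralZl ?lee_fin//.
  rewrite integral_bool// EFinD EFinM leeD2l// lee_wpmul2l ?lee_fin//.
  exact: iso_anticoncentration.
have mH : measurable_fun setT (fun v => \prod_(b' <- l) G (X b' v)).
  by apply: measurable_prod => e _; exact: mGX.
have H0 v : 0 <= \prod_(b' <- l) G (X b' v) by apply: prodr_ge0.
have mFz : measurable_fun setT (fun z' => (F (split2 bb y z'.1 z'.2))%:E).
  apply: (measurable_int PP); apply: (mgf_integrable (X := fun z' => split2 bb y z'.1 z'.2)) => //.
  - by case=> [i|?]; [exact: mX1|exact: mX2].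
  - by move=> a; under eq_integral do rewrite dot_split2; rewrite iso_prod_mgf ltry.
have -> : (\int[P]_w (\prod_(b0 <- b :: l) G (X b0 w))%:E =
    \int[P]_w (F (split2 bb y w w))%:E)%E.
  by apply: eq_integral => w _; rewrite FE big_cons mulrC bE isoD.
(* Now [y] has its own copy of the space; with the tail frozen, [X z v] is the constant shift [r] of
   [inner]. *)
rewrite (iso_independent orth cF) fubini_tonelli1// /fubini_F/=.
apply: (@le_trans _ _ (\int[P]_v ((\prod_(b' <- l) G (X b' v))%:E * (1 + M * k)%:E))%E).
  apply: ge0_le_integral => //.
  - by move=> v _; apply: integral_ge0 => w _; exact: (F0 (v, w)).
  - exact: (measurable_fun_fubini_tonelli_F (m2 := P) (fun z' => (F (split2 bb y z'.1 z'.2))%:E)).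
  - by apply: emeasurable_funM => //; exact/measurable_EFinP.
  - move=> v _; under eq_integral do rewrite FE EFinM.
    rewrite ge0_integralZl//; last 3 first.
    + exact/measurable_EFinP.
    + by move=> w _; rewrite lee_fin.
    + by rewrite lee_fin.
    by rewrite lee_wpmul2l ?lee_fin.
rewrite ge0_integralZr//; last 3 first.
- exact/measurable_EFinP.
- by move=> v _; rewrite lee_fin.
- by rewrite lee_fin addr_ge0// mulr_ge0.
rewrite exprSr EFinM lee_wpmul2r ?lee_fin ?addr_ge0 ?(mulr_ge0 M0 k0)//.
exact: IH.
Qed.

End isonormal.

(** * Spans, projections and extraction of a separated subfamily *)

Section lincomb.
Context {R : realType} {E : lmodType R}.
Implicit Types (l : seq E) (z : E).

Lemma lincomb0 l : lincomb l 0.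
Proof. by elim: l => [|b l IH]//=; exists 0, 0; rewrite scale0r addr0. Qed.

Lemma lincombD l z1 z2 : lincomb l z1 -> lincomb l z2 -> lincomb l (z1 + z2).
Proof.
elim: l z1 z2 => [|b l IH] z1 z2 /=; first by move=> -> ->; rewrite addr0.
move=> [t1 [y1 [h1 ->]]] [t2 [y2 [h2 ->]]]; exists (t1 + t2), (y1 + y2); split; first exact: IH.
by rewrite scalerDl addrACA.
Qed.

Lemma lincombZ l c z : lincomb l z -> lincomb l (c *: z).
Proof.
elim: l z => [|b l IH] z /=; first by move=> ->; rewrite scaler0.
move=> [t [y [h ->]]]; exists (c * t), (c *: y); split; first exact: IH.
by rewrite scalerDr scalerA.
Qed.

Lemma lincombB l z1 z2 : lincomb l z1 -> lincomb l z2 -> lincomb l (z1 - z2).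
Proof. by move=> h1 h2; rewrite -scaleN1r; apply: lincombD => //; exact: lincombZ. Qed.

Lemma lincomb_cons l b z : lincomb l z -> lincomb (b :: l) z.
Proof. by move=> h; exists 0, z; rewrite scale0r add0r. Qed.

Lemma lincomb_mem l b : b \in l -> lincomb l b.
Proof.
elim: l => // c l IH; rewrite in_cons => /orP[/eqP ->|/IH]; last exact: lincomb_cons.
by exists 1, 0; split; [exact: lincomb0|rewrite scale1r addr0].
Qed.

(** Unlike [far_apart] it speaks of distances and not of orthogonality, so it passes to a larger
    form by [distant_le]. Separation is obtained for a measure below [mu] and needed for [mu]. *)
Fixpoint distant (B : E -> E -> R) (c0 : R) l : Prop :=
  if l is b :: l' then distant B c0 l' /\
    forall z, lincomb l' z -> c0 <= B (b - z) (b - z)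
  else True.

Lemma distant_le (B B' : E -> E -> R) c0 l : (forall e, B e e <= B' e e) ->
  distant B c0 l -> distant B' c0 l.
Proof.
move=> BB'; elim: l => // b l IH [/IH h1 h2]; split => // z /h2 h; exact: le_trans (BB' _).
Qed.

Variable B : E -> E -> R.
Hypothesis pB : psd_form B.

Lemma lincomb_orth l y z : (forall b, b \in l -> B b y = 0) -> lincomb l z -> B z y = 0.
Proof.
elim: l z => [|b l IH] z h /=; first by move=> ->; rewrite (psd0l pB).
move=> [t [u [/IH hu ->]]]; rewrite (psdDl pB) (psdZl pB) h ?mem_head// mulr0 add0r.
by apply: hu => c cl; rewrite h// in_cons cl orbT.
Qed.

(** Gram-Schmidt for a possibly degenerate form: a residual of zero norm is orthogonal to everything
    by Cauchy-Schwarz, and is skipped. *)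
Lemma psd_project l x : exists2 z, lincomb l z & forall b, b \in l -> B b (x - z) = 0.
Proof.
elim: l x => [|b l IH] x; first by exists 0.
have [zb hb ob] := IH b; have [zx hx ox] := IH x.
pose b' := b - zb; pose x' := x - zx.
have bE : b = b' + zb by rewrite subrK.
have zbx' : B zb x' = 0 by apply: lincomb_orth hb.
have [b0|b0] := eqVneq (B b' b') 0.
  exists zx; first exact: lincomb_cons.
  move=> c; rewrite in_cons => /orP[/eqP ->|]; last exact: ox.
  rewrite -/x' bE (psdDl pB) zbx' addr0; apply/eqP; rewrite -sqrf_eq0 eq_le sqr_ge0 andbT.
  by apply: le_trans (psd_cauchy pB _ _) _; rewrite b0 mul0r.
pose t := B b' x' / B b' b'.
have xz : x - (zx + t *: b') = x' - t *: b' by rewrite opprD addrA.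
exists (zx + t *: b').
  exists t, (zx - t *: zb); split; first by apply: lincombB => //; exact: lincombZ.
  by rewrite /b' scalerBr addrCA.
have Bt c : B c (x - (zx + t *: b')) = B c x' - t * B c b'.
  by rewrite xz (psdDr pB) -scaleNr (psdZr pB) mulNr.
move=> c; rewrite in_cons => /orP[/eqP ->|cl]; rewrite Bt.
  have -> : B b x' = B b' x' by rewrite bE (psdDl pB) zbx' addr0.
  have -> : B b b' = B b' b' by rewrite {1}bE (psdDl pB) (lincomb_orth ob hb) addr0.
  by rewrite /t divfK// subrr.
by rewrite (ox _ cl) (ob _ cl) mulr0 subr0.
Qed.

Lemma distant_far_apart c0 l : distant B c0 l -> far_apart B c0 l.
Proof.
elim: l => // b l IH [/IH h1 h2]; split => //.
have [z hz oz] := psd_project l b.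
exists (b - z), z; split; rewrite ?subrK//; last exact: h2.
by move=> i; apply: oz; exact: mem_nth.
Qed.

(* By the dual Bessel inequality, each projection step removes at most [M] from
   the total squared norm [#|J| k]. *)
Lemma greedy_distant (J : finType) (X : J -> E) (k M : R) : 0 < k -> 0 < M ->
  (forall j, B (X j) (X j) = k) ->
  (forall a : J -> R, B (\sum_j a j *: X j) (\sum_j a j *: X j) <= M * \sum_j a j ^+ 2) ->
  exists s : seq J, [/\ uniq s, distant B (k / 2) [seq X i | i <- s] &
    #|J|%:R * k <= 2 * M * (size s)%:R].
Proof.
move=> k0 M0 Xk XM.
(* Duality: the sum [S] is the pairing of [r] with the combination of coefficients [B (X j) r], so
   Cauchy-Schwarz and [XM] give [S ^+ 2 <= M * S * B r r]. *)
have bessel r : \sum_j B (X j) r ^+ 2 <= M * B r r.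
  set S := \sum_j _; have S0 : 0 <= S by apply: sumr_ge0 => j _; exact: sqr_ge0.
  have SE : S = B (\sum_j B (X j) r *: X j) r.
    by rewrite (psd_suml pB); apply: eq_bigr => j _; rewrite (psdZl pB) expr2.
  have [S00|Sp] := eqVneq S 0; first by rewrite S00 mulr_ge0 ?(ltW M0)// (psd_ge0 pB).
  have {}Sp : 0 < S by rewrite lt_neqAle eq_sym Sp.
  rewrite -(ler_pM2l Sp) -expr2 {1}SE.
  apply: le_trans (psd_cauchy pB _ _) _.
  rewrite mulrA [S * M]mulrC ler_wpM2r ?(psd_ge0 pB)//; exact: XM.
(* Invariant after [n] choices: [r j] is the residual of [X j] orthogonal to the chosen vectors, and
   the total squared norm has dropped by at most [n M]. *)
pose Q n := exists (s : seq J) (r : J -> E), [/\ uniq s, size s = n,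
  distant B (k / 2) [seq X i | i <- s],
  (forall j, lincomb [seq X i | i <- s] (X j - r j) /\
    forall b, b \in [seq X i | i <- s] -> B b (r j) = 0) &
  #|J|%:R * k - n%:R * M <= \sum_j B (r j) (r j)].
have Q0 : Q 0%N.
  exists [::], X; split => //; first by move=> j; split; rewrite ?subrr//.
  by rewrite mul0r subr0; under eq_bigr do rewrite Xk; rewrite sumr_const mulr_natl.
(* Below this threshold the residuals still total more than [#|J| k / 2], so one of them has squared
   norm at least [k / 2] and can be chosen. *)
have QS n : n%:R * (2 * M) < #|J|%:R * k -> Q n -> Q n.+1.
  move=> nk [s [r [us sn ds hr Sr]]].
  have [j hj] : exists j, k / 2 <= B (r j) (r j).
    apply: contrapT => /forallNP h.
    have : \sum_j B (r j) (r j) <= \sum_(j : J) k / 2.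
      by apply: ler_sum => j _; have /negP := h j; rewrite -ltNge => /ltW.
    have -> : \sum_(j : J) k / 2 = #|J|%:R * (k / 2) by rewrite sumr_const mulr_natl.
    move=> h2; move: (le_trans Sr h2) nk.
    by move: (#|J|%:R) (n%:R) => p q; lra.
  have k2 : 0 < k / 2 by rewrite divr_gt0.
  have rjp : 0 < B (r j) (r j) by exact: lt_le_trans hj.
  have orth z i : lincomb [seq X i | i <- s] z -> B z (r i) = 0.
    by apply: lincomb_orth => b; exact: (hr i).2.
  have XB i i' : B (X i) (r i') = B (r i) (r i').
    by rewrite -[X i](subrKC (r i)) (psdDl pB) (orth _ _ (hr i).1) addr0.
  pose c i := B (r i) (r j) / B (r j) (r j).
  exists (j :: s), (fun i => r i - c i *: r j); split => /=.
  - rewrite us andbT; apply/negP => js.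
    have : B (r j) (r j) = 0.
      rewrite {1}(_ : r j = X j - (X j - r j)); last by rewrite subKr.
      apply: orth; apply: lincombB; last exact: (hr j).1.
      by apply: lincomb_mem; exact: map_f.
    by move=> e; rewrite e ltxx in rjp.
  - by rewrite sn.
  - split => // z hz.
    have [v hv ->] : exists2 v, lincomb [seq X i | i <- s] v & X j - z = r j + v.
      exists (X j - r j - z); first by apply: lincombB => //; exact: (hr j).1.
      by rewrite addrA subrKC.
    rewrite (psdDl pB) !(psdDr pB) (psd_sym pB (r j) v) (orth _ _ hv) addr0 add0r.
    by apply: le_trans hj _; rewrite lerDl (psd_ge0 pB).
  - move=> i; split.
      exists (c i), (X i - r i - c i *: (X j - r j)); split.
        by apply: lincombB; [exact: (hr i).1|apply: lincombZ; exact: (hr j).1].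
      by rewrite scalerBr !opprB [RHS]addrCA subrKC addrA addrAC.
    move=> b; rewrite in_cons => /orP[/eqP ->|bs]; last first.
      rewrite (psdDr pB) -scaleNr (psdZr pB) !(orth b) ?mulr0 ?addr0//.
        exact: lincomb_mem.
      exact: lincomb_mem.
    rewrite (psdDr pB) -scaleNr (psdZr pB) !XB /c (psd_sym pB (r j) (r i)).
    by rewrite mulNr divfK ?subrr// gt_eqF.
  - have bE i : B (r i - c i *: r j) (r i - c i *: r j) =
        B (r i) (r i) - B (X i) (r j) ^+ 2 / B (r j) (r j).
      rewrite XB.
      rewrite -scaleNr (psdDl pB) !(psdDr pB) !(psdZl pB) !(psdZr pB) (psd_sym pB (r j) (r i)) /c.
      by field; rewrite gt_eqF.
    under eq_bigr do rewrite bE.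
    rewrite sumrB -mulr_suml.
    have : (\sum_i B (X i) (r j) ^+ 2) / B (r j) (r j) <= M by rewrite ler_pdivrMr.
    by rewrite -natr1 mulrDl mul1r; lra.
have M2 : 0 < 2 * M by rewrite mulr_gt0.
have : exists n, #|J|%:R * k <= n%:R * (2 * M) /\ Q n.
  have [N hN] : exists N : nat, #|J|%:R * k <= N%:R * (2 * M).
    exists (Num.truncn (#|J|%:R * k / (2 * M))).+1.
    by rewrite -ler_pdivrMr// ltW// truncnS_gt.
  apply: contrapT => /forallNP h.
  have QN n : Q n.
    elim: n => // n IH; apply: QS => //.
    by rewrite ltNge; apply/negP => le; exact: (h n).
  exact: (h N).
move=> [n [h [s [r [us sn ds _ _]]]]]; exists s; split => //.
by rewrite sn mulrC [_ * n%:R]mulrC [k * _]mulrC.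
Qed.

End lincomb.

(** * Tails, lower bounds and independent events *)

Section tails.
Context {R : realType} {E : lmodType R} d {T : measurableType d}.
Variables (P : probability T R) (X : E -> T -> R) (B : E -> E -> R).
Hypothesis iX : isonormal P X B.
Let pB := iso_psd iX.

Lemma pow2_between (x : R) : 1 <= x -> exists k : nat, 2 ^+ k <= x < 2 ^+ k.+1.
Proof.
move=> x1; have ex : exists k : nat, x < 2 ^+ k.
  exists (Num.truncn x).+1; apply: lt_le_trans (truncnS_gt x) _.
  by rewrite -natrX ler_nat ltnW// ltn_expl.
have [k hk kmin] := ex_minnP ex; case: k => [|k] in hk kmin *.
  by exfalso; move: hk; rewrite expr0 ltNge x1.
exists k; rewrite hk andbT leNgt; apply/negP => h.
by have := kmin _ h; rewrite ltnn.
Qed.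

(** Iterating [fernique] along levels [tau k] with [(tau k.+1 - s) / sqrt 2 = tau k]: each step
    squares 4/3 times the tail, which starts at most 1/3. The levels grow like 2^(k/2), so the decay
    is Gaussian, with constants independent of the size of the family. *)
Lemma iso_tail (I : finType) (b : I -> E) (s u : R) : 0 < s ->
  ((3 / 4)%:E <= P [set w | [forall i, (`|X (b i) w| <= s)%R]])%E -> 4 * s <= u ->
  (P (~` [set w | [forall i, (`|X (b i) w| <= u)%R]]) <= (expR (- (u / s) ^+ 2 / 64))%:E)%E.
Proof.
move=> s0 hs us.
pose A (t : R) := [set w | [forall i, `|X (b i) w| <= t]].
have mA t : measurable (A t) by exact: (iso_meas_all iX).
have mAC t : measurable (~` A t) by exact: measurableC.
pose q t := fine (P (~` A t)).
have qE t : P (~` A t) = (q t)%:E by rewrite fineK// fin_num_measure.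
have q0 t : 0 <= q t by rewrite -lee_fin -qE.
have fe t : 3 / 4 * q t <= q ((t - s) / Num.sqrt 2) ^+ 2.
  have := fernique iX b s t; rewrite -/(A s) -/(A t) -/(A _) !qE -EFin_expe.
  rewrite -lee_fin; apply: le_trans; rewrite EFinM lee_wpmul2r ?lee_fin//.
have sq2 : 0 < Num.sqrt 2 :> R by rewrite sqrtr_gt0.
have sq22 : Num.sqrt 2 ^+ 2 = 2 :> R by rewrite sqr_sqrtr.
have q1 : 4 / 3 * q s <= 3^-1.
  have : q s <= 1 / 4.
    rewrite -lee_fin -qE probability_setC// -[X in (X <= _)%E]/(1%:E - P (A s))%E.
    rewrite leeBlDr ?fin_num_measure//.
    apply: (@le_trans _ _ ((1 / 4)%:E + (3 / 4)%:E)%E); last exact: leeD2l.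
    by rewrite -EFinD lee_fin; lra.
  lra.
have qle t t' : t <= t' -> q t' <= q t.
  move=> tt'; rewrite -lee_fin -!qE le_measure ?inE//.
  apply: subsetC => w /= /forallP h; apply/forallP => i; exact: le_trans (h i) tt'.
pose tau := fix tau k : R := if k is k'.+1 then Num.sqrt 2 * tau k' + s else s.
have sq34 : 4 / 3 <= Num.sqrt 2 :> R.
  rewrite -[leLHS]ger0_norm ?divr_ge0// -sqrtr_sqr ler_sqrt//.
  by rewrite expr_div_n ler_pdivrMr ?exprn_gt0//; lra.
have taule k : tau k <= 4 * s * Num.sqrt 2 ^+ k - 3 * s.
  elim: k => [|k IH] /=; first by rewrite expr0 mulr1; lra.
  apply: (@le_trans _ _ (Num.sqrt 2 * (4 * s * Num.sqrt 2 ^+ k - 3 * s) + s)).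
    by rewrite lerD2r ler_pM2l.
  have : 4 / 3 * s <= Num.sqrt 2 * s by rewrite ler_pM2r.
  by rewrite exprS; move: (Num.sqrt 2) (Num.sqrt 2 ^+ k) => y z; lra.
have pk k : 4 / 3 * q (tau k) <= 3^-1 ^+ (2 ^ k).
  elim: k => [|k IH]; first by rewrite expn0 expr1.
  have := fe (tau k.+1); rewrite /= addrK [Num.sqrt 2 * _]mulrC mulfK ?gt_eqF// => h.
  rewrite expnS mulnC exprM.
  apply: (@le_trans _ _ ((4 / 3 * q (tau k)) ^+ 2)); first by rewrite exprMn; lra.
  by rewrite lerXn2r// ?nnegrE ?mulr_ge0// exprn_ge0.
(* The lower bound gives [tau k <= u]. The upper one gives [2^k > (u / s)^2 / 32]; with
   [1/3 <= e^(-1/2)] this yields the denominator 64. *)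
have [|k /andP[k1 k2]] := @pow2_between ((u / (4 * s)) ^+ 2).
  by apply: exprn_ege1; rewrite ler_pdivlMr ?mul1r// mulr_gt0.
have u0 : 0 <= u / (4 * s).
  by rewrite divr_ge0// ?mulr_ge0// ?(ltW s0)// (le_trans _ us)// mulr_ge0// ltW.
have tu : tau k <= u.
  apply: (le_trans (taule k)); apply: (@le_trans _ _ (4 * s * Num.sqrt 2 ^+ k)).
    by rewrite gerBl mulr_ge0// ltW.
  rewrite mulrC -ler_pdivlMr ?mulr_gt0//.
  rewrite -[leLHS]ger0_norm ?exprn_ge0// -sqrtr_sqr -[leRHS]ger0_norm// -sqrtr_sqr.
  by apply: ler_wsqrtr; rewrite -exprM mulnC exprM sq22.
rewrite qE lee_fin; apply: (le_trans (qle _ _ tu)).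
apply: (@le_trans _ _ (3^-1 ^+ (2 ^ k))); first by have := pk k; have := q0 (tau k); lra.
apply: (@le_trans _ _ (expR (- 2^-1) ^+ (2 ^ k))).
  rewrite lerXn2r ?nnegrE ?expR_ge0//.
  by apply: le_trans (expR_ge1Dx _); lra.
rewrite -expRM_natl ler_expR natrX mulrN mulNr lerN2.
move: k2; rewrite [2 ^+ k.+1]exprS !expr_div_n exprMn.
move: (2 ^+ k) => y; set z := u ^+ 2 / s ^+ 2.
have -> : u ^+ 2 / (4 ^+ 2 * s ^+ 2) = z / 16 by rewrite /z; field; rewrite gt_eqF.
lra.
Qed.

Lemma iso_chebyshev e (s : R) : 0 < s -> 4 * B e e <= s ^+ 2 ->
  ((3 / 4)%:E <= P [set w | (`|X e w| <= s)%R])%E.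
Proof.
move=> s0 sB.
have mA := iso_meas_le iX e s.
have mX := iso_meas iX e.
have : (P (~` [set w | (`|X e w| <= s)%R]) <= (1 / 4)%:E)%E.
  have s2 : 0 < s ^+ 2 by rewrite exprn_gt0.
  have mC : measurable (~` [set w | (`|X e w| <= s)%R]) by exact: measurableC.
  rewrite -(@lee_pmul2l _ (s ^+ 2)%:E)// ?lte_fin// -EFinM.
  apply: (@le_trans _ _ (B e e)%:E); last by rewrite lee_fin; lra.
  rewrite -(iso_second_moment iX) -[X in P X](setIT _) -integral_indic//.
  rewrite -ge0_integralZl//; last 2 first.
  - by apply/measurable_EFinP; apply: measurable_indic.
  - by rewrite lee_fin sqr_ge0.
  apply: ge0_le_integral => //.
  - by move=> w _; rewrite -EFinM lee_fin indicE mulr_ge0// sqr_ge0.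
  - apply/measurable_EFinP; apply: measurable_funM => //; exact: measurable_indic.
  - by apply/measurable_EFinP; exact: measurable_funX.
  - move=> w _; rewrite -EFinM lee_fin indicE in_setC.
    have -> : (w \in [set w | (`|X e w| <= s)%R]) = (`|X e w| <= s).
      by apply/idP/idP; rewrite inE.
    case: (leP `|X e w| s) => h; first by rewrite mulr0n mulr0 sqr_ge0.
    by rewrite mulr1n mulr1 -(real_normK (num_real (X e w))) lerXn2r ?nnegrE ?ltW// (lt_trans s0).
rewrite probability_setC// -[X in (X <= _)%E]/(1%:E - P _)%E.
rewrite leeBlDr ?fin_num_measure// => h.
have [p pE] : exists p, P [set w | (`|X e w| <= s)%R] = p%:E.
  by exists (fine (P [set w | (`|X e w| <= s)%R])); rewrite fineK// fin_num_measure.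
by move: h; rewrite pE -EFinD !lee_fin; lra.
Qed.

Lemma iso_lower e (r : R) : 0 < B e e -> 0 <= r ->
  (((Num.sqrt (pi *+ 2))^-1 * expR (- (r / Num.sqrt (B e e) + 1) ^+ 2 / 2))%:E <=
   P [set w | (r <= X e w)%R])%E.
Proof.
move=> Be r0; have -> : [set w | (r <= X e w)%R] = [set w | `[r, +oo[%classic (X e w)].
  by apply/seteqP; split => w /=; rewrite in_itv/= andbT.
rewrite (iso_law iX)// /gaussian_law gt_eqF ?sqrtr_gt0//.
by apply: normal_ge; rewrite ?sqrtr_gt0.
Qed.

Lemma iso_meas_ge e (r : R) : measurable [set w | (r <= X e w)%R].
Proof.
have -> : [set w | (r <= X e w)%R] = X e @^-1` `[r, +oo[%classic.
  by apply/seteqP; split => w /=; rewrite in_itv/= andbT.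
by rewrite -[X in measurable X]setTI; exact: (iso_meas iX e).
Qed.

Lemma iso_independent_event (I : finType) (b : I -> E) y (l r : R) :
  (forall i, B (b i) y = 0) ->
  P ([set w | [forall i, (`|X (b i) w| <= l)%R]] `&` [set w | (r <= X y w)%R]) =
  (P [set w | [forall i, (`|X (b i) w| <= l)%R]] * P [set w | (r <= X y w)%R])%E.
Proof.
move=> orth.
have mA := iso_meas_all iX b l; have mZ := iso_meas_ge y r.
pose F (x : I + unit -> R) := (\prod_i (`|x (inl i)| <= l)%R%:R) * (r <= x (inr tt))%R%:R : R.
have cF : mgf_class F.
  apply: mgf_mul.
    apply: mgf_prod => i; apply: (mgf_ext (mgf_norm_le (fun o => (o == inl i)%:R) l)) => x.
    rewrite /dot (bigD1 (inl i))//= eqxx mul1r big1 ?addr0// => k /negbTE ->.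
    by rewrite mul0r.
  apply: (mgf_ext (mgf_ge (fun o => (o == inr tt)%:R) r)) => x.
  rewrite /dot (bigD1 (inr tt))//= mul1r big1 ?addr0// => k /negbTE ->.
  by rewrite mul0r.
have FE v w : F (split2 X b y v w) =
    ([forall i, (`|X (b i) v| <= l)%R] && (r <= X y w)%R)%:R.
  rewrite /F /=; case: (boolP [forall i, _]) => [/forallP h|].
    by rewrite big1 ?mul1r// => i _; rewrite h.
  rewrite negb_forall => /existsP[i /negbTE h].
  by rewrite (bigD1 i)//= h !mul0r.
rewrite -product_measure1E//.
have -> : P ([set w | [forall i, (`|X (b i) w| <= l)%R]] `&` [set w | (r <= X y w)%R]) =
    (\int[P]_w (F (split2 X b y w w))%:E)%E.
  rewrite -[LHS](congr1 _ (setIT _)) -integral_indic//; last exact: measurableI.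
  by apply: eq_integral => w _; rewrite FE indicE in_setI !mem_setE.
rewrite (iso_independent iX orth cF) -[RHS](congr1 _ (setIT _)) -integral_indic//; last first.
  exact: measurableX.
by apply: eq_integral => -[v w] _; rewrite FE indicE in_setX/= !mem_setE.
Qed.

End tails.

(** * Stationary fields and their spectral form *)

Section fine_integral.
Context {R : realType} d {T : measurableType d}.
Variable m : {measure set T -> \bar R}.

Lemma fine_integralZ (c : R) (g : T -> R) : m.-integrable setT (EFin \o g) ->
  fine (\int[m]_x (c * g x)%:E)%E = c * fine (\int[m]_x (g x)%:E)%E.
Proof.
move=> ig; under eq_integral do rewrite EFinM.
by rewrite integralZl// fineM// integrable_fin_num.
Qed.

Lemma fine_integralD (g h : T -> R) : m.-integrable setT (EFin \o g) ->
  m.-integrable setT (EFin \o h) -> fine (\int[m]_x (g x + h x)%:E)%E =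
  fine (\int[m]_x (g x)%:E)%E + fine (\int[m]_x (h x)%:E)%E.
Proof.
move=> ig ih; under eq_integral do rewrite EFinD.
by rewrite integralD// fineD// integrable_fin_num.
Qed.

Lemma integrable_EFinZ (c : R) (g : T -> R) : m.-integrable setT (EFin \o g) ->
  m.-integrable setT (fun x => (c * g x)%:E).
Proof. by move=> ig; under eq_fun do rewrite EFinM; exact: integrableZl. Qed.

Lemma integrable_EFin_sum (I : Type) (s : seq I) (g : I -> T -> R) :
  (forall i, m.-integrable setT (EFin \o g i)) ->
  m.-integrable setT (fun x => (\sum_(i <- s) g i x)%:E).
Proof. by move=> ig; under eq_fun do rewrite -sumEFin; apply: integrable_sum => // i _; exact: ig. Qed.

Lemma fine_integral_sum (I : Type) (s : seq I) (g : I -> T -> R) :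
  (forall i, m.-integrable setT (EFin \o g i)) ->
  fine (\int[m]_x (\sum_(i <- s) g i x)%:E)%E = \sum_(i <- s) fine (\int[m]_x (g i x)%:E)%E.
Proof.
move=> ig; elim: s => [|i s IH].
  by under eq_integral do rewrite big_nil; rewrite integral0 big_nil.
under eq_integral do rewrite big_cons.
by rewrite fine_integralD// ?IH ?big_cons//; exact: integrable_EFin_sum.
Qed.

Lemma fine_integral_quad (I : finType) (a b : I -> R) (g : I -> I -> T -> R) :
  (forall i j, m.-integrable setT (EFin \o g i j)) ->
  fine (\int[m]_x (\sum_i \sum_j a i * b j * g i j x)%:E)%E =
  \sum_i \sum_j a i * b j * fine (\int[m]_x (g i j x)%:E)%E.
Proof.
move=> ig; rewrite fine_integral_sum => [|i]; last first.
  by apply: integrable_EFin_sum => j; exact: integrable_EFinZ.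
apply: eq_bigr => i _; rewrite fine_integral_sum => [|j]; last exact: integrable_EFinZ.
by apply: eq_bigr => j _; exact: fine_integralZ.
Qed.

End fine_integral.

Section field_covariance.
Context {R : realType} {dOm : measure_display} {Om : measurableType dOm}.
Variables (P : probability Om R) (V : zmodType) (f : V -> {RV P >-> R}).
Hypothesis gf : gaussian_field f.
Hypothesis cf : centred f.
Hypothesis sf : stationary f.

Definition sample (I : finType) (x : I -> V) (w : Om) (i : I) : R := f (x i) w.

Lemma measurable_sample (I : finType) (x : I -> V) i :
  measurable_fun setT (fun w => sample x w i).
Proof. exact: measurable_funP. Qed.

Lemma field_law (I : finType) (x : I -> V) (a : I -> R) : exists m s,
  forall A : set R, measurable A -> P [set w | A (dot a (sample x w))] = gaussian_law m s A.
Proof.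
have [m [s H]] := gf (fun i : 'I_#|I| => x (enum_val i)) (fun i => a (enum_val i)).
exists m, s => A mA; rewrite -H//; congr (P _).
have E w : dot a (sample x w) = \sum_(i < #|I|) a (enum_val i) * f (x (enum_val i)) w.
  by rewrite /dot (big_enum_val (A := I) (fun i => a i * sample x w i)).
by apply/seteqP; split => w /=; rewrite E.
Qed.

Lemma sample_mgf_lty (I : finType) (x : I -> V) a :
  (\int[P]_w (expR (dot a (sample x w)))%:E < +oo)%E.
Proof.
have [m [s H]] := field_law x a.
have := gaussian_law_mgf (measurable_dot (measurable_sample x) a) H 1.
by under eq_integral do rewrite mul1r; move=> ->; rewrite ltry.
Qed.

Lemma sample_integrable (I : finType) (x : I -> V) F : mgf_class F ->
  P.-integrable setT (fun w => (F (sample x w))%:E).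
Proof. exact: (mgf_integrable (measurable_sample x) (sample_mgf_lty x)). Qed.

Lemma mgf_coord (I : finType) (i : I) : mgf_class (fun x : I -> R => x i).
Proof.
apply: (mgf_ext (mgf_dot (fun j => (j == i)%:R))) => x.
by rewrite /dot (bigD1 i)//= eqxx mul1r big1 ?addr0// => j /negbTE ->; rewrite mul0r.
Qed.

Lemma sample_mean (I : finType) (x : I -> V) a : (\int[P]_w (dot a (sample x w))%:E = 0)%E.
Proof.
under eq_integral do rewrite /dot -sumEFin.
have ic i : P.-integrable setT (fun w => (sample x w i)%:E).
  exact: (sample_integrable x (mgf_coord i)).
rewrite integral_sum//.
  rewrite big1// => i _; under eq_integral do rewrite EFinM.
  rewrite integralZl//.
  have := cf (x i); rewrite unlock /sample => e.
  by rewrite [X in (_ * X)%E]e mule0.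
by move=> i; under eq_fun do rewrite EFinM; exact: integrableZl.
Qed.

Lemma field_law_variance (I : finType) (x : I -> V) (a : I -> R) (A : set R) : measurable A ->
  P [set w | A (dot a (sample x w))] =
  gaussian_law 0 (Num.sqrt (fine (\int[P]_w (dot a (sample x w) ^+ 2)%:E)%E)) A.
Proof.
move=> mA; have [m [s H]] := field_law x a.
have mX := measurable_dot (measurable_sample x) a.
have m0 : m = 0.
  apply: (gaussian_centred mX H); first exact: sample_mean.
  exact: (sample_integrable x (mgf_dot a)).
rewrite {}m0 in H; rewrite (gaussian_second_moment mX H)/= sqrtr_sqr H//.
by rewrite /gaussian_law normr_eq0 normal_prob_norm.
Qed.

Definition cov (x y : V) : R := fine (\int[P]_w (f x w * f y w)%:E)%E.

Lemma cov_integrable x y : P.-integrable setT (fun w => (f x w * f y w)%:E).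
Proof.
exact: (sample_integrable (fun b : bool => if b then x else y)
  (mgf_mul (mgf_coord true) (mgf_coord false))).
Qed.

(** Stationarity is available on rectangles only. They form a generating pi-system, so the joint
    laws of the two pairs agree, and the product is integrated against them. *)
Lemma cov_shift h x y : cov (x + h) (y + h) = cov x y.
Proof.
rewrite /cov; congr (fine _).
pose g (u v : V) (w : Om) := (f u w, f v w).
have mg u v : measurable_fun setT (g u v) by apply: measurable_fun_pair; exact: measurable_funP.
have E u v : (\int[P]_w (f u w * f v w)%:E = \int[pushforward P (g u v)]_z (z.1 * z.2)%:E)%E.
  rewrite integral_pushforward//=; first by apply/measurable_EFinP; exact: measurable_funM.
  exact: cov_integrable.
rewrite !E; apply: eq_measure_integral => A mA _.
pose C : set (set (R * R)) :=
  [set C | exists A, measurable A /\ exists B, measurable B /\ C = A `*` B].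
apply: (measure_unique C (fun=> setT)) => //.
- rewrite measurable_prod_measurableType //; congr (<<s _ >>).
  rewrite predeqE; split => [[A' mA' [B mB <-]]|[A' [mA' [B [mB ->]]]]].
    by exists A'; split => //; exists B.
  by exists A' => //; exists B.
- move=> /= _ _ [X1 [mX1 [X2 [mX2 ->]]]] [Y1 [mY1 [Y2 [mY2 ->]]]].
  rewrite -setXI; exists (X1 `&` Y1); split; first exact: measurableI.
  by exists (X2 `&` Y2); split => //; exact: measurableI.
- by move=> _; exists setT; split => //; exists setT; split => //; rewrite setXTT.
- by rewrite bigcup_const//; exists 0%N.
- move=> _ [A1 [mA1 [A2 [mA2 ->]]]].
  pose p (i : 'I_2) := if i == ord0 then x else y.
  pose D (i : 'I_2) := if i == ord0 then A1 else A2.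
  have mD i : measurable (D i) by rewrite /D; case: ifP.
  have F u v : pushforward P (g u v) (A1 `*` A2) =
     P [set w | forall i : 'I_2, D i (f (if i == ord0 then u else v) w)].
    congr (P _); apply/seteqP; split => w /=.
      by move=> [h1 h2] i; rewrite /D; case: ifP.
    by move=> q; split; [have := q ord0|have := q ord_max].
  etransitivity; first exact: F.
  etransitivity; last by symmetry; exact: F.
  have := sf h p mD; rewrite /p => H.
  rewrite -H; congr (P _); apply/seteqP; split => w /= q i; have := q i; by case: ifP.
- move=> _; change (P (g (x + h)%R (y + h)%R @^-1` setT) < +oo)%E.
  by rewrite preimage_setT probability_setT ltry.
Qed.

Lemma covE x y : cov x y = cov_kernel f (y - x).
Proof.
by have := cov_shift x 0 (y - x); rewrite add0r subrK => ->; rewrite /cov /cov_kernel unlock.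
Qed.

End field_covariance.

(** * Trigonometric symbols and the spectral quadratic form *)

Section spectral_form.
Context {R : realType} {dL : measure_display} {L : measurableType dL} {V : zmodType}.
Variable phase : V -> L -> R.
Hypothesis mphase : forall x, measurable_fun setT (phase x).
Hypothesis phaseD : forall x y l, phase (x + y) l = phase x l + phase y l.

(** With [ssym], the real and imaginary parts of the symbol
    [sum_i a_i exp (2 i pi phase (x_i) l)]. *)
Definition csym (I : finType) (x : I -> V) (a : I -> R) (l : L) : R :=
  \sum_i a i * cos (2 * pi * phase (x i) l).
Definition ssym (I : finType) (x : I -> V) (a : I -> R) (l : L) : R :=
  \sum_i a i * sin (2 * pi * phase (x i) l).

(** The real part of the L2(nu) product of two symbols. The type [R^o] makes families of
    coefficients a module, which serves as the index space of an isonormal process. *)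
Definition spectral_form (nu : {finite_measure set L -> \bar R}) (I : finType) (x : I -> V)
    (a b : I -> R^o) : R :=
  fine (\int[nu]_l (csym x a l * csym x b l + ssym x a l * ssym x b l)%:E)%E.

Lemma phase0 l : phase 0 l = 0.
Proof. by have := phaseD 0 0 l; rewrite addr0 => /eqP; rewrite -subr_eq subrr => /eqP. Qed.

Lemma phaseN x l : phase (- x) l = - phase x l.
Proof.
have := phaseD (- x) x l; rewrite addNr phase0 => /eqP.
by rewrite eq_sym addr_eq0 => /eqP.
Qed.

Lemma phaseB x y l : phase (x - y) l = phase x l - phase y l.
Proof. by rewrite phaseD phaseN. Qed.

Lemma measurable_cos_phase x : measurable_fun setT (fun l => cos (2 * pi * phase x l)).
Proof.
apply: measurableT_comp; first exact: continuous_measurable_fun (@continuous_cos R).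
by apply: measurable_funM => //; exact: measurable_cst.
Qed.

Lemma measurable_sin_phase x : measurable_fun setT (fun l => sin (2 * pi * phase x l)).
Proof.
apply: measurableT_comp; first exact: continuous_measurable_fun (@continuous_sin R).
by apply: measurable_funM => //; exact: measurable_cst.
Qed.

Lemma measurable_csym (I : finType) (x : I -> V) a : measurable_fun setT (csym x a).
Proof.
apply: measurable_sum => i; apply: measurable_funM; first exact: measurable_cst.
exact: measurable_cos_phase.
Qed.

Lemma measurable_ssym (I : finType) (x : I -> V) a : measurable_fun setT (ssym x a).
Proof.
apply: measurable_sum => i; apply: measurable_funM; first exact: measurable_cst.
exact: measurable_sin_phase.
Qed.

Lemma csym_le (I : finType) (x : I -> V) a l : `|csym x a l| <= \sum_i `|a i|.
Proof.
apply: le_trans (ler_norm_sum _ _ _) _; apply: ler_sum => i _.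
by rewrite normrM ler_piMr// cos_max.
Qed.

Lemma ssym_le (I : finType) (x : I -> V) a l : `|ssym x a l| <= \sum_i `|a i|.
Proof.
apply: le_trans (ler_norm_sum _ _ _) _; apply: ler_sum => i _.
by rewrite normrM ler_piMr// sin_max.
Qed.

(** The symbol of a convolution is the product of the symbols; this is its real part, and
    [ssym_prod] gives the imaginary one. *)
Lemma csym_prod (I J : finType) (q1 : I -> R) (q2 : J -> R) (y1 : I -> V) (y2 : J -> V) l :
  csym (fun o : I * J => y1 o.1 + y2 o.2) (fun o => q1 o.1 * q2 o.2) l =
  csym y1 q1 l * csym y2 q2 l - ssym y1 q1 l * ssym y2 q2 l.
Proof.
rewrite /csym /ssym -(pair_bigA _ (fun i j => q1 i * q2 j * cos (2 * pi * phase (y1 i + y2 j) l)))/=.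
rewrite !mulr_suml -sumrB; apply: eq_bigr => i _; rewrite !mulr_sumr -sumrB.
by apply: eq_bigr => j _; rewrite phaseD mulrDr cosD; ring.
Qed.

Lemma ssym_prod (I J : finType) (q1 : I -> R) (q2 : J -> R) (y1 : I -> V) (y2 : J -> V) l :
  ssym (fun o : I * J => y1 o.1 + y2 o.2) (fun o => q1 o.1 * q2 o.2) l =
  ssym y1 q1 l * csym y2 q2 l + csym y1 q1 l * ssym y2 q2 l.
Proof.
rewrite /csym /ssym -(pair_bigA _ (fun i j => q1 i * q2 j * sin (2 * pi * phase (y1 i + y2 j) l)))/=.
rewrite !mulr_suml -big_split; apply: eq_bigr => i _; rewrite !mulr_sumr -big_split.
by apply: eq_bigr => j _; rewrite /= phaseD mulrDr sinD; ring.
Qed.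

Lemma bounded_integrable (nu : {finite_measure set L -> \bar R}) (g : L -> R) (M : R) :
  measurable_fun setT g -> (forall l, `|g l| <= M) -> nu.-integrable setT (fun l => (g l)%:E).
Proof.
move=> mg gM; apply: (@le_integrable _ _ _ _ _ measurableT _ (cst M%:E)).
- exact/measurable_EFinP.
- by move=> l _; rewrite !abse_EFin lee_fin (le_trans (gM l))// ler_norm.
- exact: finite_measure_integrable_cst.
Qed.

Variable nu : {finite_measure set L -> \bar R}.

Lemma form_integrable (I : finType) (x : I -> V) (a b : I -> R) :
  nu.-integrable setT (fun l => (csym x a l * csym x b l + ssym x a l * ssym x b l)%:E).
Proof.
apply: (@bounded_integrable _ _ ((\sum_i `|a i|) * (\sum_i `|b i|) + (\sum_i `|a i|) * (\sum_i `|b i|))).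
  by apply: measurable_funD; apply: measurable_funM;
    (exact: measurable_csym || exact: measurable_ssym).
move=> l; apply: le_trans (ler_normD _ _) _; rewrite !normrM.
by apply: lerD; apply: ler_pM; rewrite ?csym_le ?ssym_le.
Qed.

Lemma csymZD (I : finType) (x : I -> V) t (a b : I -> R^o) l :
  csym x (t *: a + b) l = t * csym x a l + csym x b l.
Proof.
rewrite /csym mulr_sumr -big_split/=; apply: eq_bigr => i _.
by rewrite mulrDl mulrA.
Qed.

Lemma ssymZD (I : finType) (x : I -> V) t (a b : I -> R^o) l :
  ssym x (t *: a + b) l = t * ssym x a l + ssym x b l.
Proof.
rewrite /ssym mulr_sumr -big_split/=; apply: eq_bigr => i _.
by rewrite mulrDl mulrA.
Qed.

Lemma spectral_psd (I : finType) (x : I -> V) : psd_form (spectral_form nu x).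
Proof.
split=> [a b|t a b c|a]; rewrite /spectral_form.
- by congr (fine _); apply: eq_integral => l _; congr (_%:E); ring.
- rewrite -fine_integralZ; last exact: form_integrable.
  rewrite -fine_integralD; last 2 first.
  + apply: integrable_EFinZ; exact: form_integrable.
  + exact: form_integrable.
  by congr (fine _); apply: eq_integral => l _; rewrite csymZD ssymZD; congr (_%:E); ring.
- apply: fine_ge0; apply: integral_ge0 => l _.
  by rewrite lee_fin -!expr2 addr_ge0// sqr_ge0.
Qed.

Lemma sym_quad (I : finType) (x : I -> V) (a b : I -> R) l :
  csym x a l * csym x b l + ssym x a l * ssym x b l =
  \sum_i \sum_j a i * b j * cos (2 * pi * phase (x j - x i) l).
Proof.
rewrite /csym /ssym !mulr_suml -big_split/=; apply: eq_bigr => i _.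
rewrite !mulr_sumr -big_split/=; apply: eq_bigr => j _.
by rewrite phaseB mulrBr cosB; ring.
Qed.

Lemma cos_integrable x : nu.-integrable setT (fun l => (cos (2 * pi * phase x l))%:E).
Proof. by apply: (@bounded_integrable _ _ 1); [exact: measurable_cos_phase|move=> l; exact: cos_max]. Qed.

Lemma spectral_formE (I : finType) (x : I -> V) (a b : I -> R) :
  spectral_form nu x a b = \sum_i \sum_j a i * b j *
    fine (\int[nu]_l (cos (2 * pi * phase (x j - x i) l))%:E)%E.
Proof.
rewrite /spectral_form; under eq_integral do rewrite sym_quad.
rewrite (fine_integral_quad _ _ (g := fun i j l => cos (2 * pi * phase (x j - x i) l)))//.
by move=> i j; exact: cos_integrable.
Qed.

End spectral_form.

Section field_isonormal.
Context {R : realType} {dOm : measure_display} {Om : measurableType dOm}.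
Context {dL : measure_display} {L : measurableType dL} {V : zmodType}.
Variables (P : probability Om R) (f : V -> {RV P >-> R}).
Hypothesis Sf : SGF f.
Variable phase : V -> L -> R.
Hypothesis mphase : forall x, measurable_fun setT (phase x).
Hypothesis phaseD : forall x y l, phase (x + y) l = phase x l + phase y l.
Variable mu : {finite_measure set L -> \bar R}.
Hypothesis Kmu : forall x, cov_kernel f x = fine (\int[mu]_l (cos (2 * pi * phase x l))%:E)%E.

Definition combination (I : finType) (x : I -> V) (a : I -> R^o) (w : Om) : R :=
  \sum_i a i * f (x i) w.

(** A combination of values is centred Gaussian with its second moment as variance; stationarity and
    the spectral representation turn this moment into the form. *)
Lemma field_isonormal (I : finType) (x : I -> V) :
  isonormal P (combination x) (spectral_form phase mu x).
Proof.
have [gf cf sf _] := Sf.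
split.
- exact: spectral_psd.
- by move=> a; exact: (measurable_dot (measurable_sample f x)).
- move=> t a b w; rewrite /combination mulr_sumr -big_split/=; apply: eq_bigr => i _.
  by rewrite mulrDl mulrA.
- move=> a A mA; rewrite (field_law_variance gf cf x a mA); congr (gaussian_law _ (Num.sqrt _) _).
  rewrite spectral_formE//.
  transitivity (fine (\int[P]_w (\sum_i \sum_j a i * a j * (f (x i) w * f (x j) w))%:E)%E).
    congr (fine _); apply: eq_integral => w _; rewrite expr2 /dot mulr_suml.
    congr (_%:E); apply: eq_bigr => i _; rewrite mulr_sumr; apply: eq_bigr => j _.
    by rewrite /sample; ring.
  rewrite (fine_integral_quad _ _ (g := fun i j w => f (x i) w * f (x j) w)); last first.
    by move=> i j; exact: (cov_integrable gf).
  apply: eq_bigr => i _; apply: eq_bigr => j _; congr (_ * _).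
  by rewrite -Kmu -(covE gf sf).
Qed.

End field_isonormal.

(** * Quantitative persistence bounds *)

Lemma prod_count {R : comRingType} {T : Type} (a : pred T) (M : R) (s : seq T) :
  \prod_(i <- s) (1 + M * (a i)%:R) = (1 + M) ^+ count a s.
Proof.
elim: s => [|i s IH]; first by rewrite big_nil expr0.
rewrite big_cons IH/=; case: (a i); first by rewrite mulr1 exprS.
by rewrite mulr0 addr0 mul1r.
Qed.

Lemma ler_sum_uniq {R : numDomainType} {J : finType} (s : seq J) (g : J -> R) :
  uniq s -> (forall j, 0 <= g j) -> \sum_(j <- s) g j <= \sum_j g j.
Proof.
move=> us g0; rewrite big_uniq//= [leRHS](bigID [in s])/= lerDl.
exact: sumr_ge0.
Qed.

Lemma count_large_le {R : realDomainType} {J : Type} (s : seq J) (g : J -> R) (t : R) :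
  (forall j, 0 <= g j) ->
  t * (count (fun j => ~~ (g j <= t)) s)%:R <= \sum_(j <- s) g j.
Proof.
move=> g0; elim: s => [|j s IH]; first by rewrite big_nil mulr0.
rewrite big_cons/= natrD mulrDr lerD//.
by case: (leP (g j) t) => h; rewrite ?mulr0// mulr1 ltW.
Qed.

Lemma measurable_sumnonneg {R : realType} {d} {T : measurableType d} (I : finType)
    (g : I -> T -> R) (t : R) : (forall i, measurable_fun setT (g i)) ->
  measurable [set w | (forall i, 0 <= g i w) /\ \sum_i g i w <= t].
Proof.
move=> mg; have -> : [set w | (forall i, 0 <= g i w) /\ \sum_i g i w <= t] =
   (\bigcap_(i in [set: I]) (g i @^-1` `[0, +oo[%classic)) `&`
   ((fun w => \sum_i g i w) @^-1` `]-oo, t]%classic).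
  apply/seteqP; split => w /= [h1 h2]; split; move: h2; rewrite ?in_itv//= => h2.
    by move=> i _ /=; rewrite in_itv/= andbT.
  by move=> i; have := h1 i Logic.I; rewrite /= in_itv/= andbT.
apply: measurableI.
  apply: (fin_bigcap_measurable finite_finset) => i _.
  by rewrite -[X in measurable X]setTI; exact: mg.
by rewrite -[X in measurable X]setTI; apply: measurable_sum.
Qed.

Section quantitative.
Context {R : realType} {dOm : measure_display} {Om : measurableType dOm}.
Context {dL : measure_display} {L : measurableType dL} {V : zmodType}.
Variables (P : probability Om R) (f : V -> {RV P >-> R}).
Hypothesis Sf : SGF f.
Variable phase : V -> L -> R.
Hypothesis mphase : forall x, measurable_fun setT (phase x).
Hypothesis phaseD : forall x y l, phase (x + y) l = phase x l + phase y l.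
Variable mu : {finite_measure set L -> \bar R}.
Hypothesis Kmu : forall x, cov_kernel f x = fine (\int[mu]_l (cos (2 * pi * phase x l))%:E)%E.

Let fiso (I : finType) (x : I -> V) := field_isonormal Sf mphase phaseD Kmu x.
Local Notation form := (spectral_form phase mu).

Definition unitv (I : finType) (i : I) : I -> R^o := fun j => (j == i)%:R.

Lemma sum_unitv (I : finType) (i : I) (g : I -> R) : \sum_j unitv i j * g j = g i.
Proof.
rewrite (bigD1 i)//= /unitv eqxx mul1r big1 ?addr0// => j /negbTE ->.
by rewrite mul0r.
Qed.

Lemma combination_unitv (I : finType) (x : I -> V) i w :
  combination f x (unitv i) w = f (x i) w.
Proof. exact: sum_unitv. Qed.

Lemma csym_unitv (I : finType) (x : I -> V) i l :
  csym phase x (unitv i) l = cos (2 * pi * phase (x i) l).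
Proof. exact: sum_unitv. Qed.

Lemma ssym_unitv (I : finType) (x : I -> V) i l :
  ssym phase x (unitv i) l = sin (2 * pi * phase (x i) l).
Proof. exact: sum_unitv. Qed.

Lemma form_unitv (nu : {finite_measure set L -> \bar R}) (I : finType) (x : I -> V) i :
  spectral_form phase nu x (unitv i) (unitv i) = fine (nu setT).
Proof.
rewrite /spectral_form; congr (fine _).
under eq_integral do rewrite csym_unitv ssym_unitv -!expr2 cos2Dsin2.
by rewrite integral_cst// mul1e.
Qed.

Lemma measurable_nonneg (x : V) : measurable [set w | 0 <= f x w].
Proof.
have -> : [set w | 0 <= f x w] = f x @^-1` `[0, +oo[%classic.
  by apply/seteqP; split => w /=; rewrite in_itv/= andbT.
by rewrite -[X in measurable X]setTI; exact: (measurable_funP (f x)).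
Qed.

Lemma shift_bounded (n : nat) (u : 'I_n -> V) (h : V) (s : R) :
  P [set w | [forall i, (`|f (u i + h)%R w| <= s)%R]] =
  P [set w | [forall i, (`|f (u i) w| <= s)%R]].
Proof.
have [_ _ sf _] := Sf.
have := sf h n u (fun=> `[(- s), s]%classic) (fun=> measurable_itv _) => H.
rewrite (_ : [set w | [forall i, (`|f (u i + h)%R w| <= s)%R]] =
  [set w | forall i, `[(- s), s]%classic (f (u i + h) w)]); last first.
  by apply/seteqP; split => w /= => [/forallP q i|q]; [|apply/forallP => i];
    have := q i; rewrite /= in_itv/= ler_norml.
rewrite H; congr (P _).
by apply/seteqP; split => w /= => [q|/forallP q i]; [apply/forallP => i|];
  have := q i; rewrite /= in_itv/= ler_norml.
Qed.

Lemma prob_union_le (I : finType) (A : I -> set Om) : (forall i, measurable (A i)) ->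
  (P (\bigcup_(i in [set: I]) A i) <= \sum_(i : I) P (A i))%E.
Proof.
move=> mA.
have key (s : seq I) : measurable (\big[setU/set0]_(i <- s) A i) /\
    (P (\big[setU/set0]_(i <- s) A i) <= \sum_(i <- s) P (A i))%E.
  elim: s => [|i s [IHm IH]]; first by rewrite !big_nil measure0.
  rewrite !big_cons; split; first exact: measurableU.
  by apply: le_trans (measureU2 _ _ _) _ => //; exact: leeD2l.
have [mU H] := key (index_enum I); apply: le_trans H.
rewrite le_measure ?inE//; first exact: (fin_bigcup_measurable finite_finset).
by move=> w [i _ h]; rewrite -bigcup_seq; exists i => //=; rewrite mem_index_enum.
Qed.

Lemma prob_setC_le (A : set Om) (a : R) : measurable A ->
  (a%:E <= P A)%E -> (P (~` A) <= (1 - a)%:E)%E.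
Proof.
move=> mA; have [t tE] : exists t, P A = t%:E by exists (fine (P A)); rewrite fineK// fin_num_measure.
by rewrite probability_setC// tE -EFinB !lee_fin lerD2l lerN2.
Qed.

Lemma prob_setC_ge (A : set Om) (a : R) : measurable A ->
  (P (~` A) <= a%:E)%E -> ((1 - a)%:E <= P A)%E.
Proof.
move=> mA; have [t tE] : exists t, P A = t%:E by exists (fine (P A)); rewrite fineK// fin_num_measure.
by rewrite probability_setC// tE -EFinB !lee_fin; lra.
Qed.

(** * Lower bound for nonnegativity on translates of one cell *)

Section lower.
Variables (N : nat) (x : 'I_N -> V) (u : nat -> V) (I : finType) (q : I -> R) (y : I -> V).
Variables (s0 l h0 : R).
Hypothesis s0_gt0 : 0 < s0.
Hypothesis Hs0 : forall n, ((3 / 4)%:E <= P [set w | [forall i : 'I_n, (`|f (u i) w| <= s0)%R]])%E.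
Hypothesis Hl : 8 * s0 <= l.
Hypothesis HN : N%:R * expR (- (l / 2 / s0) ^+ 2 / 64) <= 1 / 4.
Hypothesis HK : 16 * fine (mu setT) <= l ^+ 2.
Hypothesis Hmu : 0 < fine (mu setT).
Hypothesis ssym0 : forall z, ssym phase y q z = 0.
Hypothesis h0_gt0 : 0 < h0.
Hypothesis Hh : forall m i, h0 <= fine (\int[mu]_z (csym phase y q z *
  cos (2 * pi * phase (x m + u i) z))%:E)%E.
Let v := fine (\int[mu]_z (csym phase y q z ^+ 2)%:E)%E.

(* With [Z] the field averaged against [q], [f - (h / v) Z] is independent of [Z]
   and bounded by [l] with probability at least 1/2, while [h Z / v >= l] as soon
   as [Z >= v l / h0]. *)
Lemma grid_nonneg_lower n : 0 < v ->
  ((2^-1 * ((Num.sqrt (pi *+ 2))^-1 * expR (- (Num.sqrt v * l / h0 + 1) ^+ 2 / 2)))%:E <=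
   P [set w | forall (m : 'I_N) (i : 'I_n), (0 <= f (x m + u i) w)%R])%E.
Proof.
move=> v0; have l0 : 0 < l by apply: lt_le_trans Hl; rewrite mulr_gt0.
pose J := ('I_N * 'I_n)%type.
pose p (o : J + I) : V := match o with inl (m, i) => x m + u i | inr i => y i end.
have iX := fiso p; have pB := iso_psd iX; set X := combination f p in iX *; set B := form p in iX pB *.
pose z : J + I -> R^o := fun o => if o is inr i then q i else 0.
have zc a : csym phase p z a = csym phase y q a.
  by rewrite /csym big_sumType/= big1 ?add0r// => j _; rewrite mul0r.
have zs a : ssym phase p z a = 0.
  by rewrite -[RHS](ssym0 a) /ssym big_sumType/= big1 ?add0r// => j _; rewrite mul0r.
have Bzz : B z z = v.
  rewrite /B /spectral_form /v; congr (fine _); apply: eq_integral => a _.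
  by rewrite zc zs mulr0 addr0.
pose e (j : J) : J + I -> R^o := unitv (inl j).
pose h (j : J) := B (e j) z.
have hE (j : J) : h0 <= h j.
  apply: le_trans (Hh j.1 j.2) _; rewrite /h /B /spectral_form le_eqVlt; apply/orP; left.
  apply/eqP; congr (fine _); apply: eq_integral => a _.
  by rewrite csym_unitv zc zs mulr0 addr0 mulrC; case: j.
have Bee j : B (e j) (e j) = fine (mu setT) by exact: form_unitv.
have hv j : h j ^+ 2 <= fine (mu setT) * v.
  by apply: le_trans (psd_cauchy pB _ _) _; rewrite Bee Bzz.
pose b (j : J) : J + I -> R^o := e j - (h j / v) *: z.
have bz j : B (b j) z = 0.
  by rewrite /b -scaleNr (psdDl pB) (psdZl pB) Bzz -/(h j) mulNr divfK ?subrr// gt_eqF.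
have Xb j w : X (b j) w = X (e j) w - h j / v * X z w.
  by rewrite /b -scaleNr (isoD iX) (isoZ iX) mulNr.
have Xe j w : X (e j) w = f (x j.1 + u j.2) w.
  by rewrite /X combination_unitv; case: j.
pose r := v * l / h0.
have r0 : 0 <= r by rewrite divr_ge0 ?mulr_ge0 ?(ltW l0) ?(ltW v0) ?(ltW h0_gt0).
have sv0 : 0 < Num.sqrt v by rewrite sqrtr_gt0.
pose G := [set w | [forall j, (`|X (b j) w| <= l)%R]] `&` [set w | (r <= X z w)%R].
have mG : measurable G.
  by apply: measurableI; [exact: (iso_meas_all iX)|exact: (iso_meas_ge iX)].
have mT : measurable [set w | forall (m : 'I_N) (i : 'I_n), (0 <= f (x m + u i) w)%R].
  have -> : [set w | forall (m : 'I_N) (i : 'I_n), (0 <= f (x m + u i) w)%R] =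
     \bigcap_(j in [set: J]) [set w | (0 <= f (x j.1 + u j.2) w)%R].
    apply/seteqP; split => w /=; first by move=> H j _; exact: H.
    by move=> H m i; exact: (H (m, i)).
  by apply: (fin_bigcap_measurable finite_finset) => j _; exact: measurable_nonneg.
apply: (@le_trans _ _ (P G)); last first.
  rewrite le_measure ?inE// => w [/= /forallP hb hr] m i.
  have := hb (m, i); rewrite Xb Xe/= ler_norml => /andP[h1 _].
  have : l <= h (m, i) / v * X z w.
    apply: (@le_trans _ _ (h0 / v * r)).
      rewrite /r (_ : h0 / v * (v * l / h0) = l)//.
      by field; rewrite !gt_eqF.
    apply: ler_pM => //; first by rewrite divr_ge0 ?(ltW v0) ?(ltW h0_gt0).
    by rewrite ler_wpM2r// invr_ge0 ltW.
  by move: h1; lra.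
rewrite /G (iso_independent_event iX)// EFinM; apply: lee_pmul.
- by rewrite lee_fin.
- by rewrite lee_fin mulr_ge0 ?expR_ge0.
(* Since [h / v <= sqrt (mu / v)] by Cauchy-Schwarz, [|Z| <= s] gives [(h / v) |Z| <= l / 2]. This
   fails with probability at most 1/4 by Chebyshev ([HK]), and [|f| <= l / 2] on the grid fails with
   at most 1/4 by the tail on each cell ([HN]). *)
- pose s := l / 2 * Num.sqrt (v / fine (mu setT)).
  have vm0 : 0 < v / fine (mu setT) by rewrite divr_gt0.
  have s_gt0 : 0 < s by rewrite mulr_gt0 ?divr_gt0// sqrtr_gt0.
  pose S := [set w | (`|X z w| <= s)%R].
  pose F m := [set w | [forall i : 'I_n, (`|X (e (m, i)) w| <= l / 2)%R]].
  have mS : measurable S by exact: (iso_meas_le iX).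
  have mF m : measurable (F m) by exact: (iso_meas_all iX).
  have PS : ((3 / 4)%:E <= P S)%E.
    apply: (iso_chebyshev iX) => //; rewrite Bzz /s exprMn sqr_sqrtr ?(ltW vm0)//.
    rewrite mulrA ler_pdivlMr// -subr_ge0.
    have -> : (l / 2) ^+ 2 * v - 4 * v * fine (mu setT) = v / 4 * (l ^+ 2 - 16 * fine (mu setT)).
      by field.
    by rewrite mulr_ge0 ?divr_ge0 ?(ltW v0)// subr_ge0.
  have PF m : (P (~` F m) <= (expR (- (l / 2 / s0) ^+ 2 / 64))%:E)%E.
    apply: (iso_tail iX (b := fun i : 'I_n => e (m, i))) => //.
      apply: le_trans (Hs0 n) _; rewrite -(shift_bounded _ (x m)).
      by under eq_set do under eq_forallb do rewrite addrC -(Xe (m, _)).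
    by move: Hl; lra.
  have mA : measurable [set w | [forall j, (`|X (b j) w| <= l)%R]] by exact: (iso_meas_all iX).
  have sub : ~` [set w | [forall j, (`|X (b j) w| <= l)%R]] `<=`
      ~` S `|` \bigcup_(m in [set: 'I_N]) ~` F m.
    move=> w /=; apply: contra_notP => /not_orP[/contrapT hS hF].
    apply/forallP => -[m i]; rewrite Xb.
    have hSw : `|h (m, i) / v * X z w| <= l / 2.
      rewrite normrM; apply: (@le_trans _ _ (Num.sqrt (fine (mu setT) / v) * s)).
        apply: ler_pM => //.
        rewrite -sqrtr_sqr; apply: ler_wsqrtr.
        rewrite expr_div_n ler_pdivrMr ?exprn_gt0//.
        by apply: le_trans (hv _) _; rewrite expr2 mulrA divfK ?gt_eqF.
      rewrite /s mulrCA -sqrtrM ?divr_ge0 ?(ltW v0) ?(ltW Hmu)//.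
      rewrite (_ : fine (mu setT) / v * (v / fine (mu setT)) = 1) ?sqrtr1 ?mulr1//.
      by field; rewrite !gt_eqF.
    have hFw : `|X (e (m, i)) w| <= l / 2.
      have : F m w by apply: contrapT => h'; apply: hF; exists m.
      by move=> /forallP.
    apply: le_trans (ler_normB _ _) _.
    by move: hSw hFw; lra.
  have PC : (P (~` [set w | [forall j, (`|X (b j) w| <= l)%R]]) <= (2^-1)%:E)%E.
    have mCS : measurable (~` S) by exact: measurableC.
    have mU : measurable (\bigcup_(m in [set: 'I_N]) ~` F m).
      by apply: (fin_bigcup_measurable finite_finset) => m _; exact: measurableC.
    apply: (@le_trans _ _ (P (~` S `|` \bigcup_(m in [set: 'I_N]) ~` F m))).
      by rewrite le_measure ?inE//; [exact: measurableC|exact: measurableU].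
    apply: le_trans (measureU2 _ mCS mU) _.
    have -> : (2^-1)%:E = (4^-1)%:E + (4^-1)%:E :> \bar R by rewrite -EFinD; congr (_%:E); field.
    apply: leeD.
      rewrite (_ : 4^-1 = 1 - 3 / 4); last by field.
      exact: prob_setC_le.
    apply: le_trans (prob_union_le _) _ => [m|]; first exact: measurableC.
    apply: (@le_trans _ _ (\sum_(m < N) (expR (- (l / 2 / s0) ^+ 2 / 64))%:E)%E).
      by apply: lee_sum => m _; exact: PF.
    rewrite sumEFin lee_fin sumr_const card_ord.
    by move: HN; rewrite mulr_natl mul1r.
  rewrite (_ : 2^-1 = 1 - 2^-1); last by field.
  exact: prob_setC_ge.
- have -> : Num.sqrt v * l / h0 = r / Num.sqrt (B z z).
    by rewrite Bzz /r -{2}(sqr_sqrtr (ltW v0)); field; rewrite !gt_eqF.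
  by apply: (iso_lower iX) => //; rewrite Bzz.
Qed.

(** The bound on finite grids is uniform in [n], so continuity from above carries it to the whole
    sequence [u]. *)
Lemma cover_nonneg_lower : 0 < v ->
  ((2^-1 * ((Num.sqrt (pi *+ 2))^-1 * expR (- (Num.sqrt v * l / h0 + 1) ^+ 2 / 2)))%:E <=
   P [set w | forall (m : 'I_N) (i : nat), (0 <= f (x m + u i) w)%R])%E.
Proof.
move=> v0; pose A n := [set w | forall (m : 'I_N) (i : 'I_n), (0 <= f (x m + u i) w)%R].
have mA n : measurable (A n).
  have -> : A n = \bigcap_(j in [set: 'I_N * 'I_n]) [set w | (0 <= f (x j.1 + u j.2) w)%R].
    apply/seteqP; split => w /=; first by move=> H j _; exact: H.
    by move=> H m i; exact: (H (m, i)).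
  apply: (fin_bigcap_measurable finite_finset) => j _; exact: measurable_nonneg.
have -> : [set w | forall (m : 'I_N) (i : nat), (0 <= f (x m + u i) w)%R] = \bigcap_n A n.
  apply/seteqP; split => w /=; first by move=> H n _ m i; exact: H.
  by move=> H m i; exact: (H i.+1 Logic.I m (@Ordinal i.+1 i (leqnn _))).
have mB : measurable (\bigcap_n A n) by exact: bigcapT_measurable.
have niA : nonincreasing_seq A.
  apply/nonincreasing_seqP => n; apply/subsetPset => w H m i.
  exact: (H m (widen_ord (leqnSn n) i)).
have cvgA : P \o A @ \oo --> P (\bigcap_n A n).
  by apply: nonincreasing_cvg_mu => //; rewrite ltey_eq fin_num_measure.
rewrite -(cvg_lim _ cvgA)//; apply: lime_ge; first by apply/cvg_ex; eexists; exact: cvgA.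
by apply: nearW => n; exact: grid_nonneg_lower.
Qed.

End lower.

(** * Upper bound for nonnegativity *)

Section upper.
Variable nu : {finite_measure set L -> \bar R}.
Hypothesis nu_le : forall A, measurable A -> (nu A <= mu A)%E.
Variables (J : finType) (x : J -> V) (M : R).
Let k := fine (nu setT).
Hypothesis k_gt0 : 0 < k.
Hypothesis M_gt0 : 0 < M.
Hypothesis Hform : forall a : J -> R^o, spectral_form phase nu x a a <= M * \sum_j a j ^+ 2.
Variable eta : R.
Hypothesis eta_gt0 : 0 < eta.
(** Weighting each small value by [W ^+ 2] gives at least [W ^+ size s] when half of the values are
    small, against an expectation of at most [2 ^+ size s] by [Heta]; the quotient is
    [expR (- size s)]. *)
Let W : R := 2 * expR 1.
Hypothesis Heta : (W ^+ 2 - 1) * (2 * eta * normal_peak (Num.sqrt (k / 2))) <= 1.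

Lemma spectral_form_le (I : finType) (z : I -> V) (a : I -> R^o) :
  spectral_form phase nu z a a <= spectral_form phase mu z a a.
Proof.
apply: fine_le.
- exact/integrable_fin_num/form_integrable.
- exact/integrable_fin_num/form_integrable.
have E : (fun l => (csym phase z a l * csym phase z a l + ssym phase z a l * ssym phase z a l)%:E)
   = (fun l => (csym phase z a l ^+ 2 + ssym phase z a l ^+ 2)%:E) by [].
rewrite E; apply: ge0_le_measure_integral => //.
- by move=> l; rewrite lee_fin addr_ge0// sqr_ge0.
- apply/measurable_EFinP; apply: measurable_funD; apply: measurable_funX;
    [exact: measurable_csym|exact: measurable_ssym].
Qed.

(* Markov: nonnegative values with a small sum are mostly below [eta], which is
   unlikely for a well separated subfamily. *)
Lemma small_sum_le (h : V) :
  (P [set w | (forall j, (0 <= f (h + x j) w)%R) /\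
     (\sum_j f (h + x j) w <= 2 * (eta * k / (8 * M)) * #|J|%:R)%R] <=
   (expR (- (#|J|%:R * k / (2 * M))))%:E)%E.
Proof.
set E := [set w | _].
pose p j := h + x j.
have iX := fiso p; have pB := iso_psd iX.
have pB' := spectral_psd mphase nu p.
have formE a : spectral_form phase nu p a a = spectral_form phase nu x a a.
  rewrite !spectral_formE//; apply: eq_bigr => i _; apply: eq_bigr => j _.
  by rewrite /p opprD addrACA subrr add0r.
have [||s [us ds Js]] := greedy_distant pB' (X := @unitv J) k_gt0 M_gt0.
- by move=> j; exact: form_unitv.
- move=> a; have -> : \sum_j a j *: unitv j = (a : J -> R^o).
    apply/funext => i.
    have -> : (\sum_j a j *: unitv j) i = \sum_j a j * unitv j i.
      by elim: (index_enum J) => [|j r IH]; rewrite ?big_nil// !big_cons -IH.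
    rewrite (bigD1 i)//= /unitv eqxx mulr1 big1 ?addr0// => j ij.
    by rewrite eq_sym (negbTE ij) mulr0.
  by rewrite formE; exact: Hform.
(* Separation, found for [nu], is passed to the larger form of [mu], and orthogonal parts are taken
   only afterwards, with respect to the latter. *)
have {ds} fs := distant_far_apart pB (distant_le (@spectral_form_le _ p) ds).
have W1 : 1 <= W.
  by rewrite /W; have := expR_ge1Dx (1 : R); lra.
have W0 : 0 < W by lra.
have M1 : 0 <= W ^+ 2 - 1 by rewrite subr_ge0 exprn_ege1.
have k20 : 0 < k / 2 by rewrite divr_gt0.
have := small_ball_count iX k20 (ltW eta_gt0) M1 fs; rewrite size_map.
set Y := (X in (\int[_]_w X w)%E) => HY.
have mf j : measurable_fun setT (f (p j) : Om -> R) by exact: measurable_funP.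
have mE : measurable E by exact: measurable_sumnonneg.
have YE w : Y w = (W ^+ (2 * count (fun j => `|f (p j) w| <= eta) s))%:E.
  rewrite /Y big_map; under eq_bigr do rewrite combination_unitv.
  by rewrite prod_count addrC subrK exprM.
have Ycount w : E w -> ((W ^+ size s)%:E <= Y w)%E.
  move=> [w0 wsum]; rewrite YE lee_fin ler_weXn2l//.
  have := count_predC (fun j => `|f (p j) w| <= eta) s.
  set c1 := count _ s; set c2 := count _ s => c12.
  suff : (2 * c2 <= size s)%N by rewrite -c12 !mul2n -!addnn leq_add2r leq_add2l.
  (* Nonnegativity allows summing over [s] only. As [#|J| k <= 2 M size s], the right-hand side is
     at most [eta * size s / 2], so at most half of the chosen values exceed [eta]. *)
  have h2 : eta * c2%:R <= 2 * (eta * k / (8 * M)) * #|J|%:R.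
    apply: le_trans wsum; apply: le_trans (ler_sum_uniq us w0).
    apply: le_trans (count_large_le s eta w0).
    rewrite ler_pM2l// ler_nat /c2; apply: sub_count => j /=.
    by rewrite (ger0_norm (w0 j)).
  have h3 : eta * (2 * c2%:R) <= eta * (size s)%:R.
    apply: (@le_trans _ _ (eta * (#|J|%:R * k) / (2 * M))).
      rewrite ler_pdivlMr ?mulr_gt0//.
      have : eta * c2%:R * (4 * M) <= 2 * (eta * k / (8 * M)) * #|J|%:R * (4 * M).
        by rewrite ler_pM2r// mulr_gt0.
      have -> : 2 * (eta * k / (8 * M)) * #|J|%:R * (4 * M) = eta * (#|J|%:R * k).
        by field; rewrite gt_eqF.
      lra.
    rewrite ler_pdivrMr ?mulr_gt0// -mulrA ler_pM2l//.
    by apply: le_trans Js _; rewrite [leRHS]mulrC.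
  by move: h3; rewrite ler_pM2l// -natrM ler_nat.
have mY : measurable_fun setT Y.
  apply/measurable_EFinP; apply: measurable_prod => b _; apply: measurable_funD => //.
  apply: measurable_funM => //.
  have -> : (fun w => (`|combination f p b w| <= eta)%R%:R) =
      \1_[set w | `|combination f p b w| <= eta] :> (Om -> R).
    by apply/funext => w; rewrite indicE mem_setE.
  by apply: measurable_indic; exact: (iso_meas_le iX).
have Y0 w : (0 <= Y w)%E by rewrite YE lee_fin exprn_ge0// ltW.
have main : ((W ^+ size s)%:E * P E <= (2 ^+ size s)%:E)%E.
  apply: (@le_trans _ _ (\int[P]_w Y w)%E); last first.
    apply: le_trans HY _; rewrite lee_fin; apply: lerXn2r; rewrite ?nnegrE//.
      by rewrite addr_ge0// mulr_ge0// ?mulr_ge0 ?(ltW eta_gt0) ?normal_peak_ge0.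
    by move: Heta; lra.
  rewrite -[X in P X](setIT E) -integral_indic// -ge0_integralZl//; last 2 first.
  - by apply/measurable_EFinP; apply: measurable_indic.
  - by rewrite lee_fin exprn_ge0// ltW.
  apply: ge0_le_integral => //.
  - by move=> w _; rewrite -EFinM lee_fin mulr_ge0// exprn_ge0// ltW.
  - by apply/measurable_EFinP; apply: measurable_funM => //; exact: measurable_indic.
  - move=> w _; rewrite indicE; case: (boolP (w \in E)) => [|_]; last by rewrite mule0.
    by rewrite inE mule1 => /Ycount.
have Wn : 0 < W ^+ size s by rewrite exprn_gt0.
apply: (@le_trans _ _ (expR (- (size s)%:R))%:E); last first.
  rewrite lee_fin ler_expR lerN2 ler_pdivrMr ?mulr_gt0//.
  by apply: le_trans Js _; rewrite mulrC.
rewrite -(@lee_pmul2l _ (W ^+ size s)%:E)// ?lte_fin//.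
apply: le_trans main _; rewrite -EFinM lee_fin /W exprMn -expRM_natl mulr1 -mulrA -expRD.
by rewrite subrr expR0 mulr1.
Qed.

Variables (I : finType) (q : I -> R) (y : I -> V) (v : R).
Hypothesis q_ge0 : forall i, 0 <= q i.
Hypothesis q_sum : \sum_i q i = 1.
Hypothesis ssym0 : forall z, ssym phase y q z = 0.
Hypothesis v_gt0 : 0 < v.
Hypothesis Hv : fine (\int[mu]_z (csym phase y q z ^+ 2)%:E)%E <= v.
Let eta0 := eta * k / (8 * M).
Hypothesis Hv0 : 8 * Num.sqrt v <= eta0.
Hypothesis J_gt0 : (0 < #|J|)%N.

(** The symbol of a probability has modulus at most 1: averaging over [J] does not increase the
    variance. *)
Lemma average_sym_le1 z :
  csym phase x (fun=> #|J|%:R^-1) z ^+ 2 + ssym phase x (fun=> #|J|%:R^-1) z ^+ 2 <= 1.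
Proof.
rewrite !expr2 (sym_quad phaseD); set c := _^-1.
have c0 : 0 <= c by rewrite invr_ge0.
have cN : c * #|J|%:R = 1 by rewrite mulVf// gt_eqF ?ltr0n.
apply: (@le_trans _ _ (\sum_(i : J) \sum_(j : J) c * c)).
  apply: ler_sum => i _; apply: ler_sum => j _.
  by rewrite ler_piMr ?mulr_ge0// (le_trans (ler_norm _))// cos_max.
rewrite le_eqVlt; apply/orP; left; apply/eqP.
under eq_bigr do rewrite sumr_const -mulr_natr -mulrA cN mulr1.
by rewrite sumr_const -mulr_natr.
Qed.

(* Once the doubly averaged variable is at most [eta0], at least half of the
   weight [q] sits on indices [i] whose average over [J] is at most [2 eta0], so
   Markov's inequality replaces a union bound over [I]. *)
Lemma nonneg_upper (A : set Om) : measurable A ->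
  A `<=` [set w | forall i j, (0 <= f (y i + x j) w)%R] ->
  (P A <= (expR (- eta0 ^+ 2 / (256 * v)) + 2 * expR (- (#|J|%:R * k / (2 * M))))%:E)%E.
Proof.
move=> mA Asub.
pose c : R := #|J|%:R^-1.
have J0 : 0 < #|J|%:R :> R by rewrite ltr0n.
have cJ : c * #|J|%:R = 1 by rewrite mulVf// gt_eqF.
have c0 : 0 < c by rewrite invr_gt0.
have eta00 : 0 < eta0 by rewrite divr_gt0 ?mulr_gt0.
pose p (o : I * J) := y o.1 + x o.2.
have iX := fiso p; have pB := iso_psd iX.
set X := combination f p in iX *.
pose z : I * J -> R^o := fun o => q o.1 * c.
have zc a : csym phase p z a = csym phase y q a * csym phase x (fun=> c) a.
  by have := csym_prod phaseD q (fun=> c) y x a; rewrite ssym0 mul0r subr0.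
have zs a : ssym phase p z a = csym phase y q a * ssym phase x (fun=> c) a.
  by have := ssym_prod phaseD q (fun=> c) y x a; rewrite ssym0 mul0r add0r.
have Bzz : spectral_form phase mu p z z <= v.
  apply: le_trans Hv; apply: fine_le.
  - exact/integrable_fin_num/form_integrable.
  - apply/integrable_fin_num => //; apply: (@bounded_integrable _ _ _ _ _ ((\sum_i `|q i|) ^+ 2)).
      by apply: measurable_funX; exact: measurable_csym.
    by move=> l; rewrite normrX lerXn2r ?nnegrE ?csym_le// sumr_ge0.
  apply: ge0_le_integral => //.
  - by move=> l _; rewrite -!expr2 lee_fin addr_ge0// sqr_ge0.
  - exact/(measurable_int mu)/form_integrable.
  - by apply/measurable_EFinP; apply: measurable_funX; exact: measurable_csym.
  - move=> l _; rewrite lee_fin zc zs -!expr2 !exprMn -mulrDr ler_piMr ?sqr_ge0//.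
    exact: average_sym_le1.
pose S := [set w | [forall i : unit, (`|X z w| <= eta0)%R]].
have mS : measurable S by exact: (iso_meas_all iX (fun=> z)).
have sv : 0 < Num.sqrt v by rewrite sqrtr_gt0.
(* [iso_tail] for a single variable, with the quantile [2 sqrt v] from Chebyshev; 256 is 64 times
   the square of that 2. *)
have PS : (P (~` S) <= (expR (- eta0 ^+ 2 / (256 * v)))%:E)%E.
  have -> : - eta0 ^+ 2 / (256 * v) = - (eta0 / (2 * Num.sqrt v)) ^+ 2 / 64.
    by rewrite -{1}(sqr_sqrtr (ltW v_gt0)); field; rewrite gt_eqF.
  apply: (iso_tail iX (b := fun _ : unit => z)); first by rewrite mulr_gt0.
    rewrite (_ : [set w | _] = [set w | (`|X z w| <= 2 * Num.sqrt v)%R]); last first.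
      by apply/seteqP; split => w /=; [move/forallP/(_ tt)|move=> h; apply/forallP].
    apply: (iso_chebyshev iX); first by rewrite mulr_gt0.
    by rewrite exprMn sqr_sqrtr ?(ltW v_gt0)//; move: Bzz; lra.
  by move: Hv0; lra.
pose E i := [set w | (forall j, (0 <= f (y i + x j) w)%R) /\
     (\sum_j f (y i + x j) w <= 2 * eta0 * #|J|%:R)%R].
have mE i : measurable (E i).
  by apply: measurable_sumnonneg => j; exact: measurable_funP.
have PE i : (P (E i) <= (expR (- (#|J|%:R * k / (2 * M))))%:E)%E := small_sum_le (y i).
have mAS : measurable (A `&` S) by exact: measurableI.
have PAS : (P (A `&` S) <= (2 * expR (- (#|J|%:R * k / (2 * M))))%:E)%E.
  apply: (@le_trans _ _ (\int[P]_w (\sum_i 2 * q i * \1_(E i) w)%:E)%E); last first.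
    under eq_integral do rewrite -sumEFin.
    rewrite ge0_integral_sum//; last 2 first.
    - by move=> i; apply/measurable_EFinP; apply: measurable_funM => //; exact: measurable_indic.
    - by move=> i w _; rewrite lee_fin !mulr_ge0.
    set e := expR _.
    have -> : 2 * e = \sum_i 2 * q i * e by rewrite -mulr_suml -mulr_sumr q_sum mulr1.
    rewrite -sumEFin; apply: lee_sum => i _.
    under eq_integral do rewrite EFinM.
    rewrite ge0_integralZl//; last 2 first.
    - by apply/measurable_EFinP; exact: measurable_indic.
    - by rewrite lee_fin mulr_ge0.
    rewrite [(2 * q i * e)%:E]EFinM; apply: lee_wpmul2l; first by rewrite lee_fin mulr_ge0.
    by rewrite integral_indic// setIT; exact: PE.
  rewrite -[X in P X](setIT _) -integral_indic//; apply: ge0_le_integral => //.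
  - by apply/measurable_EFinP; exact: measurable_indic.
  - by apply/measurable_EFinP; apply: measurable_sum => i; apply: measurable_funM => //; exact: measurable_indic.
  move=> w _; rewrite lee_fin indicE; case: (boolP (w \in A `&` S)); last first.
    by move=> _; apply: sumr_ge0 => i _; rewrite !mulr_ge0.
  rewrite inE => -[Aw /forallP/(_ tt) Sw]; have f0 := Asub _ Aw.
  rewrite mulr1n.
  (* Outside [E i] the average over [J] exceeds [2 eta0]. Averaging [step] against [q] gives [eta0
     (1 - sum q_i 1_(E i)) <= Z / 2 <= eta0 / 2], that is, [sum 2 q_i 1_(E i) >= 1]. *)
  have step i : eta0 * (1 - \1_(E i) w) <= c / 2 * \sum_j f (y i + x j) w.
    have s0 : 0 <= \sum_j f (y i + x j) w by apply: sumr_ge0 => j _; exact: f0.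
    rewrite indicE; case: (boolP (w \in E i)); first by rewrite subrr mulr0 mulr_ge0// divr_ge0// ltW.
    rewrite notin_setE => nE; rewrite subr0 mulr1.
    have : 2 * eta0 * #|J|%:R < \sum_j f (y i + x j) w.
      by rewrite ltNge; apply/negP => h; apply: nE; split => // j; exact: f0.
    move=> /ltW; rewrite -(ler_pM2l (x := c / 2)) ?divr_gt0//; apply: le_trans.
    have E2 (t n : R) : t / 2 * (2 * eta0 * n) = eta0 * (t * n) by field.
    by rewrite E2 cJ mulr1.
  have : \sum_i q i * (eta0 * (1 - \1_(E i) w)) <= \sum_i q i * (c / 2 * \sum_j f (y i + x j) w).
    by apply: ler_sum => i _; rewrite ler_wpM2l.
  have -> : \sum_i q i * (c / 2 * \sum_j f (y i + x j) w) = 2^-1 * X z w.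
    rewrite /X /combination -(pair_bigA _ (fun i j => z (i, j) * f (p (i, j)) w))/= mulr_sumr.
    apply: eq_bigr => i _; rewrite !mulr_sumr; apply: eq_bigr => j _.
    by rewrite /z /p/=; field.
  have -> : \sum_i q i * (eta0 * (1 - \1_(E i) w)) =
      eta0 * (1 - 2^-1 * \sum_i 2 * q i * \1_(E i) w).
    rewrite -[X in _ = eta0 * (X - _)]q_sum [2^-1 * _]mulr_sumr -sumrB mulr_sumr; apply: eq_bigr => i _.
    by field.
  move=> h; have {}h : eta0 * (1 - 2^-1 * \sum_i 2 * q i * \1_(E i) w) <= eta0 * 2^-1.
    apply: le_trans h _; rewrite mulrC ler_wpM2r// (le_trans (ler_norm _))//.
  by move: h; rewrite ler_pM2l//; lra.
apply: (@le_trans _ _ (P (~` S `|` (A `&` S)))).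
  rewrite le_measure ?inE//; first by apply: measurableU => //; exact: measurableC.
  by move=> w Aw; have [Sw|Sw] := pselect (S w); [right|left].
apply: le_trans (measureU2 _ (measurableC mS) mAS) _.
by rewrite EFinD; exact: leeD.
Qed.

End upper.

End quantitative.

(** * Asymptotics *)

Lemma truncn_gt_mul {R : realType} (a d : R) : 0 < d -> exists M : nat, a < d * M%:R.
Proof.
move=> d0; exists (Num.truncn (a / d)).+1.
by rewrite -ltr_pdivrMl// mulrC truncnS_gt.
Qed.

Lemma half_square_le {R : realFieldType} (a : R) : (a + 1) ^+ 2 / 2 <= a ^+ 2 + 1.
Proof. by have := sqr_ge0 (a - 1); rewrite !expr2; lra. Qed.

Lemma covariance_margin {R : realFieldType} (b m K s tau : R) :
  8 * (1 + K * s) * tau <= b -> b <= m -> b / 8 <= m / 4 - tau - K * tau * s.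
Proof. by lra. Qed.

Lemma margin_eventually {R : realFieldType} (c X Y : R) : 0 < c ->
  2 / c * Y <= X -> 4 / c <= X -> Y + 2 <= c * X.
Proof.
move=> c0 h1 h2.
have : c * (2 / c * Y) <= c * X by rewrite ler_pM2l.
have : c * (4 / c) <= c * X by rewrite ler_pM2l.
have -> : c * (4 / c) = 4 by field; rewrite gt_eqF.
have -> : c * (2 / c * Y) = 2 * Y by field; rewrite gt_eqF.
lra.
Qed.

Lemma half_le_pred {R : realFieldType} (a b : R) : 1 <= a -> 2 * a < b + 1 -> a <= b.
Proof. by lra. Qed.

Lemma expR2_ge3 {R : realType} : 3 <= expR 2 :> R.
Proof. by have := expR_ge1Dx (2 : R); lra. Qed.

(** * Eventual comparisons of powers of T, written as exponentials of [t = ln T] *)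

Section growth.
Context {R : realType}.
Implicit Types (a b c C t : R).

Lemma near_pinfty_scale c (Q : R -> Prop) : 0 < c ->
  (\forall s \near +oo, Q s) -> \forall t \near +oo, Q (c * t).
Proof.
move=> c0 [M [Mr QM]]; exists (M / c); split; first exact: num_real.
by move=> t; rewrite ltr_pdivrMr// mulrC => /QM.
Qed.

Lemma expR_dominates a b C : a < b -> \forall t \near +oo, C * expR (a * t) <= expR (b * t).
Proof.
move=> ab; have ba : 0 < b - a by rewrite subr_gt0.
near=> t; rewrite -[b](subrK a) mulrDl expRD ler_wpM2r ?expR_ge0//.
apply: le_trans (expR_ge1Dx _); rewrite -lerBlDl.
rewrite -ler_pdivrMl//; near: t; apply: nbhs_pinfty_ge; exact: num_real.
Unshelve. all: by end_near.
Qed.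

Lemma expR_dominates_lin a C : 0 < a -> \forall t \near +oo, C * t <= expR (a * t).
Proof.
move=> a0; have a20 : 0 < a / 2 by rewrite divr_gt0.
near=> t.
have t0 : 0 <= t by near: t; apply: nbhs_pinfty_ge; exact: num_real.
have h : C / (a / 2) * expR (a / 2 * t) <= expR (a * t).
  by near: t; apply: expR_dominates; rewrite ltr_pdivrMr// ltr_pMr// ltr1n.
have [C0|C0] := leP C 0.
  by apply: (@le_trans _ _ 0); rewrite ?expR_ge0// mulr_le0_ge0.
apply: le_trans h; rewrite -mulrA ler_pM2l// ler_pdivlMl//.
by apply: le_trans (expR_ge1Dx _); rewrite lerDr.
Unshelve. all: by end_near.
Qed.

Lemma expR_tends_to0 a C e : a < 0 -> 0 < e -> \forall t \near +oo, C * expR (a * t) <= e.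
Proof.
move=> a0 e0; near=> t.
have : e^-1 * C * expR (a * t) <= expR (0 * t) by near: t; exact: expR_dominates.
by rewrite mul0r expR0 -mulrA ler_pdivrMl// mulr1.
Unshelve. all: by end_near.
Qed.

Lemma expR_ge_eventually a C : 0 < a -> \forall t \near +oo, C <= expR (a * t).
Proof.
move=> a0; near=> t.
have : C * expR (0 * t) <= expR (a * t) by near: t; exact: expR_dominates.
by rewrite mul0r expR0 mulr1.
Unshelve. all: by end_near.
Qed.

Lemma power_law_bounds (m : R -> R) (alpha eta : R) : 0 < eta < alpha ->
  (forall r, 0 <= m r) ->
  ln (m delta) / ln delta @[delta --> 0^'+] --> alpha ->
  \forall s \near +oo, expR (- (alpha + eta) * s) <= m (expR (- s)) <= expR (- (alpha - eta) * s).
Proof.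
move=> /andP[eta0 etaa] m0 /cvgrPdist_le /(_ _ eta0) [e /= e0 He].
near=> s.
have s0 : 0 < s by near: s; apply: nbhs_pinfty_gt; exact: num_real.
have : `|alpha - ln (m (expR (- s))) / ln (expR (- s))| <= eta.
  apply: He; last exact: expR_gt0.
  rewrite /= sub0r normrN ger0_norm ?expR_ge0//.
  have -> : - s = (- 1) * s by rewrite mulN1r.
  apply: (@le_lt_trans _ _ (e / 2)); last by rewrite ltr_pdivrMr// ltr_pMr// ltr1n.
  rewrite -[leLHS]mul1r; near: s; apply: expR_tends_to0; first by rewrite oppr_lt0.
  by rewrite divr_gt0.
rewrite expRK; set p := m _ => h.
(* The logarithm is 0 at 0, so a vanishing mass would give the ratio 0, farther than [eta] from
   [alpha]. *)
have p0 : 0 < p.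
  rewrite lt_neqAle m0 andbT eq_sym; apply/eqP => p0; move: h.
  by rewrite p0 ln0// mul0r subr0 (ger0_norm (ltW (lt_trans eta0 etaa))) leNgt etaa.
have -> : p = expR (ln p) by rewrite lnK.
move: h; rewrite invrN mulrN opprK !ler_expR ler_norml => /andP[h1 h2].
have e1 : ln p / s * s = ln p by rewrite divfK// gt_eqF.
by apply/andP; split; rewrite -e1 ler_pM2r//; [move: h1|move: h2]; lra.
Unshelve. all: by end_near.
Qed.

Lemma power_growthP (F : R -> \bar R) (alpha : R) :
  (forall e : R, 0 < e -> \forall t \near +oo, exists z : R, [/\ F (expR t) = z%:E,
     expR ((alpha - e) * t) <= z & z <= expR ((alpha + e) * t)]) ->
  power_growth F alpha.
Proof.
move=> H; have near_ln (Q : R -> Prop) :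
    (\forall t \near +oo, Q (expR t)) -> \forall T \near +oo, Q T.
  move=> [M [Mr QM]]; exists (expR M); split; first exact: num_real.
  move=> T MT; have T0 : 0 < T by apply: lt_trans MT; exact: expR_gt0.
  by rewrite -[T]lnK//; apply: QM; rewrite -(expRK M) ltr_ln// posrE expR_gt0.
exists (fun T => ln (fine (F T)) / ln T - alpha).
  apply/cvgrPdist_le => e e0; apply: near_ln; near=> t.
  have t0 : 0 < t by near: t; apply: nbhs_pinfty_gt; exact: num_real.
  have [z [-> h1 h2]] : exists z : R, [/\ F (expR t) = z%:E,
     expR ((alpha - e) * t) <= z & z <= expR ((alpha + e) * t)] by near: t; exact: H.
  have z0 : 0 < z by apply: lt_le_trans h1; exact: expR_gt0.
  rewrite /= expRK sub0r normrN.
  move: h1 h2; rewrite -(lnK z0) !ler_expR !lnK// => h1 h2.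
  have e1 : ln z / t * t = ln z by rewrite divfK// gt_eqF.
  rewrite ler_norml; apply/andP; split; rewrite -(ler_pM2r t0) mulrBl e1; move: h1 h2; lra.
apply: near_ln; near=> t.
have t0 : 0 < t by near: t; apply: nbhs_pinfty_gt; exact: num_real.
have [z [-> h1 h2]] : exists z : R, [/\ F (expR t) = z%:E,
   expR ((alpha - 1) * t) <= z & z <= expR ((alpha + 1) * t)] by near: t; exact: H.
have z0 : 0 < z by apply: lt_le_trans h1; exact: expR_gt0.
rewrite /powR gt_eqF ?expR_gt0//= expRK addrC subrK divfK ?gt_eqF// lnK//.
Unshelve. all: by end_near.
Qed.

End growth.

(** * Variance and covariances of the average, from the size of its symbol *)

Section kernel_bounds.
Context {R : realType} {dL : measure_display} {L : measurableType dL} {V : zmodType}.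
Variable phase : V -> L -> R.
Hypothesis mphase : forall x, measurable_fun setT (phase x).
Variable mu : {finite_measure set L -> \bar R}.

Lemma fine_integral_le (g h : L -> R) (M : R) : measurable_fun setT g -> measurable_fun setT h ->
  (forall l, `|g l| <= M) -> (forall l, `|h l| <= M) -> (forall l, g l <= h l) ->
  fine (\int[mu]_l (g l)%:E)%E <= fine (\int[mu]_l (h l)%:E)%E.
Proof.
move=> mg mh gM hM gh; have ig := bounded_integrable mu mg gM; have ih := bounded_integrable mu mh hM.
apply: fine_le; [exact: integrable_fin_num|exact: integrable_fin_num|].
by apply: le_integral => // l _; rewrite lee_fin.
Qed.

Lemma fine_integral_comb (A B : set L) (a b c : R) : measurable A -> measurable B ->
  fine (\int[mu]_l (a * \1_A l + b * \1_B l + c)%:E)%E =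
  a * fine (mu A) + b * fine (mu B) + c * fine (mu setT).
Proof.
move=> mA mB.
have iI (C : set L) : measurable C -> mu.-integrable setT (EFin \o \1_C).
  by move=> mC; apply: (@bounded_integrable _ _ _ _ _ 1) => // l; rewrite indicE; case: (_ \in _); rewrite ?normr0 ?normr1.
have ic : mu.-integrable setT (EFin \o cst c) by exact: finite_measure_integrable_cst.
rewrite fine_integralD//; last first.
  rewrite (_ : EFin \o _ = (fun l => (a * \1_A l)%:E + (b * \1_B l)%:E)%E)//.
  by apply: integrableD => //; apply: integrable_EFinZ; exact: iI.
rewrite fine_integralD; last 2 first.
- by apply: integrable_EFinZ; exact: iI.
- by apply: integrable_EFinZ; exact: iI.
rewrite !fine_integralZ; last 2 first.
- exact: iI.
- exact: iI.
rewrite !integral_indic// !setIT integral_cst// fineM//; exact: fin_num_measure.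
Qed.

Variables (bL : R -> set L) (bV : R -> set V).
Hypothesis mbL : forall r, measurable (bL r).
Hypothesis bL_mono : forall r s, r <= s -> bL r `<=` bL s.
Hypothesis Hphase : forall l r x T, bL r l -> bV T x -> r * T <= 1 / 8 ->
  1 / 2 <= cos (2 * pi * phase x l).
Variables (I : finType) (q : I -> R) (y : I -> V) (N : set L) (rho r tau E : R).
Hypothesis rho_gt0 : 0 < rho.
Hypothesis q_ge0 : forall i, 0 <= q i.
Hypothesis q_sum : \sum_i q i = 1.
Hypothesis yV : forall i, bV (1 / (8 * rho)) (y i).
Hypothesis csym_ge0 : forall l, 0 <= csym phase y q l.
Hypothesis mN : measurable N.
Hypothesis muN : (mu N <= tau%:E)%E.
Hypothesis Hoff : forall l, ~ N l -> ~ bL r l -> csym phase y q l <= E.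
Hypothesis E_ge0 : 0 <= E.

Lemma csym_le1 l : csym phase y q l <= 1.
Proof.
apply: le_trans (ler_norm _) _; apply: le_trans (csym_le _ _ _ _) _.
by rewrite -q_sum; apply: ler_sum => i _; rewrite ger0_norm.
Qed.

Lemma csym_near l : bL rho l -> 1 / 2 <= csym phase y q l.
Proof.
move=> hl; have -> : 1 / 2 = \sum_i q i * (1 / 2) by rewrite -mulr_suml q_sum [RHS]mul1r.
apply: ler_sum => i _.
rewrite ler_wpM2l//; apply: Hphase hl (yV i) _.
by rewrite (_ : rho * (1 / (8 * rho)) = 1 / 8)//; field; rewrite gt_eqF.
Qed.

Let fineN : fine (mu N) <= tau.
Proof. by rewrite -lee_fin fineK// fin_num_measure. Qed.

(** The symbol is at most 1 on the ball of radius [r] and on the exceptional set [N], and at most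
    [E] elsewhere. *)
Lemma kernel_variance_le : fine (\int[mu]_l (csym phase y q l ^+ 2)%:E)%E <=
  fine (mu (bL r)) + tau + E ^+ 2 * fine (mu setT).
Proof.
apply: (@le_trans _ _ (1 * fine (mu (bL r)) + 1 * fine (mu N) + E ^+ 2 * fine (mu setT))).
  rewrite -fine_integral_comb//; apply: (@fine_integral_le _ _ (1 + 1 + E ^+ 2)).
  - by apply: measurable_funX; exact: measurable_csym.
  - apply: measurable_funD => //; apply: measurable_funD; apply: measurable_funM => //;
      exact: measurable_indic.
  - move=> l; rewrite ger0_norm ?sqr_ge0//.
    have : csym phase y q l ^+ 2 <= 1 by rewrite exprn_ile1// csym_le1.
    have := sqr_ge0 E; lra.
  - move=> l; rewrite !mul1r ger0_norm ?addr_ge0 ?sqr_ge0//.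
    by rewrite lerD2r; apply: lerD; rewrite indicE; case: (_ \in _).
  - move=> l; rewrite !mul1r; have h1 : csym phase y q l ^+ 2 <= 1 by rewrite exprn_ile1// csym_le1.
    have E2 := sqr_ge0 E.
    rewrite !indicE; case: (boolP (l \in bL r)) => [_|]; first by case: (_ \in _) => /=; lra.
    rewrite notin_setE => lr; case: (boolP (l \in N)) => [_|] /=; first by lra.
    rewrite notin_setE => lN; rewrite !add0r lerXn2r ?nnegrE//; exact: Hoff.
by rewrite !mul1r !lerD2r lerD2l.
Qed.

Lemma kernel_variance_ge : fine (mu (bL rho)) / 4 <= fine (\int[mu]_l (csym phase y q l ^+ 2)%:E)%E.
Proof.
have -> : fine (mu (bL rho)) / 4 = 4^-1 * fine (mu (bL rho)) + 0 * fine (mu N) + 0 * fine (mu setT).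
  by rewrite !mul0r !addr0 mulrC.
rewrite -fine_integral_comb//; apply: (@fine_integral_le _ _ 1).
- apply: measurable_funD => //; apply: measurable_funD; apply: measurable_funM => //;
    exact: measurable_indic.
- by apply: measurable_funX; exact: measurable_csym.
- move=> l; rewrite mul0r !addr0 indicE; case: (_ \in _); rewrite /= ?mulr0 ?mulr1 ger0_norm//; lra.
- move=> l; rewrite ger0_norm ?sqr_ge0//.
  by rewrite exprn_ile1// csym_le1.
- move=> l; rewrite mul0r !addr0 indicE; case: (boolP (l \in bL rho)) => [|_].
    rewrite inE => /csym_near h; rewrite mulr1.
    apply: (@le_trans _ _ ((1 / 2) ^+ 2)); first by rewrite expr2; lra.
    by rewrite lerXn2r ?nnegrE.
  by rewrite mulr0 sqr_ge0.
Qed.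

(** The integrand is at least 1/4 on the ball of radius [rho] (symbol and cosine both at least 1/2)
    and nonnegative on the one of radius [r], up to a loss of at most 1 on [N]; elsewhere it is at
    least [- E]. *)
Lemma kernel_covariance_ge x T : bV T x -> r * T <= 1 / 8 -> rho <= r ->
  fine (mu (bL rho)) / 4 - tau - E * fine (mu setT) <=
  fine (\int[mu]_l (csym phase y q l * cos (2 * pi * phase x l))%:E)%E.
Proof.
move=> xT rT rhor.
apply: (@le_trans _ _ (4^-1 * fine (mu (bL rho)) + (- 1) * fine (mu N) + (- E) * fine (mu setT))).
  by move: fineN; rewrite mulN1r mulNr; lra.
rewrite -fine_integral_comb//; apply: (@fine_integral_le _ _ (1 + 1 + E)).
- apply: measurable_funD => //; apply: measurable_funD; apply: measurable_funM => //;
    exact: measurable_indic.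
- by apply: measurable_funM; [exact: measurable_csym|exact: measurable_cos_phase].
- move=> l; apply: le_trans (ler_normD _ _) _; rewrite normrN (ger0_norm E_ge0) lerD2r.
  apply: le_trans (ler_normD _ _) _; apply: lerD; rewrite indicE; case: (_ \in _);
    rewrite /= ?mulr0 ?mulr1 ?normr0 ?normrN ?normr1// ger0_norm//; lra.
- move=> l; rewrite normrM.
  apply: (@le_trans _ _ 1); last by move: E_ge0; lra.
  by rewrite mulr_ile1 ?normr_ge0// ?cos_max// ger0_norm// csym_le1.
- move=> l; rewrite !indicE.
  have c1 := csym_le1 l; have c0 := csym_ge0 l.
  have := cos_max (2 * pi * phase x l); rewrite ler_norml => /andP[k1 k2].
  set k := cos _ in k1 k2 *; set c := csym _ _ _ _ in c0 c1 *.
  have ck : - c <= c * k by rewrite -{1}[c]mulr1 -mulrN ler_wpM2l.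
  case: (boolP (l \in bL rho)) => [|lrho].
    rewrite inE => h.
    have h1 := csym_near h; have h2 := Hphase (bL_mono rhor h) xT rT.
    have : 1 / 2 * (1 / 2) <= c * k by apply: ler_pM.
    by case: (_ \in _) => /=; move: E_ge0; lra.
  rewrite mulr0 add0r.
  case: (boolP (l \in N)) => [_|] /=; first by move: E_ge0; lra.
  rewrite notin_setE => lN; rewrite mulr0 add0r.
  have [lr|lr] := pselect (bL r l).
    have h2 := Hphase lr xT rT.
    have : 0 <= c * k by rewrite mulr_ge0// (le_trans _ h2)// divr_ge0.
    by move: E_ge0; lra.
  have : c <= E by exact: Hoff.
  lra.
Qed.

End kernel_bounds.

(** * Both bounds for an abstract group and spectral space *)

Section abstract_growth.
Context {R : realType} {dOm : measure_display} {Om : measurableType dOm}.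
Context {dL : measure_display} {L : measurableType dL} {V : zmodType}.
Variables (P : probability Om R) (f : V -> {RV P >-> R}).
Hypothesis Sf : SGF f.
Variable phase : V -> L -> R.
Hypothesis mphase : forall x, measurable_fun setT (phase x).
Hypothesis phaseD : forall x y l, phase (x + y) l = phase x l + phase y l.
Variable mu : {finite_measure set L -> \bar R}.
Hypothesis Kmu : forall x, cov_kernel f x = fine (\int[mu]_l (cos (2 * pi * phase x l))%:E)%E.
Variables (bL : R -> set L) (bV : R -> set V) (alpha : R) (d : nat).
Hypothesis alpha_gt0 : 0 < alpha.
Hypothesis mbL : forall r, measurable (bL r).
Hypothesis bL_mono : forall r s, r <= s -> bL r `<=` bL s.
Hypothesis Hball : ln (fine (mu (bL delta))) / ln delta @[delta --> 0^'+] --> alpha.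
Hypothesis Hphase : forall l r x T, bL r l -> bV T x -> r * T <= 1 / 8 ->
  1 / 2 <= cos (2 * pi * phase x l).
Hypothesis Hkernel : forall M : nat, exists C rho0 : R, [/\ 0 < C, 0 < rho0 &
  forall rho tau : R, 0 < rho -> rho < rho0 -> 0 < tau ->
  exists (I : finType) (q : I -> R) (y : I -> V) (N : set L),
  [/\ forall i, 0 <= q i, \sum_i q i = 1, forall i, bV (1 / (8 * rho)) (y i) &
   [/\ forall l, ssym phase y q l = 0, forall l, 0 <= csym phase y q l,
     measurable N, (mu N <= tau%:E)%E &
     forall (r : R) l, 0 < r -> ~ N l -> ~ bL r l -> csym phase y q l <= C * (rho / r) ^+ M]]].
Let persist (T : R) : set Om := [set w | forall x, bV T x -> (0 <= f x w)%R].
Hypothesis mpersist : forall T, measurable (persist T).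
Let m (r : R) := fine (mu (bL r)).

Let m_ge0 r : 0 <= m r.
Proof. exact: fine_ge0. Qed.

Let m_le r : m r <= fine (mu setT).
Proof. by apply: fine_le; rewrite ?fin_num_measure// le_measure ?inE. Qed.

Variables (u : nat -> V) (A1 C1 : R) (D : nat).
Hypothesis A1_ge1 : 1 <= A1.
Hypothesis u_bounded : forall w, exists B : R, forall i, `|f (u i) w| <= B.
Hypothesis Hcover : forall T : R, 1 <= T -> exists (N : nat) (x : 'I_N -> V),
  [/\ N%:R <= C1 * T ^+ D,
    [set w | forall (m : 'I_N) (i : nat), (0 <= f (x m + u i)%R w)%R] `<=` persist T &
    forall m i, bV (A1 * T) (x m + u i)].

(** The sequence [u] describes one cell, on which the field is pointwise bounded; the events of
    boundedness by integers increase to the whole space, and the level found serves all [n]. *)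
Lemma bounded_quantile : exists2 s0 : R, 0 < s0 &
  forall n, ((3 / 4)%:E <= P [set w | [forall i : 'I_n, (`|f (u i) w| <= s0)%R]])%E.
Proof.
pose A (k : nat) := \bigcap_i [set w | `|f (u i) w| <= k%:R].
have mfn (i : nat) (s : R) : measurable [set w | `|f (u i) w| <= s].
  have -> : [set w | `|f (u i) w| <= s] = f (u i) @^-1` `[- s, s]%classic.
    by apply/seteqP; split => w /=; rewrite in_itv/= ler_norml.
  by rewrite -[X in measurable X]setTI; exact: (measurable_funP (f (u i))).
have mA k : measurable (A k) by apply: bigcapT_measurable => i; exact: mfn.
have ndA : nondecreasing_seq A.
  apply/nondecreasing_seqP => n; apply/subsetPset => w H i _.
  by apply: le_trans (H i Logic.I) _; rewrite ler_nat.
have UA : \bigcup_k A k = setT.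
  rewrite -subTset => w _; have [B HB] := u_bounded w.
  exists (Num.truncn B).+1 => // i _ /=; apply: le_trans (HB i) _.
  by rewrite ltW// truncnS_gt.
have cvgA : P \o A @ \oo --> P (\bigcup_k A k).
  by apply: nondecreasing_cvg_mu => //; rewrite UA.
rewrite UA probability_setT in cvgA.
have [k [k0 hk]] : exists k : nat, (0 < k)%N /\ ((3 / 4)%:E <= P (A k))%E.
  have : \forall k \near \oo, ((3 / 4)%:E < P (A k))%E.
    apply: (cvgA [set z | ((3 / 4)%:E < z)%E]).
    by apply: open_nbhs_nbhs; split; [exact: open_ereal_gt_ereal|rewrite /= lte_fin; lra].
  move=> [k _ hk]; exists k.+1; split => //; apply/ltW/hk => /=; exact: leqW.
exists k%:R => [|n]; first by rewrite ltr0n.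
apply: le_trans hk _; rewrite le_measure ?inE//; last first.
  by move=> w H; apply/forallP => i; exact: (H i Logic.I).
have -> : [set w | [forall i : 'I_n, (`|f (u i) w| <= k%:R)%R]] =
   \bigcap_(i in [set: 'I_n]) [set w | `|f (u i) w| <= k%:R].
  apply/seteqP; split => w /= => [/forallP H i _|H]; first exact: H.
  by apply/forallP => i; exact: (H i Logic.I).
by apply: (fin_bigcap_measurable finite_finset) => i _; exact: mfn.
Qed.

Lemma persist_lower (e : R) : 0 < e -> \forall t \near +oo,
  ((expR (- expR ((alpha + e) * t)))%:E <= P (persist (expR t)))%E.
Proof.
move=> e0.
(* All losses are powers of [T ^ dl]; the left side of the last condition is the final exponent
   [gam + dl]. *)
have [dl [d0 d1 da de]] : exists dl : R, [/\ 0 < dl, dl <= 1, dl < alpha &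
    alpha + 6 * dl + 2 * alpha * dl + 2 * dl ^+ 2 <= alpha + e].
  exists (Num.min (Num.min 1 (alpha / 2)) (e / (8 + 2 * alpha))); set dl := Num.min _ _.
  have a8 : 0 < 8 + 2 * alpha by rewrite addr_gt0// mulr_gt0.
  have h0 : 0 < dl by rewrite !lt_min ltr01 !divr_gt0.
  have h1 : dl <= 1 by rewrite !ge_min lexx.
  have h2 : dl <= alpha / 2 by rewrite !ge_min lexx orbT.
  have h3 : dl <= e / (8 + 2 * alpha) by rewrite !ge_min lexx orbT.
  split => //; first by apply: le_lt_trans h2 _; rewrite ltr_pdivrMr// ltr_pMr// ltr1n.
  have h4 : dl ^+ 2 <= dl by rewrite expr2 ler_piMl// ltW.
  by move: h3; rewrite ler_pdivlMr//; lra.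
pose b1 := (alpha + dl) * (1 + dl).
(* The ball of radius [rho = T^(-(1 + dl))] has mass at least [T^(- b1)]. Leakage and exceptional
   mass are of order [tau = T^(- dl M)], negligible before it as [dl M > b1]. *)
have [M HM] := truncn_gt_mul b1 d0.
have [C [rho0 [C0 rho00 HK]]] := Hkernel M.
have [s0 s00 Hs0] := bounded_quantile.
have A10 : 0 < A1 by apply: lt_le_trans A1_ge1.
pose mT := fine (mu setT).
have mT0 : 0 <= mT by exact: fine_ge0.
pose kp := dl * M%:R.
have b10 : 0 < b1 by rewrite mulr_gt0// addr_gt0.
have kp0 : 0 < kp by apply: lt_trans HM.
(* The exponent of [v l^2 / h0^2], namely [-(alpha - dl) + 2 dl + 2 b1]. *)
pose gam := alpha + 5 * dl + 2 * alpha * dl + 2 * dl ^+ 2.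
have gam0 : 0 < gam by rewrite /gam !addr_gt0// ?mulr_gt0// exprn_gt0.
pose c1 : R := 2^-1 * (Num.sqrt (pi *+ 2))^-1.
have c10 : 0 < c1 by rewrite mulr_gt0// invr_gt0 sqrtr_gt0 mulrn_wgt0// pi_gt0.
have Hpow : 0 < dl < alpha by rewrite d0.
have Dpos : 0 <= 8 * A1 by rewrite mulr_ge0// ltW.
near=> t.
have t0 : 0 <= t by near: t; apply: nbhs_pinfty_ge; exact: num_real.
pose T := expR t; have T1 : 1 <= T by rewrite -expR0 ler_expR.
pose rho := expR (- ((1 + dl) * t)).
have rho_gt0 : 0 < rho by exact: expR_gt0.
have Hrho : rho < rho0.
  apply: (@le_lt_trans _ _ (rho0 / 2)); last by rewrite ltr_pdivrMr// ltr_pMr// ltr1n.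
  rewrite -[rho]mul1r /rho -mulNr; near: t; apply: expR_tends_to0; last by rewrite divr_gt0.
  by rewrite oppr_lt0 addr_gt0.
have m1 : expR (- (alpha + dl) * ((1 + dl) * t)) <= m (expR (- ((1 + dl) * t)))
    <= expR (- (alpha - dl) * ((1 + dl) * t)).
  near: t; apply: (near_pinfty_scale (Q := fun s => expR (- (alpha + dl) * s) <= m (expR (- s)) <= expR (- (alpha - dl) * s))); first by rewrite addr_gt0.
  exact: power_law_bounds Hpow m_ge0 Hball.
have {m1} m1 : expR (- b1 * t) <= m rho.
  by move: m1 => /andP[h _]; rewrite /b1 mulNr -mulrA -mulNr.
have m2 : m (expR (- t)) <= expR (- (alpha - dl) * t).
  have : expR (- (alpha + dl) * t) <= m (expR (- t)) <= expR (- (alpha - dl) * t).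
    by near: t; exact: power_law_bounds Hpow m_ge0 Hball.
  by case/andP.
pose tau := expR (- kp * t).
have [I [q [y [N [q0 q1 yV [ss0 cs0 mN muN Hoff]]]]]] := HK rho tau rho_gt0 Hrho (expR_gt0 _).
(* The covering points reach distance [A1 T]; this radius keeps the phases within 1/8 there. For the
   variance, the radius [1 / T] is used instead. *)
pose r1 := (8 * A1)^-1 * expR (- t).
have r10 : 0 < r1 by rewrite mulr_gt0 ?expR_gt0// invr_gt0 mulr_gt0.
have rhoE : rho = expR (- dl * t) * expR (- t).
  by rewrite /rho -expRD; congr expR; ring.
have rr1 : rho <= r1.
  rewrite rhoE /r1 ler_pM2r ?expR_gt0// -[leLHS]mul1r; near: t; apply: expR_tends_to0.
    by rewrite oppr_lt0.
  by rewrite invr_gt0 mulr_gt0.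
have tauE : expR (- dl * t) ^+ M = tau.
  by rewrite -expRM_natl /tau /kp; congr expR; ring.
pose E1 := C * (8 * A1) ^+ M * tau.
have E10 : 0 <= E1 by rewrite !mulr_ge0 ?expR_ge0 ?exprn_ge0// ltW.
have Hoff1 l : ~ N l -> ~ bL r1 l -> csym phase y q l <= E1.
  move=> Nl rl; apply: le_trans (Hoff _ _ r10 Nl rl) _.
  rewrite rhoE /r1 invfM invrK -mulrA [expR (- t) * _]mulrCA mulfV ?gt_eqF ?expR_gt0//.
  by rewrite mulr1 exprMn tauE /E1 [tau * _]mulrC mulrA.
pose E2 := C * tau.
have E20 : 0 <= E2 by rewrite mulr_ge0 ?expR_ge0// ltW.
have Hoff2 l : ~ N l -> ~ bL (expR (- t)) l -> csym phase y q l <= E2.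
  move=> Nl rl; apply: le_trans (Hoff _ _ (expR_gt0 _) Nl rl) _.
  by rewrite rhoE mulfK ?gt_eqF ?expR_gt0// tauE.
pose h0 := expR (- b1 * t) / 8.
have h00 : 0 < h0 by rewrite divr_gt0// expR_gt0.
pose v := fine (\int[mu]_l (csym phase y q l ^+ 2)%:E)%E.
have tau1 : tau <= 1 by rewrite -expR0 ler_expR mulNr oppr_le0 mulr_ge0// ltW.
have vle : v <= 2 * expR (- (alpha - dl) * t).
  apply: le_trans (kernel_variance_le mphase mbL q0 q1 cs0 mN muN Hoff2 E20) _.
  rewrite -/(m (expR (- t))) -/mT -addrA.
  have -> : 2 * expR (- (alpha - dl) * t) = expR (- (alpha - dl) * t) + expR (- (alpha - dl) * t) by ring.
  apply: lerD => //.
  apply: (@le_trans _ _ ((1 + C ^+ 2 * mT) * expR (- kp * t))).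
    rewrite mulrDl mul1r lerD2l /E2 exprMn -/tau mulrAC.
    apply: ler_wpM2l; first by rewrite mulr_ge0 ?sqr_ge0.
    by rewrite [leLHS]expr2 ler_piMr// expR_ge0.
  near: t; apply: expR_dominates; rewrite ltrN2.
  apply: le_lt_trans HM; rewrite /b1 -[leLHS]mulr1; apply: ler_pM; rewrite ?subr_ge0 ?(ltW da)//; move: d0; lra.
have v0 : 0 < v.
  apply: (lt_le_trans _ (kernel_variance_ge mphase mu mbL Hphase rho_gt0 q0 q1 yV cs0 mN)).
  by rewrite divr_gt0// (lt_le_trans _ m1)// expR_gt0.
have [Nc [x [Ncle Hsub xA]]] := Hcover T1.
have hle (k : 'I_Nc) i : h0 <= fine (\int[mu]_z (csym phase y q z *
    cos (2 * pi * phase (x k + u i) z))%:E)%E.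
  apply: le_trans (kernel_covariance_ge mphase mbL bL_mono Hphase rho_gt0 q0 q1 yV cs0 mN muN Hoff1 E10 (xA k i) _ rr1).
    rewrite -/(m rho) -/mT.
    apply: covariance_margin m1; rewrite /tau.
    by near: t; apply: expR_dominates; rewrite ltrN2.
  have eT : expR (- t) * T = 1 by rewrite /T -expRD addNr expR0.
  have -> : r1 * (A1 * T) = (8 * A1)^-1 * A1 * (expR (- t) * T) by rewrite /r1; ring.
  rewrite eT mulr1 le_eqVlt; apply/orP; left; apply/eqP.
  by field; rewrite gt_eqF.
(* Any positive power of [T] exceeds the constants in [Hl] and [HKl], and its square exceeds the
   logarithm of the number of cells, at most [C1 T^D]. *)
pose l := expR (dl * t).
have Hl : 8 * s0 <= l by rewrite /l; near: t; exact: expR_ge_eventually.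
have l2E : l ^+ 2 = expR (2 * dl * t) by rewrite -expRM_natl; congr expR; ring.
have HN : Nc%:R * expR (- (l / 2 / s0) ^+ 2 / 64) <= 1 / 4.
  have lin : (D%:R + 1) * (256 * s0 ^+ 2) * t <= expR (2 * dl * t).
    by near: t; apply: expR_dominates_lin; rewrite mulr_gt0.
  apply: (@le_trans _ _ (C1 * expR (- 1 * t))); last first.
    by near: t; apply: expR_tends_to0; rewrite ?oppr_lt0 ?divr_gt0.
  apply: (@le_trans _ _ (Nc%:R * expR (- ((D%:R + 1) * t)))).
    rewrite ler_wpM2l// ler_expR !expr_div_n l2E mulNr lerN2.
    have -> : expR (2 * dl * t) / 2 ^+ 2 / s0 ^+ 2 / 64 = expR (2 * dl * t) / (256 * s0 ^+ 2).
      by field; rewrite gt_eqF.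
    have s256 : 0 < 256 * s0 ^+ 2 by apply: mulr_gt0; rewrite ?exprn_gt0 ?ltr0n.
    rewrite (ler_pdivlMr _ _ s256); apply: le_trans lin.
    by rewrite le_eqVlt; apply/orP; left; apply/eqP; ring.
  apply: (@le_trans _ _ (C1 * T ^+ D * expR (- ((D%:R + 1) * t)))).
    by rewrite ler_wpM2r// expR_ge0.
  rewrite /T -expRM_natl -mulrA -expRD le_eqVlt; apply/orP; left; apply/eqP.
  by congr (_ * expR _); ring.
have HKl : 16 * mT <= l ^+ 2.
  by rewrite l2E; near: t; apply: expR_ge_eventually; rewrite mulr_gt0.
have Hmu : 0 < mT by apply: (lt_le_trans _ (m_le rho)); apply: (lt_le_trans _ m1); exact: expR_gt0.
have := cover_nonneg_lower Sf mphase phaseD Kmu s00 Hs0 Hl HN HKl Hmu ss0 h00 hle v0.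
have mcov : measurable [set w | forall (m : 'I_Nc) (i : nat), (0 <= f (x m + u i)%R w)%R].
  have -> : [set w | forall (m : 'I_Nc) (i : nat), (0 <= f (x m + u i)%R w)%R] =
     \bigcap_(k in [set: 'I_Nc]) \bigcap_i [set w | 0 <= f (x k + u i)%R w].
    by apply/seteqP; split => w /=; [move=> h k _ i _; exact: h|move=> h k i; exact: (h k Logic.I i Logic.I)].
  apply: (fin_bigcap_measurable finite_finset) => k _; apply: bigcapT_measurable => i.
  exact: measurable_nonneg.
move=> H; apply: le_trans (le_trans H _); last first.
  by apply: le_measure; rewrite ?inE; [exact: mcov|exact: mpersist|exact: Hsub].
rewrite -/v lee_fin mulrA -/c1 -{1}(lnK c10) -expRD ler_expR.
pose a := Num.sqrt v * l / h0.
have a2 : a ^+ 2 <= 128 * expR (gam * t).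
  rewrite /a expr_div_n exprMn sqr_sqrtr ?(ltW v0)// l2E.
  have -> : 128 * expR (gam * t) = 2 * expR (- (alpha - dl) * t) * expR (2 * dl * t) / h0 ^+ 2.
    rewrite /h0 expr_div_n -expRM_natl invfM -expRN invrK.
    rewrite (_ : 8 ^+ 2 = 64); last by ring.
    rewrite (_ : gam * t = - (alpha - dl) * t + 2 * dl * t + - (2 * (- b1 * t))).
      by rewrite !expRD; ring.
    by rewrite /gam /b1; ring.
  by rewrite ler_pM2r ?invr_gt0 ?exprn_gt0// ler_pM2r ?expR_gt0.
rewrite -/a mulNr -opprB lerN2.
have big : (128 + `|1 - ln c1|) * expR (gam * t) <= expR ((gam + dl) * t).
  by near: t; apply: expR_dominates; rewrite ltrDl.
have e1 : 1 <= expR (gam * t) by rewrite -expR0 ler_expR mulr_ge0// ltW.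
have e2 : expR ((gam + dl) * t) <= expR ((alpha + e) * t).
  rewrite ler_expR ler_wpM2r//; apply: (le_trans _ de).
  by rewrite le_eqVlt; apply/orP; left; apply/eqP; rewrite /gam; ring.
have e3 : `|1 - ln c1| <= `|1 - ln c1| * expR (gam * t) by rewrite ler_peMr.
apply: le_trans e2; apply: le_trans big; rewrite mulrDl.
apply: le_trans (lerB (half_square_le a) (lexx (ln c1))) _; rewrite -addrA.
by apply: lerD a2 (le_trans _ e3); exact: ler_norm.
Unshelve. all: by end_near.
Qed.

Hypothesis bV_mono : forall T T', T <= T' -> bV T `<=` bV T'.
Hypothesis bVD : forall T T' x y, bV T x -> bV T' y -> bV (T + T') (x + y).
Hypothesis alpha_ltd : alpha < d%:R.
Variable nu : {finite_measure set L -> \bar R}.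
Hypothesis nu_le : forall A, measurable A -> (nu A <= mu A)%E.
Variables (A M' : R).
Let k := fine (nu setT).
Hypothesis k_gt0 : 0 < k.
Hypothesis M_gt0 : 0 < M'.
Hypothesis A_gt0 : 0 < A.
Hypothesis Hac : forall n : nat, (0 < n)%N -> exists (J : finType) (x : J -> V),
  [/\ forall j, bV (A * n%:R) (x j), (n ^ d <= #|J|)%N &
    forall a : J -> R^o, spectral_form phase nu x a a <= M' * \sum_j a j ^+ 2].

Lemma persist_upper (e : R) : 0 < e -> \forall t \near +oo,
  (P (persist (expR t)) <= (expR (- expR ((alpha - e) * t)))%:E)%E.
Proof.
move=> e0.
(* The product is the exponent [b1] with which the mass of the ball of radius [T^(-(1 - dl))] is at
   most [T^(- b1)]. *)
have [dl [d0 d1 da de]] : exists dl : R, [/\ 0 < dl, dl < 1, dl < alpha &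
    alpha - e < (alpha - dl) * (1 - dl)].
  exists (Num.min (Num.min (1 / 2) (alpha / 2)) (e / (2 + alpha))); set dl := Num.min _ _.
  have a8 : 0 < 2 + alpha by rewrite addr_gt0.
  have h0 : 0 < dl by rewrite !lt_min !divr_gt0.
  have h1 : dl <= 1 / 2 by rewrite !ge_min lexx.
  have h2 : dl <= alpha / 2 by rewrite !ge_min lexx orbT.
  have h3 : dl <= e / (2 + alpha) by rewrite !ge_min lexx orbT.
  split => //; first by lra.
    by apply: le_lt_trans h2 _; rewrite ltr_pdivrMr// ltr_pMr// ltr1n.
  have h4 := sqr_ge0 dl; rewrite expr2 in h4.
  by move: h3; rewrite ler_pdivlMr//; lra.
pose b1 := (alpha - dl) * (1 - dl).
have b10 : 0 < b1 by rewrite mulr_gt0 ?subr_gt0.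
have b1a : b1 < alpha.
  apply: (@lt_le_trans _ _ (alpha * (1 - dl))).
    by rewrite ltr_pM2r ?subr_gt0// ltrBlDr ltrDl.
  by rewrite ler_piMr ?(ltW alpha_gt0)// lerBlDr lerDl ltW.
have [M HM] := truncn_gt_mul alpha d0.
have [C [rho0 [C0 rho00 HK]]] := Hkernel M.
pose mT := fine (mu setT).
have mT0 : 0 <= mT by exact: fine_ge0.
pose kp := dl * M%:R.
have kp0 : 0 < kp by apply: lt_trans HM.
pose W : R := 2 * expR 1.
have W1 : 1 <= W by rewrite /W; have := expR_ge1Dx (1 : R); lra.
pose pk := normal_peak (Num.sqrt (k / 2)).
have WM : 0 <= (W ^+ 2 - 1) * (2 * pk).
  by rewrite mulr_ge0 ?subr_ge0 ?exprn_ege1// mulr_ge0// normal_peak_ge0.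
(* Chosen for [Heta]; the added 1 keeps the denominator positive. *)
pose eta := ((W ^+ 2 - 1) * (2 * pk) + 1)^-1.
have eta_gt0 : 0 < eta by rewrite invr_gt0 ltr_wpDl.
have Heta : (W ^+ 2 - 1) * (2 * eta * pk) <= 1.
  have -> : (W ^+ 2 - 1) * (2 * eta * pk) = (W ^+ 2 - 1) * (2 * pk) * eta by ring.
  by rewrite ler_pdivrMr ?mul1r ?lerDl// ltr_wpDl.
pose eta0 := eta * k / (8 * M').
have eta00 : 0 < eta0 by rewrite divr_gt0 ?mulr_gt0.
have Hpow : 0 < dl < alpha by rewrite d0.
pose c1 := eta0 ^+ 2 / 512.
have c10 : 0 < c1 by apply: divr_gt0; rewrite ?exprn_gt0 ?ltr0n.
pose c2 := (4 * A)^-1 ^+ d * k / (2 * M').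
have c20 : 0 < c2 by rewrite divr_gt0 ?mulr_gt0// exprn_gt0// invr_gt0 mulr_gt0.
have dpos : 0 < d%:R :> R by apply: lt_trans alpha_ltd.
near=> t.
have t0 : 0 <= t by near: t; apply: nbhs_pinfty_ge; exact: num_real.
pose T := expR t; have T1 : 1 <= T by rewrite -expR0 ler_expR.
have T0 : 0 < T by exact: expR_gt0.
(* The kernel then lives within [1 / (8 rho) = T / 2], which leaves [T / 2] for the integer
   points. *)
pose rho := expR (- t) / 4.
have rho_gt0 : 0 < rho by rewrite divr_gt0 ?expR_gt0.
have Hrho : rho < rho0.
  apply: (@le_lt_trans _ _ (rho0 / 2)); last by rewrite ltr_pdivrMr// ltr_pMr// ltr1n.
  rewrite /rho mulrC -mulN1r; near: t; apply: expR_tends_to0; last by rewrite divr_gt0.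
  by rewrite oppr_lt0.
pose r := expR (- ((1 - dl) * t)).
have m1 : m r <= expR (- b1 * t).
  have : expR (- (alpha + dl) * ((1 - dl) * t)) <= m (expR (- ((1 - dl) * t))) <= expR (- (alpha - dl) * ((1 - dl) * t)).
    near: t; apply: (near_pinfty_scale (Q := fun s => expR (- (alpha + dl) * s) <= m (expR (- s)) <= expR (- (alpha - dl) * s))); first by rewrite subr_gt0.
    exact: power_law_bounds Hpow m_ge0 Hball.
  by move=> /andP[_ h]; rewrite /b1 mulNr -mulrA -mulNr.
pose tau := expR (- kp * t).
have [I [q [y [N [q0 q1 yV [ss0 cs0 mN muN Hoff]]]]]] := HK rho tau rho_gt0 Hrho (expR_gt0 _).
have tauE : expR (- dl * t) ^+ M = tau.
  by rewrite -expRM_natl /tau /kp; congr expR; ring.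
have tau1 : tau <= 1 by rewrite -expR0 ler_expR mulNr oppr_le0 mulr_ge0// ltW.
pose E := C * tau.
have E_0 : 0 <= E by rewrite mulr_ge0 ?expR_ge0// ltW.
have Hoff1 l : ~ N l -> ~ bL r l -> csym phase y q l <= E.
  move=> Nl rl; apply: le_trans (Hoff _ _ (expR_gt0 _) Nl rl) _.
  rewrite /E -tauE ler_pM2l//; apply: lerXn2r; rewrite ?nnegrE ?expR_ge0//.
    by rewrite divr_ge0 ?expR_ge0// ltW.
  rewrite /rho /r -expRN opprK mulrAC -expRD.
  rewrite (_ : - t + (1 - dl) * t = - dl * t); last by ring.
  by rewrite ler_pdivrMr// ler_peMr ?expR_ge0// ler1n.
pose v := 2 * expR (- b1 * t).
have v0 : 0 < v by rewrite mulr_gt0 ?expR_gt0.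
have vle : fine (\int[mu]_l (csym phase y q l ^+ 2)%:E)%E <= v.
  apply: le_trans (kernel_variance_le mphase mbL q0 q1 cs0 mN muN Hoff1 E_0) _.
  rewrite -/(m r) -/mT -addrA.
  have -> : v = expR (- b1 * t) + expR (- b1 * t) by rewrite /v; ring.
  apply: lerD => //.
  apply: (@le_trans _ _ ((1 + C ^+ 2 * mT) * expR (- kp * t))).
    rewrite mulrDl mul1r lerD2l /E exprMn -/tau mulrAC.
    apply: ler_wpM2l; first by rewrite mulr_ge0 ?sqr_ge0.
    by rewrite [leLHS]expr2 ler_piMr// expR_ge0.
  by near: t; apply: expR_dominates; rewrite ltrN2; exact: lt_trans HM.
have v64 : 8 * Num.sqrt v <= eta0.
  have h : 128 * expR (- b1 * t) <= eta0 ^+ 2.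
    by near: t; apply: expR_tends_to0; rewrite ?oppr_lt0// exprn_gt0.
  have s8 : 8 = Num.sqrt 64 :> R.
    by rewrite (_ : 64 = 8 ^+ 2) ?sqrtr_sqr ?ger0_norm//; ring.
  rewrite s8 -sqrtrM// -[leRHS]ger0_norm ?(ltW eta00)// -sqrtr_sqr; apply: ler_wsqrtr.
  by rewrite /v mulrA -natrM; exact: h.
(* The integer points lie within [A n <= T / 2], and there are at least [n^d >= (T / (4 A))^d] of
   them, whence [c2]. *)
pose n := Num.truncn (T / (2 * A)).
have TA : 4 * A <= T.
  by rewrite /T -[t]mul1r; near: t; exact: expR_ge_eventually.
have TA0 : 0 <= T / (2 * A) by rewrite divr_ge0 ?mulr_ge0 ?(ltW A_gt0)// ltW.
have n1 : n%:R <= T / (2 * A) by rewrite truncn_le.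
have n2 : T / (4 * A) <= n%:R.
  have : T / (2 * A) < n.+1%:R by exact: truncnS_gt.
  have -> : T / (2 * A) = 2 * (T / (4 * A)) by field; rewrite gt_eqF.
  have : 1 <= T / (4 * A) by rewrite ler_pdivlMr ?mulr_gt0// mul1r.
  by rewrite -[n.+1%:R]natr1; exact: half_le_pred.
have n0 : (0 < n)%N.
  by rewrite -(ltr0n R); apply: lt_le_trans n2; rewrite divr_gt0 ?mulr_gt0.
have [J [x [xV nJ Hform]]] := Hac n0.
have J0 : (0 < #|J|)%N by apply: leq_trans nJ; rewrite expn_gt0 n0.
apply: le_trans (nonneg_upper Sf mphase phaseD Kmu nu_le k_gt0 M_gt0 Hform eta_gt0 Heta
  q0 q1 ss0 v0 vle v64 J0 (mpersist T) _) _.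
  move=> w Hw i j; apply: Hw; have -> : T = 1 / (8 * rho) + T / 2.
    by rewrite /rho expRN -/T; field; rewrite gt_eqF.
  apply: bVD; first exact: yV.
  apply: bV_mono (xV j); rewrite mulrC -ler_pdivlMr//.
  by apply: le_trans n1 _; rewrite le_eqVlt; apply/orP; left; apply/eqP; field; rewrite gt_eqF.
(* The bound of [nonneg_upper] amounts to three exponentials, each at most [expR (- (Y + 2))], and
   [3 <= expR 2] absorbs the number three. *)
pose Y := expR ((alpha - e) * t).
have big1 : Y + 2 <= c1 * expR (b1 * t).
  have h1 : 2 / c1 * expR ((alpha - e) * t) <= expR (b1 * t) by near: t; exact: expR_dominates.
  have h2 : 4 / c1 <= expR (b1 * t) by near: t; exact: expR_ge_eventually.
  exact: margin_eventually.
have big2 : Y + 2 <= c2 * expR (d%:R * t).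
  have h1 : 2 / c2 * expR ((alpha - e) * t) <= expR (d%:R * t).
    near: t; apply: expR_dominates; apply: lt_trans de _; exact: lt_trans b1a _.
  have h2 : 4 / c2 <= expR (d%:R * t) by near: t; exact: expR_ge_eventually.
  exact: margin_eventually.
have Jk : c2 * expR (d%:R * t) <= #|J|%:R * k / (2 * M').
  rewrite /c2 mulrAC ler_pM2r ?invr_gt0 ?mulr_gt0// mulrAC ler_pM2r// expRM_natl -exprMn.
  apply: (@le_trans _ _ (n%:R ^+ d)); last by rewrite -natrX ler_nat.
  by apply: lerXn2r; rewrite ?nnegrE// ?mulr_ge0 ?expR_ge0 ?invr_ge0 ?mulr_ge0 ?(ltW A_gt0)// mulrC.
have X1 : eta0 ^+ 2 / (256 * v) = c1 * expR (b1 * t).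
  by rewrite /c1 /v mulNr expRN; field; rewrite gt_eqF ?expR_gt0.
rewrite lee_fin -/Y mulNr X1.
apply: (@le_trans _ _ (expR (- (Y + 2)) + 2 * expR (- (Y + 2)))).
  apply: lerD; first by rewrite ler_expR lerN2.
  by rewrite ler_pM2l// ler_expR lerN2; exact: le_trans Jk.
rewrite opprD expRD [expR (- 2)]expRN.
have e3 := @expR2_ge3 R.
have -> : expR (- Y) / expR 2 + 2 * (expR (- Y) / expR 2) = expR (- Y) * (3 / expR 2).
  by field; rewrite gt_eqF ?expR_gt0.
by rewrite ler_piMr ?expR_ge0// ler_pdivrMr ?expR_gt0// mul1r.
Unshelve. all: by end_near.
Qed.

Lemma abstract_power_growth : power_growth (fun T => theta f (bV T)) alpha.
Proof.
apply: power_growthP => e e0; near=> t.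
have lo : ((expR (- expR ((alpha + e) * t)))%:E <= P (persist (expR t)))%E.
  near: t; exact: persist_lower.
have up : (P (persist (expR t)) <= (expR (- expR ((alpha - e) * t)))%:E)%E.
  near: t; exact: persist_upper.
have [p pE] : exists p, P (persist (expR t)) = p%:E.
  by exists (fine (P (persist (expR t)))); rewrite fineK// fin_num_measure.
rewrite pE !lee_fin in lo up.
have p0 : 0 < p by apply: lt_le_trans lo; exact: expR_gt0.
exists (- ln p); split.
- by rewrite /theta -/(persist _) pE lne_EFin// EFinN.
- by rewrite lerNr -[leRHS]expRK ler_ln// posrE expR_gt0.
- by rewrite lerNl -[leLHS]expRK ler_ln// posrE expR_gt0.
Unshelve. all: by end_near.
Qed.

End abstract_growth.

(** * Fejer kernels *)

Section trigonometry.
Context {R : realType}.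
Implicit Types x u : R.

(** Otherwise the double angle formula would make [cos (2 u)] negative, although
    [|2 u| <= pi / 2]. *)
Lemma cos_ge_half u : `|u| <= pi / 4 -> 1 / 2 <= cos u.
Proof.
move=> hu; have [h1 h2] : - (pi / 4) <= u /\ u <= pi / 4 by move: hu; rewrite ler_norml => /andP[].
have c0 : 0 <= cos u.
  by apply: cos_ge0_pihalf; apply/andP; have := pi_ge0 R; split; lra.
have c2 : 0 <= cos (u *+ 2).
  have -> : u *+ 2 = u + u by rewrite mulr2n.
  by apply: cos_ge0_pihalf; apply/andP; split; lra.
rewrite leNgt; apply/negP => h; move: c2; rewrite cos_mulr2n -(mulr_natl (cos u ^+ 2)).
have : cos u ^+ 2 < (1 / 2) ^+ 2 by rewrite ltrXn2r// ?nnegrE.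
by rewrite !expr2; lra.
Qed.

Lemma sin_ge_quarter u : 0 <= u <= pi / 2 -> u / 4 <= sin u.
Proof.
move=> /andP[u0 u1]; have h0 : 0 <= u / 2 by rewrite divr_ge0.
have [xi] := @MVT_segment R sin cos 0 (u / 2) h0 (fun x _ => is_derive_sin x)
  (continuous_subspaceT (@continuous_sin R)).
rewrite in_itv/= sin0 !subr0 => /andP[xi0 xi1] sinE.
have cxi : 1 / 2 <= cos xi by apply: cos_ge_half; rewrite ger0_norm//; lra.
have cu : 1 / 2 <= cos (u / 2) by apply: cos_ge_half; rewrite ger0_norm//; lra.
have s4 : 1 / 2 * (u / 2) <= sin (u / 2) by rewrite sinE ler_wpM2r.
have -> : u = u / 2 *+ 2 by rewrite mulr2n; lra.
rewrite sin_mulr2n mulr2n.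
have : 1 / 2 * (1 / 2 * (u / 2)) <= cos (u / 2) * sin (u / 2).
  by apply: ler_pM => //; rewrite ?mulr_ge0.
lra.
Qed.

Lemma sin_pi_ge x : `|x| <= 1 / 2 -> `|x| / 2 <= `|sin (pi * x)|.
Proof.
have key (y : R) : 0 <= y <= 1 / 2 -> y / 2 <= sin (pi * y).
  move=> /andP[y0 y1]; have p2 := pi_ge2 R.
  apply: (@le_trans _ _ (pi * y / 4)).
    have : 2 * y <= pi * y by rewrite ler_wpM2r.
    lra.
  apply: sin_ge_quarter; rewrite mulr_ge0 ?pi_ge0//= ler_wpM2l ?pi_ge0//.
  by rewrite -[_^-1]mul1r.
move=> hx; have [x0|x0] := leP 0 x.
  by move: hx; rewrite ger0_norm// => hx; apply: le_trans (key _ _) (ler_norm _); rewrite x0.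
move: hx; rewrite ltr0_norm// => hx; rewrite -normrN -sinN -mulrN.
by apply: le_trans (key _ _) (ler_norm _); rewrite hx oppr_ge0 ltW.
Qed.

(** Multiplied by [2 sin (pi x)], both sums telescope; the squares of the results add up to
    [2 - 2 cos (A + pi x) <= 4]. *)
Lemma dirichlet_kernel_le (n : nat) x :
  sin (pi * x) ^+ 2 * ((\sum_(a < n) cos (2 * pi * (a%:R * x))) ^+ 2 +
    (\sum_(a < n) sin (2 * pi * (a%:R * x))) ^+ 2) <= 1.
Proof.
set s := sin (pi * x); set A := (2 * n%:R - 1) * (pi * x).
have hc : 2 * s * \sum_(a < n) cos (2 * pi * (a%:R * x)) = sin A + s.
  rewrite /A; elim: n {A} => [|n IH].
    by rewrite big_ord0 mulr0 mulr0 sub0r mulN1r sinN addNr.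
  rewrite big_ord_recr/= mulrDr IH.
  have -> : (2 * n.+1%:R - 1) * (pi * x) = 2 * pi * (n%:R * x) + pi * x.
    by rewrite -natr1; ring.
  have -> : (2 * n%:R - 1) * (pi * x) = 2 * pi * (n%:R * x) - pi * x by ring.
  by rewrite sinB sinD -/s; ring.
have hs : 2 * s * \sum_(a < n) sin (2 * pi * (a%:R * x)) = cos (pi * x) - cos A.
  rewrite /A; elim: n {A hc} => [|n IH].
    by rewrite big_ord0 mulr0 mulr0 sub0r mulN1r cosN subrr.
  rewrite big_ord_recr/= mulrDr IH.
  have -> : (2 * n.+1%:R - 1) * (pi * x) = 2 * pi * (n%:R * x) + pi * x.
    by rewrite -natr1; ring.
  have -> : (2 * n%:R - 1) * (pi * x) = 2 * pi * (n%:R * x) - pi * x by ring.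
  by rewrite cosB cosD -/s; ring.
set C := \sum_(a < n) _ in hc *; set S := \sum_(a < n) _ in hs *.
have -> : s ^+ 2 * (C ^+ 2 + S ^+ 2) = ((2 * s * C) ^+ 2 + (2 * s * S) ^+ 2) / 4 by field.
rewrite hc hs ler_pdivrMr// mul1r.
have h1 := cos2Dsin2 A; have h2 := cos2Dsin2 (pi * x); rewrite -/s in h2.
have h3 : (sin A + s) ^+ 2 + (cos (pi * x) - cos A) ^+ 2 =
  (cos A ^+ 2 + sin A ^+ 2) + (cos (pi * x) ^+ 2 + s ^+ 2) - 2 * cos (A + pi * x).
  by rewrite cosD -/s; ring.
by rewrite h3 h1 h2; have := cos_geN1 (A + pi * x); lra.
Qed.

End trigonometry.

Section symmetric_kernels.
Context {R : realType} {dL : measure_display} {L : measurableType dL} {V : zmodType}.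
Variable phase : V -> L -> R.
Hypothesis phaseD : forall x y l, phase (x + y) l = phase x l + phase y l.

(** A vanishing imaginary part makes the symbol real, so that convolving kernels multiplies the
    functions [g]. *)
Definition symmetric_kernel (Q : set V) (g : L -> R) : Prop :=
  exists (I : finType) (q : I -> R) (y : I -> V),
  [/\ forall i, 0 <= q i, \sum_i q i = 1, forall i, Q (y i) &
      forall l, ssym phase y q l = 0 /\ csym phase y q l = g l].

Lemma symmetric_kernel_le1 Q g l : symmetric_kernel Q g -> g l <= 1.
Proof.
move=> [I [q [y [q0 q1 _ /(_ l)[_ <-]]]]]; apply: le_trans (ler_norm _) _.
apply: le_trans (csym_le _ _ _ _) _; rewrite -q1; apply: ler_sum => i _.
by rewrite ger0_norm.
Qed.

Lemma symmetric_kernel1 (Q : set V) : Q 0 -> symmetric_kernel Q (fun=> 1).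
Proof.
move=> Q0; exists unit, (fun=> 1), (fun=> 0); split => // [|l].
  by rewrite big_const card_unit/= addr0.
rewrite /ssym /csym !big_const card_unit/= (phase0 phaseD) !mulr0 sin0 cos0.
by rewrite mulr0 mulr1 !addr0.
Qed.

Lemma symmetric_kernelM (Q1 Q2 Q : set V) g1 g2 :
  (forall x y, Q1 x -> Q2 y -> Q (x + y)) ->
  symmetric_kernel Q1 g1 -> symmetric_kernel Q2 g2 ->
  symmetric_kernel Q (fun l => g1 l * g2 l).
Proof.
move=> QD [I1 [q1 [y1 [q10 q11 y1Q h1]]]] [I2 [q2 [y2 [q20 q21 y2Q h2]]]].
exists (I1 * I2)%type, (fun o => q1 o.1 * q2 o.2), (fun o => y1 o.1 + y2 o.2); split.
- by move=> o; rewrite mulr_ge0.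
- rewrite -(pair_bigA _ (fun i j => q1 i * q2 j))/= -[RHS]q11; apply: eq_bigr => i _.
  by rewrite -mulr_sumr q21 mulr1.
- by move=> o; exact: QD.
- move=> l; have [s1 c1] := h1 l; have [s2 c2] := h2 l; split.
  + by rewrite (ssym_prod phaseD) s1 s2 mul0r mulr0 addr0.
  + by rewrite (csym_prod phaseD) s1 mul0r subr0 c1 c2.
Qed.

Lemma phaseMn v n l : phase (v *+ n) l = n%:R * phase v l.
Proof.
elim: n => [|n IH]; first by rewrite mulr0n (phase0 phaseD) mul0r.
by rewrite mulrS phaseD IH -natr1 mulrDl mul1r addrC.
Qed.

(* The squared modulus of the normalised Dirichlet kernel. *)
Lemma fejer_kernel (Q : set V) (v : V) (n : nat) : (0 < n)%N ->
  (forall a b : 'I_n, Q (v *+ a - v *+ b)) ->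
  exists g, [/\ symmetric_kernel Q g, forall l, 0 <= g l &
    forall l, g l * (n%:R * sin (pi * phase v l)) ^+ 2 <= 1].
Proof.
move=> n0 Qv; have nR : 0 < n%:R :> R by rewrite ltr0n.
pose C l := \sum_(a < n) cos (2 * pi * (a%:R * phase v l)).
pose S l := \sum_(a < n) sin (2 * pi * (a%:R * phase v l)).
exists (fun l => n%:R^-2 * (C l ^+ 2 + S l ^+ 2)); split.
- exists ('I_n * 'I_n)%type, (fun=> n%:R^-2), (fun o : 'I_n * 'I_n => v *+ o.1 - v *+ o.2); split => //.
  + rewrite sumr_const card_prod card_ord -[_ *+ (n * n)]mulr_natl natrM -expr2 divff//.
    by rewrite expf_neq0// gt_eqF.
  + move=> l; split.
      have -> : 0 = n%:R^-2 * (S l * C l - C l * S l) by rewrite [C l * _]mulrC subrr mulr0.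
      rewrite /ssym -mulr_sumr /C /S; congr (_ * _).
      rewrite -(pair_bigA _ (fun i j : 'I_n => sin (2 * pi * phase (v *+ i - v *+ j) l)))/=.
      rewrite !mulr_suml -sumrB; apply: eq_bigr => i _; rewrite !mulr_sumr -sumrB; apply: eq_bigr => j _.
      by rewrite (phaseB phaseD) !phaseMn mulrBr sinB.
    rewrite /csym -mulr_sumr /C /S; congr (_ * _).
    rewrite -(pair_bigA _ (fun i j : 'I_n => cos (2 * pi * phase (v *+ i - v *+ j) l)))/=.
    rewrite !expr2 !mulr_suml -big_split; apply: eq_bigr => i _; rewrite !mulr_sumr -big_split; apply: eq_bigr => j _.
    by rewrite (phaseB phaseD) !phaseMn mulrBr cosB.
- by move=> l; rewrite mulr_ge0 ?invr_ge0 ?addr_ge0 ?sqr_ge0.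
- move=> l; rewrite exprMn.
  have -> : n%:R^-2 * (C l ^+ 2 + S l ^+ 2) * (n%:R ^+ 2 * sin (pi * phase v l) ^+ 2) =
     sin (pi * phase v l) ^+ 2 * (C l ^+ 2 + S l ^+ 2) by field; rewrite gt_eqF.
  exact: dirichlet_kernel_le.
Qed.

End symmetric_kernels.

Section euclidean_norm.
Context {R : realType} {d : nat}.
Implicit Types x y : 'rV[R]_d.

Lemma psd_dotr : psd_form (@dotr R d).
Proof.
split=> [x y|t x y z|x]; rewrite /dotr.
- by apply: eq_bigr => i _; rewrite mulrC.
- by rewrite mulr_sumr -big_split/=; apply: eq_bigr => i _; rewrite !mxE mulrDl mulrA.
- by apply: sumr_ge0 => i _; rewrite -expr2 sqr_ge0.
Qed.

Lemma dotr_sqr_ge0 x : 0 <= dotr x x. Proof. exact: psd_ge0 psd_dotr x. Qed.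

Lemma eballP (T : R) x : eball T x <-> 0 <= T /\ dotr x x <= T ^+ 2.
Proof.
rewrite /eball/=; split=> [h|[T0 h]].
  have T0 : 0 <= T by apply: le_trans h; exact: sqrtr_ge0.
  by split => //; rewrite -[leLHS]sqr_sqrtr ?dotr_sqr_ge0// lerXn2r ?nnegrE ?sqrtr_ge0.
by rewrite -[leRHS]ger0_norm// -sqrtr_sqr ler_wsqrtr.
Qed.

Lemma dotr_le x y (T T' : R) : eball T x -> eball T' y -> `|dotr x y| <= T * T'.
Proof.
move=> /eballP[T0 xT] /eballP[T'0 yT].
rewrite -[leRHS]ger0_norm ?mulr_ge0// -!sqrtr_sqr ler_wsqrtr// exprMn.
by apply: le_trans (psd_cauchy psd_dotr _ _) _; apply: ler_pM => //; exact: dotr_sqr_ge0.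
Qed.

Lemma eball_mono (T T' : R) : T <= T' -> @eball R d T `<=` @eball R d T'.
Proof. by move=> TT' x; rewrite /eball/= => h; exact: le_trans TT'. Qed.

Lemma eballD (T T' : R) x y : eball T x -> eball T' y -> eball (T + T') (x + y).
Proof.
move=> hx hy; have := dotr_le hx hy; rewrite ler_norml => /andP[_ xy].
move/eballP: hx => [T0 xT]; move/eballP: hy => [T'0 yT].
apply/eballP; split; first exact: addr_ge0.
rewrite (psdDl psd_dotr) !(psdDr psd_dotr) (psd_sym psd_dotr y x) sqrrD -mulr_natr.
lra.
Qed.

Lemma eballZ (T : R) (s : R) x : eball T x -> eball (`|s| * T) (s *: x).
Proof.
move=> /eballP[T0 xT]; apply/eballP; split; first exact: mulr_ge0.
rewrite (psdZl psd_dotr) (psdZr psd_dotr) mulrA -expr2 exprMn real_normK ?num_real//.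
by rewrite ler_wpM2l ?sqr_ge0.
Qed.

Lemma eball0 (T : R) : 0 <= T -> @eball R d T 0.
Proof. by move=> T0; apply/eballP; split => //; rewrite (psd0l psd_dotr) sqr_ge0. Qed.

Lemma eball_coord (c : R) x : 0 <= c -> (forall j, `|x 0 j| <= c) -> eball (d%:R * c) x.
Proof.
move=> c0 xc; apply/eballP; split; first by rewrite mulr_ge0.
apply: (@le_trans _ _ (d%:R * c ^+ 2)).
  apply: (@le_trans _ _ (\sum_(j < d) c ^+ 2)).
    by apply: ler_sum => j _; rewrite -expr2 -real_normK ?num_real// lerXn2r ?nnegrE.
  by rewrite sumr_const card_ord mulr_natl.
rewrite exprMn ler_wpM2r ?sqr_ge0// -natrX ler_nat.
by case: (d) => // n; rewrite leq_pmulr.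
Qed.

Lemma coord_le_eball (T : R) x j : eball T x -> `|x 0 j| <= T.
Proof.
move=> /eballP[T0 xT]; rewrite -[leRHS]ger0_norm// -!sqrtr_sqr ler_wsqrtr//.
apply: le_trans xT; rewrite /dotr (bigD1 j)//= -expr2 lerDl.
by apply: sumr_ge0 => i _; rewrite -expr2 sqr_ge0.
Qed.

Lemma not_eball_coord (r : R) x : (0 < d)%N -> 0 < r -> ~ eball r x -> exists j, r / d%:R <= `|x 0 j|.
Proof.
move=> d0 r0 hx; apply: contrapT => h; apply: hx.
have dR : 0 < d%:R :> R by rewrite ltr0n.
have -> : r = d%:R * (r / d%:R) by field; rewrite gt_eqF.
apply: eball_coord; first by rewrite divr_ge0 ?ltW.
move=> j; rewrite leNgt; apply/negP => hj; apply: h; exists j; exact: ltW.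
Qed.

End euclidean_norm.

Section kernel_products.
Context {R : realType} {dL : measure_display} {L : measurableType dL} {V : zmodType}.
Variable phase : V -> L -> R.
Hypothesis phaseD : forall x y l, phase (x + y) l = phase x l + phase y l.
Variable bV : R -> set V.
Hypothesis bVD : forall T T' x y, bV T x -> bV T' y -> bV (T + T') (x + y).
Hypothesis bV0 : bV 0 0.

Lemma symmetric_kernel_prod (I : Type) (s : seq I) (T : R) (g : I -> L -> R) :
  (forall i, symmetric_kernel phase (bV T) (g i)) ->
  symmetric_kernel phase (bV ((size s)%:R * T)) (fun l => \prod_(i <- s) g i l).
Proof.
move=> hg; elim: s => [|i s IH].
  rewrite (_ : (fun l => _) = fun=> 1); last by apply/funext => l; rewrite big_nil.
  by rewrite mul0r; exact: symmetric_kernel1.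
rewrite (_ : (fun l => _) = fun l => g i l * \prod_(j <- s) g j l); last first.
  by apply/funext => l; rewrite big_cons.
apply: symmetric_kernelM (hg i) IH => // x y /bVD h /h.
by rewrite /= -nat1r mulrDl mul1r.
Qed.

Lemma symmetric_kernelX (M : nat) (T : R) (g : L -> R) :
  symmetric_kernel phase (bV T) g ->
  symmetric_kernel phase (bV (M%:R * T)) (fun l => g l ^+ M).
Proof.
move=> hg; rewrite (_ : (fun l => _) = fun l => \prod_(i <- nseq M tt) g l); last first.
  by apply/funext => l; rewrite big_nseq; elim: M => // M IH; rewrite exprS IH.
by rewrite -{1}(size_nseq M tt); apply: (@symmetric_kernel_prod unit).
Qed.

End kernel_products.

(** Linear decay of one Fejer factor is enough, since the product is raised to an arbitrary power
    afterwards. *)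
Lemma le_inv_of_sqr {R : realFieldType} (g z z0 : R) : 0 <= g <= 1 -> 0 < z0 -> z0 <= z ->
  g * z ^+ 2 <= 1 -> g <= z0^-1.
Proof.
move=> /andP[g0 g1] z00 zz0 h; have [z1|z1] := leP z0 1.
  by apply: le_trans g1 _; rewrite invf_ge1.
rewrite -[leRHS]mul1r ler_pdivlMr//; apply: le_trans h; rewrite ler_wpM2l//.
have h1 : 1 <= z by rewrite ltW// (lt_le_trans z1).
by apply: le_trans zz0 _; rewrite expr2 ler_peMr// (le_trans ler01).
Qed.

(** * Kernels built coordinate by coordinate *)

Section coordinates.
Context {R : realType} {dL : measure_display} {L : measurableType dL} {V : zmodType} {d : nat}.
Variables (c : L -> 'rV[R]_d) (emb : V -> 'rV[R]_d).
Hypothesis mc : forall j, measurable_fun setT (fun l => c l 0 j).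
Hypothesis embD : forall x y, emb (x + y) = emb x + emb y.

Definition coord_phase (x : V) (l : L) : R := dotr (c l) (emb x).
Definition coord_ball (r : R) : set L := [set l | eball r (c l)].
Definition emb_ball (T : R) : set V := [set x | eball T (emb x)].

Lemma emb0 : emb 0 = 0.
Proof. by have := embD 0 0; rewrite addr0 => /eqP; rewrite -subr_eq subrr => /eqP. Qed.

Lemma embB x y : emb (x - y) = emb x - emb y.
Proof. by rewrite -{2}[x](subrK y) embD addrK. Qed.

Lemma embMn x n : emb (x *+ n) = emb x *+ n.
Proof. by elim: n => [|n IH]; rewrite ?mulr0n ?emb0// !mulrS embD IH. Qed.

Lemma coord_phaseD x y l : coord_phase (x + y) l = coord_phase x l + coord_phase y l.
Proof. by rewrite /coord_phase embD (psdDr psd_dotr). Qed.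

Lemma measurable_coord_phase x : measurable_fun setT (coord_phase x).
Proof.
apply: measurable_sum => j; apply: measurable_funM; [exact: mc|exact: measurable_cst].
Qed.

Lemma measurable_coord_ball r : measurable (coord_ball r).
Proof.
have [r0|r0] := leP 0 r; last first.
  rewrite (_ : coord_ball r = set0)//; apply/seteqP; split => // l /eballP[].
  by rewrite leNgt r0.
rewrite (_ : coord_ball r = (fun l => dotr (c l) (c l)) @^-1` `]-oo, r ^+ 2]%classic).
  rewrite -[X in measurable X]setTI; apply: measurable_sum => // j.
  by apply: measurable_funM; exact: mc.
by apply/seteqP; split => l /=; rewrite in_itv/= => h; [case/eballP: h|apply/eballP].
Qed.

Lemma coord_ball_mono r r' : r <= r' -> coord_ball r `<=` coord_ball r'.
Proof. by move=> rr' l; exact: eball_mono. Qed.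

Lemma emb_ball_mono T T' : T <= T' -> emb_ball T `<=` emb_ball T'.
Proof. by move=> TT' l; exact: eball_mono. Qed.

Lemma emb_ballD T T' x y : emb_ball T x -> emb_ball T' y -> emb_ball (T + T') (x + y).
Proof. by rewrite /emb_ball/= embD; exact: eballD. Qed.

Lemma coord_phase_cos l r x T : coord_ball r l -> emb_ball T x -> r * T <= 1 / 8 ->
  1 / 2 <= cos (2 * pi * coord_phase x l).
Proof.
move=> lr xT rT; apply: cos_ge_half; rewrite normrM ger0_norm ?mulr_ge0 ?pi_ge0//.
have : `|coord_phase x l| <= 1 / 8 by apply: le_trans rT; exact: dotr_le.
move=> h; apply: (@le_trans _ _ (2 * pi * (1 / 8))); last by have := pi_ge0 R; lra.
by rewrite ler_wpM2l// mulr_ge0// pi_ge0.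
Qed.

Variable mu : {finite_measure set L -> \bar R}.
Hypothesis d_gt0 : (0 < d)%N.
Hypothesis Hstep : forall tau : R, 0 < tau -> exists (s : R) (v : 'I_d -> V),
  [/\ 0 < s, s <= 1, forall j, emb (v j) = s *: delta_mx 0 j &
    (mu [set l | exists j, (1 / 2 < s * `|c l 0 j|)%R] <= tau%:E)%E].

Lemma coord_kernels (M : nat) : exists C rho0 : R, [/\ 0 < C, 0 < rho0 &
  forall rho tau : R, 0 < rho -> rho < rho0 -> 0 < tau ->
  exists (I : finType) (q : I -> R) (y : I -> V) (N : set L),
  [/\ forall i, 0 <= q i, \sum_i q i = 1, forall i, emb_ball (1 / (8 * rho)) (y i) &
   [/\ forall l, ssym coord_phase y q l = 0, forall l, 0 <= csym coord_phase y q l,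
     measurable N, (mu N <= tau%:E)%E &
     forall (r : R) l, 0 < r -> ~ N l -> ~ coord_ball r l ->
       csym coord_phase y q l <= C * (rho / r) ^+ M]]].
Proof.
have dR : 0 < d%:R :> R by rewrite ltr0n.
(* The successor keeps the divisor positive when [M = 0]. *)
pose m : R := M.+1%:R; have m0 : 0 < m by rewrite ltr0n.
exists ((32 * d%:R ^+ 2 * m) ^+ M), (8 * d%:R * m)^-1.
have K0 : 0 < 32 * d%:R ^+ 2 * m by rewrite !mulr_gt0// exprn_gt0.
split; [by rewrite exprn_gt0|by rewrite invr_gt0 !mulr_gt0|].
move=> rho tau rho_gt0 rho_lt tau0.
have [s [v [s0 s1 vE muN]]] := Hstep tau0.
(* Each factor reaches distance [n s] and there are [M d] of them, so [n <= z] places the support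
   within [1 / (8 rho)]. The choice of [rho0] and [s <= 1] give [z >= 1], hence [n > 0]. *)
pose z := (8 * rho * d%:R * m * s)^-1.
have z1 : 1 <= z.
  rewrite invf_ge1 ?mulr_gt0//; apply: (@le_trans _ _ (8 * rho * d%:R * m)).
    by rewrite ler_piMr// !mulr_ge0// ltW.
  move: rho_lt; rewrite -[X in _ < X]mul1r ltr_pdivlMr ?mulr_gt0// => /ltW.
  by apply: le_trans; rewrite le_eqVlt; apply/orP; left; apply/eqP; ring.
pose n := Num.truncn z.
have n0 : (0 < n)%N by rewrite truncn_gt0.
have nz : n%:R <= z by rewrite truncn_le (le_trans ler01 z1).
have zn : z / 2 <= n%:R.
  have : z < n.+1%:R by exact: truncnS_gt.
  have : 1 <= n%:R :> R by rewrite ler1n.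
  by rewrite -[n.+1%:R]natr1; lra.
have /choice[g Hg] (j : 'I_d) : exists g : L -> R,
    [/\ symmetric_kernel coord_phase (emb_ball (n%:R * s)) g, forall l, 0 <= g l &
     forall l, g l * (n%:R * sin (pi * coord_phase (v j) l)) ^+ 2 <= 1].
  apply: (fejer_kernel coord_phaseD n0) => a b; rewrite /emb_ball/= embB !embMn vE.
  rewrite -[_ *+ a]scaler_nat -[_ *+ b]scaler_nat !scalerA -scalerBl.
  apply: (@eball_mono _ _ (`|a%:R * s - b%:R * s| * 1)); last first.
    apply: eballZ; apply/eballP; split => //; rewrite /dotr (bigD1 j)//= big1 ?addr0.
      by rewrite mxE !eqxx/= mulr1 expr1n.
    by move=> i /negbTE ij; rewrite !mxE ij andbF mulr0.
  rewrite mulr1 -mulrBl normrM (gtr0_norm s0) ler_pM2r// ler_norml.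
  have an : a%:R <= n%:R :> R by rewrite ler_nat ltnW.
  have bn : b%:R <= n%:R :> R by rewrite ler_nat ltnW.
  have a0 : 0 <= a%:R :> R by []. 
  have b0 : 0 <= b%:R :> R by [].
  by apply/andP; split; lra.
have gk j : symmetric_kernel coord_phase (emb_ball (n%:R * s)) (g j) by case: (Hg j).
have g0 j l : 0 <= g j l by case: (Hg j).
have g1 j l : g j l <= 1 by exact: symmetric_kernel_le1 (gk j).
have gs j l : g j l * (n%:R * sin (pi * coord_phase (v j) l)) ^+ 2 <= 1 by case: (Hg j).
pose G l := \prod_(j < d) g j l.
have b00 : emb_ball 0 0 by rewrite /emb_ball/= emb0; exact: eball0.
have := symmetric_kernelX coord_phaseD emb_ballD b00 M
  (symmetric_kernel_prod coord_phaseD emb_ballD b00 (enum 'I_d) gk).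
move=> [I [q [y [q0 q1 yT hl]]]].
exists I, q, y, [set l | exists j, 1 / 2 < s * `|c l 0 j|].
have cE l : csym coord_phase y q l = G l ^+ M.
  by have [_ ->] := hl l; rewrite /G big_enum.
split => //.
  move=> i; apply: emb_ball_mono (yT i).
  rewrite size_enum_ord.
  apply: (@le_trans _ _ (m * (d%:R * (z * s)))).
    apply: ler_pM; rewrite ?mulr_ge0 ?(ltW s0)// ?ler_nat//.
    by rewrite ler_pM2l// ler_pM2r.
  by rewrite /z le_eqVlt; apply/orP; left; apply/eqP; field; rewrite !gt_eqF.
split => //.
- by move=> l; case: (hl l).
- by move=> l; rewrite cE exprn_ge0// prodr_ge0.
- rewrite (_ : [set l | _] = \bigcup_(j in [set: 'I_d]) ((fun l => s * `|c l 0 j|) @^-1` `]1 / 2, +oo[%classic)).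
    apply: (fin_bigcup_measurable finite_finset) => j _.
    rewrite -[X in measurable X]setTI; apply: measurable_funM => //.
    by apply: measurableT_comp => //; exact: mc.
  apply/seteqP; split => l; last first.
    by move=> [j _ /=]; rewrite in_itv/= andbT => h; exists j.
  by move=> [j h]; exists j => //=; rewrite in_itv/= andbT.
- move=> r l r0 Nl rl; rewrite cE -exprMn lerXn2r ?nnegrE ?prodr_ge0//.
    by rewrite mulr_ge0 ?divr_ge0 ?ltW.
  (* One large coordinate suffices, the other factors being at most 1. There [n |sin|] is at least
     [(z / 2) (s r / (2 d))], which is [r / (32 d^2 m rho)]. *)
  have [j hj] := not_eball_coord d_gt0 r0 rl.
  have Gj : G l <= g j l.
    rewrite /G (bigD1 j)//= ler_piMr//.
    by apply: (@le_trans _ _ (\prod_(i < d | i != j) 1)); [apply: ler_prod => i _; rewrite g0 g1|rewrite big1].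
  apply: (le_trans Gj).
  have -> : 32 * d%:R ^+ 2 * m * (rho / r) = (r / (32 * d%:R ^+ 2 * m * rho))^-1.
    by field; rewrite !gt_eqF.
  have phE : coord_phase (v j) l = s * c l 0 j.
    rewrite /coord_phase vE (psdZr psd_dotr) /dotr (bigD1 j)//= mxE !eqxx mulr1 big1 ?addr0// => i /negbTE ij.
    by rewrite mxE ij andbF mulr0.
  have sc : `|s * c l 0 j| <= 1 / 2.
    by rewrite normrM gtr0_norm// leNgt; apply/negP => h; apply: Nl; exists j.
  apply: (@le_inv_of_sqr _ _ (n%:R * `|sin (pi * coord_phase (v j) l)|)).
  + by rewrite g0 g1.
  + by rewrite divr_gt0 ?mulr_gt0// exprn_gt0.
  + apply: (@le_trans _ _ (z / 2 * (s * (r / d%:R) / 2))).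
      by rewrite /z le_eqVlt; apply/orP; left; apply/eqP; field; rewrite !gt_eqF.
    apply: ler_pM; rewrite ?divr_ge0 ?mulr_ge0 ?divr_ge0 ?(ltW s0) ?(ltW r0) ?(ltW dR)//.
      by apply: le_trans z1.
    rewrite phE; apply: le_trans (sin_pi_ge sc); rewrite normrM (gtr0_norm s0).
    by rewrite ler_pM2r// ler_pM2l.
  + by rewrite exprMn real_normK ?num_real// -exprMn.
Qed.

End coordinates.

(** * Lebesgue measure on boxes *)

Lemma measurable_open_lower {R : realType} {T : ptopologicalType}
    (g : g_sigma_algebraType (@open T) -> R) :
  (forall x, open [set t : T | x < g t]) -> measurable_fun setT g.
Proof.
move=> og; apply: (measurability _ (RGenOInfty.measurableE R)) => _ [_ [x ->] <-].
rewrite setTI; apply: sub_sigma_algebra.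
rewrite (_ : g @^-1` _ = [set t : T | x < g t]); first exact: og.
by apply/seteqP; split => t /=; rewrite in_itv/= andbT.
Qed.

Section borel_vectors.
Context {R : realType} {d : nat}.

Lemma measurable_coord (j : 'I_d) : measurable_fun setT (fun v : borel_rV R d => v 0 j : R).
Proof.
apply: (@measurable_open_lower R 'rV[R]_d) => x.
have /continuousP h : continuous (fun v : 'rV[R]_d => v 0 j) by exact: coord_continuous.
exact: h _ (@open_gt R x).
Qed.

(** Written over all rational cubes, those not contained in [U] contributing the empty set, so that
    the union is countable. This is what makes a map with measurable coordinates Borel. *)
Lemma open_rational_boxes (U : set 'rV[R]_d) : open U ->
  U = \bigcup_(q : 'rV[rat]_d * rat) [set v | U v /\
    (forall j, `|v 0 j - ratr (q.1 0 j)| < ratr q.2) /\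
    (forall w : 'rV[R]_d, (forall j, `|w 0 j - ratr (q.1 0 j)| < ratr q.2) -> U w)].
Proof.
move=> oU; apply/seteqP; split => [v Uv|v [q _ []]//].
have /nbhs_ballP[e /= e0 eU] : nbhs v U by exact: open_nbhs_nbhs.
have [r] : exists r : rat, ratr r \in `](0 : R), (e / 2)[ by apply: rat_in_itvoo; rewrite divr_gt0.
rewrite in_itv/= => /andP[r0 re].
have /choice[p Hp] (j : 'I_d) : exists p : rat, `|v 0 j - ratr p| < ratr r.
  have [p] : exists p : rat, ratr p \in `](v 0 j - ratr r), (v 0 j + ratr r)[.
    by apply: rat_in_itvoo; rewrite ltrD2l gtrN.
  by rewrite in_itv/= => hp; exists p; rewrite distrC ltr_distl.
exists (\row_j p j, r) => //; split => //; split => [j|w hw]; first by rewrite mxE.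
apply: eU; split => // i j; rewrite !ord1 /ball/= -(subrK (ratr (p j)) (v 0 j)) -addrA.
apply: le_lt_trans (ler_normD _ _) _; rewrite [e]splitr; apply: ltrD.
  exact: lt_trans re.
by apply: lt_trans re; have := hw j; rewrite mxE distrC.
Qed.

Lemma measurable_vector d' {T : measurableType d'} (F : T -> borel_rV R d) :
  (forall j, measurable_fun setT (fun t => F t 0 j)) -> measurable_fun setT F.
Proof.
move=> mF; apply: (@measurability _ _ T (borel_rV R d) setT F (@open 'rV[R]_d) erefl) => _ [U oU <-]; rewrite setTI.
rewrite (open_rational_boxes oU) preimage_bigcup.
apply: countable_bigcupT_measurable; first exact: countableP.
move=> q; have [hq|hq] := pselect (forall w : 'rV[R]_d,
    (forall j, `|w 0 j - ratr (q.1 0 j)| < ratr q.2) -> U w); last first.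
  rewrite (_ : _ @^-1` _ = set0)//; apply/seteqP; split => // t [_ [_ h]].
  by apply: hq.
rewrite (_ : _ @^-1` _ = \bigcap_(j in [set: 'I_d])
    ((fun t => F t 0 j) @^-1` `](ratr (q.1 0 j) - ratr q.2), (ratr (q.1 0 j) + ratr q.2)[%classic)).
  apply: (fin_bigcap_measurable finite_finset) => j _.
  by rewrite -[X in measurable X]setTI; exact: mF.
apply/seteqP; split => t /=.
  by move=> [_ [h _]] j _ /=; rewrite in_itv/= -ltr_distl.
move=> h; have h' j : `|(F t : 'rV[R]_d) 0 j - ratr (q.1 0 j)| < ratr q.2.
  by have := h j Logic.I; rewrite /= in_itv/= ltr_distl.
by split; [exact: hq|split].
Qed.

End borel_vectors.

Section finite_of_measure.
Context {R : realType} {dT : measure_display} {T : measurableType dT}.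
Variable m : {measure set T -> \bar R}.
Hypothesis mfin : (m setT < +oo)%E.

(** Repackages a measure of finite total mass, such as a pushforward, at the type of finite
    measures. *)
Lemma finite_copy : exists2 m' : {finite_measure set T -> \bar R},
  forall A, m' A = m A & forall f : T -> \bar R, (\int[m']_x f x = \int[m]_x f x)%E.
Proof.
exists (mfrestr measurableT mfin) => [A|f]; first by rewrite /= /mfrestr /mrestr setIT.
by apply: eq_measure_integral => A _ _; rewrite /= /mfrestr /mrestr setIT.
Qed.

End finite_of_measure.

Section interval_cosine.
Context {R : realType}.
Local Notation leb := (@lebesgue_measure R).

Lemma sin_add_period (x : R) (m : int) : sin (x + 2 * pi * m%:~R) = sin x.
Proof.
have key (n : nat) (y : R) : sin (y + 2 * pi * n%:R) = sin y.
  rewrite -[RHS](periodicn (@sinD2pi R) n); congr sin; congr (_ + _).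
  by rewrite mulr_natr mulr_natl.
case: m => n; first exact: key.
by rewrite NegzE -[LHS](key n.+1) mulrNz mulrN subrK.
Qed.

Lemma integral_cos_period (a : R) (n : nat) (k : int) (th : R) : (0 < n)%N ->
  (\int[leb]_(t in `[a, (a + n%:R)%R[) (cos (2 * pi * (t * k%:~R) + th))%:E =
   (if k == 0 then n%:R * cos th else 0)%:E)%E.
Proof.
move=> n0; have ab : a < a + n%:R by rewrite ltrDl ltr0n.
have [->|k0] := eqVneq k 0.
  under eq_integral do rewrite mulr0 mulr0 add0r.
  rewrite integral_cst//= lebesgue_measure_itv/= lte_fin ab -EFinB -EFinM.
  by congr (_%:E); rewrite addrC addKr mulrC.
pose w : R := 2 * pi * k%:~R.
have w0 : w != 0 by rewrite /w mulf_neq0 ?intr_eq0// mulf_neq0 ?pnatr_eq0// gt_eqF ?pi_gt0.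
pose g (t : R) := cos (2 * pi * (t * k%:~R) + th).
pose F (t : R) := w^-1 * sin (2 * pi * (t * k%:~R) + th).
have dF (t : R) : is_derive t (1 : R) F (g t).
  have d1 : is_derive t (1 : R) (fun t : R => 2 * pi * (t * k%:~R) + th) w.
    have -> : (fun t : R => 2 * pi * (t * k%:~R) + th) = (fun t => w *: t + th).
      by apply/funext => u; rewrite /w /GRing.scale/=; ring.
    by apply: is_derive_eq; rewrite addr0 /GRing.scale/= mulr1.
  have h := @is_derive1_comp R sin (fun t : R => 2 * pi * (t * k%:~R) + th) t _ _ (is_derive_sin _) d1.
  have {}h : is_derive t (1 : R) F (w^-1 *: (cos (2 * pi * (t * k%:~R) + th) * w)) by exact: is_deriveZ.
  apply: is_derive_eq h _.
  by rewrite /GRing.scale/= [w^-1 * _]mulrC mulfK.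
have cF : continuous F.
  move=> t; apply/differentiable_continuous/derivable1_diffP.
  by have [] := dF t.
have cg : continuous g.
  move=> t; apply: continuous_comp; last exact: continuous_cos.
  apply: (@differentiable_continuous _ _ _ _ (fun t : R => 2 * pi * (t * k%:~R) + th)).
  by apply/derivable1_diffP.
rewrite integral_itv_bndo_bndc; last first.
  apply: measurable_funTS; apply/measurable_EFinP.
  exact: continuous_measurable_fun.
rewrite (@continuous_FTC2 R g F a (a + n%:R) ab).
- rewrite -EFinB; congr (_%:E); rewrite /F -mulrBr.
  have -> : 2 * pi * ((a + n%:R) * k%:~R) + th = 2 * pi * (a * k%:~R) + th + 2 * pi * (n%:Z * k)%:~R.
    by rewrite intrM; ring.
  by rewrite sin_add_period subrr mulr0.
- exact: continuous_subspaceT.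
- split; first by move=> t _; have [] := dF t.
    by apply: cvg_at_right_filter; exact: cF.
  by apply: cvg_at_left_filter; exact: cF.
- by move=> t _; rewrite derive1E; have [] := dF t.
Qed.

End interval_cosine.

Section box_measure.
Context {R : realType}.
Local Notation leb := (@lebesgue_measure R).

Lemma bounded_integrable_of_finite {dT} {T : measurableType dT} (m : {measure set T -> \bar R})
    (g : T -> R) (M : R) : (m setT < +oo)%E -> measurable_fun setT g -> (forall t, `|g t| <= M) ->
  m.-integrable setT (EFin \o g).
Proof.
move=> mfin mg gM; apply/integrableP; split; first exact/measurable_EFinP.
apply: (@le_lt_trans _ _ (\int[m]_t (cst M%:E) t)%E).
  apply: ge0_le_integral => //.
  - by apply/measurable_EFinP; exact: measurableT_comp.
  - by move=> t _; rewrite lee_fin.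
rewrite integral_cst//; have m0 : m setT \is a fin_num by rewrite ge0_fin_numE.
by rewrite -(fineK m0) -EFinM ltry.
Qed.

Definition box {d : nat} (a b : R) : set 'rV[R]_d := [set u | forall i, a <= u 0 i < b].

Lemma finite_restriction {dT} {T : measurableType dT} (m : {measure set T -> \bar R}) (D : set T) :
  measurable D -> (m D < +oo)%E ->
  exists lam : {finite_measure set T -> \bar R}, [/\ forall A, lam A = m (A `&` D),
    forall f, measurable_fun setT f -> (forall x, (0 <= f x)%E) ->
      (\int[lam]_x f x = \int[m]_(x in D) f x)%E &
    forall f, lam.-integrable setT f -> (\int[lam]_x f x = \int[m]_(x in D) f x)%E].
Proof.
move=> mD mfin; pose lam : {finite_measure set T -> \bar R} := mfrestr mD mfin.
have lamC : lam (~` D) = 0%E by rewrite /= /mfrestr /mrestr setICl measure0.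
have lamD f : (\int[lam]_(x in D) f x = \int[m]_(x in D) f x)%E.
  by apply: eq_measure_integral => A mA AD; rewrite /= /mfrestr /mrestr setIidl.
have mC := measurableC mD.
exists lam; split => // f.
  by move=> mf f0; rewrite (@ge0_negligible_integral _ _ _ lam setT (~` D))// setDE setCK setTI.
by move=> iF; rewrite (@negligible_integral _ _ _ lam setT (~` D))// setDE setCK setTI.
Qed.

Lemma row_mx_head d (t : R) (v : 'rV[R]_d) (i : 'I_1) :
  (row_mx (t%:M : 'rV[R]_1) v : 'rV[R]_d.+1) 0 (lshift d i : 'I_d.+1) = t.
Proof. by etransitivity; [exact: row_mxEl|rewrite ord1 mxE eqxx mulr1n]. Qed.

Lemma row_mx_tail d (t : R) (v : 'rV[R]_d) (i : 'I_d) :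
  (row_mx (t%:M : 'rV[R]_1) v : 'rV[R]_d.+1) 0 (rshift 1 i : 'I_d.+1) = v 0 i.
Proof. exact: row_mxEr. Qed.

Lemma dotr_row_mx d (t : R) (v : 'rV[R]_d) (k : 'rV[int]_(1 + d)) :
  dotr (row_mx (t%:M : 'rV[R]_1) v) (map_mx intr k) =
  t * (k 0 (lshift d 0))%:~R + dotr v (map_mx intr (rsubmx k)).
Proof.
rewrite /dotr big_split_ord/= big_ord1 row_mxEl !mxE eqxx mulr1n; congr (_ + _).
by apply: eq_bigr => j _; rewrite row_mxEr !mxE.
Qed.

(** [lebesgue_rV] is an iterated integral on sets; this gives an honest measure agreeing with it
    inside a cube, as the image under concatenation of a product measure. The phase [th] is there
    for the induction: integrating the last coordinates leaves the first one in the phase. The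
    integer side makes nonzero frequencies integrate to 0. *)
Lemma box_measure_exists (d : nat) (a : R) (n : nat) : (0 < n)%N ->
  exists Lb : {finite_measure set (borel_rV R d) -> \bar R},
  (forall A : set (borel_rV R d), measurable A -> A `<=` box a (a + n%:R) ->
     lebesgue_rV A = Lb A) /\
  (forall (k : 'rV[int]_d) (th : R),
    (\int[Lb]_v (cos (2 * pi * dotr v (map_mx intr k) + th))%:E =
     (if k == 0 then n%:R ^+ d * cos th else 0)%:E)%E).
Proof.
move=> n0; elim: d => [|d [Lb [H1 H2]]].
  pose dl : {measure set (borel_rV R 0) -> \bar R} := @dirac _ (borel_rV R 0) (0 : 'rV[R]_0) R.
  have dlT : dl setT = 1%E by rewrite /dl/= /dirac indicT.
  have fin1 : (dl setT < +oo)%E by rewrite dlT ltry.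
  have [Lb LbE LbI] := finite_copy fin1.
  exists Lb; split => [A mA _|k th]; first by rewrite LbE.
  rewrite LbI integral_dirac//; last first.
    apply/measurable_EFinP; apply: measurableT_comp; first exact: continuous_measurable_fun (@continuous_cos R).
    apply: measurable_funD => //; apply: measurable_funM => //.
    by rewrite /dotr; apply: measurable_sum => -[].
  by rewrite -[X in (X * _)%E]/(dl setT) dlT mul1e thinmx0 eqxx expr0 mul1r /dotr big_ord0 mulr0 add0r.
pose J : set (measurableTypeR R) := `[a, (a + n%:R)[%classic.
have Jfin : (leb J < +oo)%E.
  by rewrite lebesgue_measure_itv/=; case: ifP => _; rewrite ?ltry// -EFinB ltry.
have [lam [_ lam_ge0 lam_int]] := finite_restriction (measurable_itv `[a, (a + n%:R)[ : measurable J) Jfin.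
pose r (z : measurableTypeR R * borel_rV R d) : borel_rV R d.+1 := row_mx (z.1%:M : 'rV[R]_1) (z.2 : 'rV[R]_d).
have mr : measurable_fun setT r.
  apply: measurable_vector => j.
  case: (split_ordP (j : 'I_(1 + d))) => i ->.
    rewrite (_ : (fun z => _) = fst); first exact: measurable_fst.
    by apply/funext => z; rewrite /r row_mx_head.
  rewrite (_ : (fun z => _) = (fun v : borel_rV R d => v 0 i) \o snd); last first.
    by apply/funext => z; rewrite /r row_mx_tail.
  by apply: measurableT_comp; [exact: measurable_coord|exact: measurable_snd].
pose m : {measure set _ -> \bar R} := (lam \x Lb)%E.
have mfin : (m setT < +oo)%E.
  have -> : m setT = (lam setT * Lb setT)%E.
    by rewrite -setXTT; apply: product_measure1E.
  have h1 : lam setT \is a fin_num by exact: fin_num_measure.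
  have h2 : Lb setT \is a fin_num by exact: fin_num_measure.
  by rewrite -(fineK h1) -(fineK h2) -EFinM ltry.
have pfin : (pushforward m r setT < +oo)%E by rewrite /pushforward preimage_setT.
have [Lb' LbE LbI] := @finite_copy R _ (borel_rV R d.+1) (pushforward m r) pfin.
exists Lb'; split => [A mA AI|k th].
  rewrite LbE /pushforward.
  have mrA : measurable (r @^-1` A) by rewrite -[X in measurable X]setTI; apply: (mr).
  (* The sections of this preimage are the slices in the recursion of [lebesgue_rV]. *)
  pose g (t : measurableTypeR R) := Lb (xsection (r @^-1` A) t).
  have mg : measurable_fun setT g by exact: measurable_fun_xsection.
  have secE t : xsection (r @^-1` A) t = [set v : 'rV[R]_d | A (row_mx (t%:M : 'rV[R]_1) v)].
    by apply/seteqP; split => v /=; rewrite /xsection/= ?inE//; move=> h; rewrite inE.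
  rewrite -[RHS]/(\int[lam]_t g t)%E.
  rewrite lam_ge0//.
  transitivity (\int[leb]_t g t)%E.
    apply: eq_integral => t _ /=; rewrite /g secE; apply: H1.
      by rewrite -secE; exact: measurable_xsection.
    by move=> v /AI h i; have := h (rshift 1 i); rewrite row_mx_tail.
  rewrite [RHS]integral_mkcond; apply: eq_integral => t _; rewrite patchE.
  case: ifPn => //; rewrite notin_setE/= => ht; rewrite /g secE.
  rewrite (_ : [set v | _] = set0) ?measure0//; apply/seteqP; split => // v /AI h.
  by apply: ht; rewrite /J/= in_itv/=; have := h (lshift d (ord0 : 'I_1)); rewrite row_mx_head.
rewrite LbI.
have mcos : measurable_fun setT (fun v : borel_rV R d.+1 => cos (2 * pi * dotr v (map_mx intr k) + th)).
  apply: measurableT_comp; first exact: continuous_measurable_fun (@continuous_cos R).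
  apply: measurable_funD => //; apply: measurable_funM => //.
  by apply: measurable_sum => j; apply: measurable_funM => //; exact: measurable_coord.
have cos1 (x : R) : `|cos x| <= 1 by exact: cos_max.
rewrite integral_pushforward//=; last 2 first.
- exact/measurable_EFinP.
- apply: (@bounded_integrable_of_finite _ _ m (fun z => cos (2 * pi * dotr (r z) (map_mx intr k) + th)) 1) => //.
  exact: (measurableT_comp mcos mr).
pose F (z : measurableTypeR R * borel_rV R d) := (cos (2 * pi * dotr (r z) (map_mx intr k) + th))%:E.
have iF : (lam \x Lb)%E.-integrable setT F.
  apply: (@bounded_integrable_of_finite _ _ m (fun z => cos (2 * pi * dotr (r z) (map_mx intr k) + th)) 1) => //.
  exact: (measurableT_comp mcos mr).
rewrite -[LHS]/(\int[(lam \x Lb)%E]_z F z)%E -integral12_prod_meas1//.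
have innerE (t : R) : fubini_F Lb F t = (if rsubmx (k : 'rV_(1 + d)) == 0 then
    n%:R ^+ d * cos (2 * pi * (t * ((k : 'rV_(1 + d)) 0 (lshift d 0))%:~R) + th) else 0)%:E.
  rewrite -H2 /fubini_F; apply: eq_integral => v _; rewrite /F /r/=.
  by rewrite dotr_row_mx mulrDr addrAC addrA addrC addrA addrC; congr ((cos _)%:E); rewrite addrC addrA.
under eq_integral do rewrite innerE.
have k0E : (k == 0) = ((k : 'rV_(1 + d)) 0 (lshift d 0) == 0) && (rsubmx (k : 'rV_(1 + d)) == 0).
  apply/eqP/andP => [->|[/eqP k1 /eqP k2]]; first by rewrite mxE eqxx linear0 eqxx.
  rewrite -[k](@hsubmxK _ 1 1 d) k2 (_ : lsubmx _ = 0) ?row_mx0//.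
  by apply/matrixP => i j; rewrite !ord1 !mxE k1.
rewrite k0E andbC; case: eqP => [_|_] /=; last by rewrite integral0.
have icos : lam.-integrable setT (fun t =>
    (cos (2 * pi * (t * ((k : 'rV_(1 + d)) 0 (lshift d 0))%:~R) + th))%:E).
  apply: (@bounded_integrable_of_finite _ _ lam (fun t =>
    cos (2 * pi * (t * ((k : 'rV_(1 + d)) 0 (lshift d 0))%:~R) + th)) 1) => //.
  - by rewrite ltey_eq fin_num_measure.
  - apply: measurableT_comp; first exact: continuous_measurable_fun (@continuous_cos R).
    by apply: measurable_funD => //; apply: measurable_funM => //; exact: measurable_funM.
under eq_integral do rewrite EFinM.
rewrite integralZl// lam_int// integral_cos_period// -EFinM; congr (_%:E).
by case: eqP => _; rewrite ?mulr0// exprSr mulrA.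
Qed.

End box_measure.

(** Restrict [mu] to [B], take its Radon-Nikodym density, and keep the set where it is at most [n].
    The density is finite everywhere, so these sets exhaust the space and one of them has positive
    mass. *)
Lemma ac_dominated {R : realType} {dT} {T : measurableType dT}
    (mu Lb : {finite_measure set T -> \bar R}) (B : set T) : measurable B ->
  mu B <> 0%E -> (forall A, measurable A -> A `<=` B -> Lb A = 0%E -> mu A = 0%E) ->
  exists (nu : {finite_measure set T -> \bar R}) (M : nat),
  [/\ forall A, measurable A -> (nu A <= mu A)%E,
      forall A, measurable A -> (nu A <= M%:R%:E * Lb A)%E & nu setT <> 0%E].
Proof.
move=> mB muB ac.
have Bfin : (mu B < +oo)%E by rewrite ltey_eq fin_num_measure.
have [nu0 [nu0E _ _]] := finite_restriction mB Bfin.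
have dom : nu0 `<< Lb.
  move=> N NE A mA AN; rewrite nu0E; apply: ac; first exact: measurableI.
  - exact: subIsetr.
  - by apply: NE; [exact: measurableI|move=> x [/AN]].
have [f [f0 ffin fint fE]] := radon_nikodym_sigma_finite dom.
have mf : measurable_fun setT f by exact: (measurable_int Lb).
pose E (n : nat) := [set x | (f x <= n%:R%:E)%E].
have mE n : measurable (E n).
  rewrite (_ : E n = setT `&` [set x | (f x <= (cst n%:R%:E) x)%E]); last by rewrite setTI.
  exact: emeasurable_fun_le.
have [n En] : exists n, nu0 (E n) <> 0%E.
  apply: contrapT => h; apply: muB.
  have : nu0.-negligible (\bigcup_n E n).
    apply: negligible_bigcup => n; apply/negligibleP => //.
    by apply: contrapT => h'; apply: h; exists n.
  have -> : \bigcup_n E n = setT.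
    rewrite -subTset => x _; exists (Num.truncn (fine (f x))).+1 => //.
    by rewrite /E/= -(fineK (ffin x)) lee_fin ltW// truncnS_gt.
  by move=> h0; rewrite -(setTI B) -nu0E; exact/negligibleP.
have Efin : (nu0 (E n) < +oo)%E by rewrite ltey_eq fin_num_measure.
have [nu [nuE _ _]] := finite_restriction (mE n) Efin.
exists nu, n; split => [A mA|A mA|]; last by rewrite nuE setTI.
  have -> : nu A = mu (A `&` E n `&` B) := etrans (nuE A) (nu0E _).
  apply: le_measure; rewrite ?inE//; last by move=> x [[]].
  by apply: measurableI => //; exact: measurableI.
have mAE : measurable (A `&` E n) by exact: measurableI.
have -> : nu A = (\int[Lb]_(x in A `&` E n) f x)%E := etrans (nuE A) (fE _ mAE).
apply: (@le_trans _ _ (\int[Lb]_(x in A `&` E n) (cst n%:R%:E) x)%E).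
  apply: ge0_le_integral => //; first exact: measurable_funTS.
  by move=> x [].
rewrite integral_cst//; apply: lee_wpmul2l; first by rewrite lee_fin.
by rewrite le_measure ?inE//; exact: subIsetl.
Qed.

(** * Bessel inequality at integer points *)

Section dominated_form.
Context {R : realType} {dL : measure_display} {L : measurableType dL} {V : zmodType} {d : nat}.
Variables (c : L -> 'rV[R]_d) (emb : V -> 'rV[R]_d).
Hypothesis mc : forall j, measurable_fun setT (fun l => c l 0 j).
Hypothesis embD : forall x y, emb (x + y) = emb x + emb y.
Variables (nu Lb : {finite_measure set L -> \bar R}) (M : nat).
Hypothesis nu_dom : forall A, measurable A -> (nu A <= M%:R%:E * Lb A)%E.
Variables (pt : 'rV[int]_d -> V) (vol : R).
Hypothesis emb_pt : forall k, emb (pt k) = map_mx intr k.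
Hypothesis vol_ge0 : 0 <= vol.
Hypothesis orth : forall k : 'rV[int]_d,
  (\int[Lb]_l (cos (2 * pi * dotr (c l) (map_mx intr k)))%:E = (if k == 0 then vol else 0)%:E)%E.
Hypothesis d_gt0 : (0 < d)%N.

Let phase := coord_phase c emb.
Let mphase : forall x, measurable_fun setT (phase x).
Proof. exact: measurable_coord_phase. Qed.
Let phaseD : forall x y l, phase (x + y) l = phase x l + phase y l.
Proof. exact: coord_phaseD. Qed.

Lemma spectral_form_dominated (I : finType) (x : I -> V) (a : I -> R^o) :
  spectral_form phase nu x a a <= M%:R * spectral_form phase Lb x a a.
Proof.
pose Mn : {nonneg R} := NngNum (ler0n R M).
have iform (m : {finite_measure set L -> \bar R}) := form_integrable mphase m x a a.
rewrite /spectral_form -[M%:R]/(fine M%:R%:E) -fineM//; last by apply: integrable_fin_num => //; exact: iform.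
have E : (fun l => (csym phase x a l * csym phase x a l + ssym phase x a l * ssym phase x a l)%:E)
   = (fun l => (csym phase x a l ^+ 2 + ssym phase x a l ^+ 2)%:E) by [].
have mE : measurable_fun setT (fun l => (csym phase x a l ^+ 2 + ssym phase x a l ^+ 2)%:E).
  by apply/measurable_EFinP; apply: measurable_funD; apply: measurable_funX;
    [exact: measurable_csym|exact: measurable_ssym].
apply: fine_le.
- by apply: integrable_fin_num => //; exact: iform.
- by rewrite fin_numM//; apply: integrable_fin_num => //; exact: iform.
rewrite E -[leRHS](@ge0_integral_mscale _ _ _ Lb setT measurableT Mn _ mE); last first.
  by move=> l _; rewrite lee_fin addr_ge0// sqr_ge0.
by apply: ge0_le_measure_integral => // l; rewrite lee_fin addr_ge0// sqr_ge0.
Qed.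

(** Exponentials at distinct integer points are orthogonal for [Lb], so its form is exactly
    [vol * sum a_j^2], and [nu] costs a factor [M]. The added 1 makes the constant positive. *)
Lemma lattice_points_form : exists A M' : R, [/\ 0 < A, 0 < M' &
  forall n : nat, (0 < n)%N -> exists (J : finType) (x : J -> V),
  [/\ forall j, emb_ball emb (A * n%:R) (x j), (n ^ d <= #|J|)%N &
    forall a : J -> R^o, spectral_form phase nu x a a <= M' * \sum_j a j ^+ 2]].
Proof.
exists d%:R, (M%:R * vol + 1); split; rewrite ?ltr0n// ?ltr_wpDl ?mulr_ge0//.
move=> n n0; pose k (g : 'rV['I_n]_d) : 'rV[int]_d := map_mx (fun i : 'I_n => Posz i) g.
exists 'rV['I_n]_d, (fun g => pt (k g)); split => [g||a].
- rewrite /emb_ball/= emb_pt; apply: eball_coord => // j.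
  by rewrite !mxE ger0_norm ?ler0n// ler_nat ltnW.
- by rewrite card_mx card_ord mul1n.
- apply: le_trans (spectral_form_dominated _ _) _.
  rewrite mulrDl mul1r; apply: (@le_trans _ _ (M%:R * vol * \sum_j a j ^+ 2)); last first.
    by rewrite lerDl; apply: sumr_ge0 => j _; exact: sqr_ge0.
  rewrite -mulrA ler_wpM2l// spectral_formE// mulr_sumr le_eqVlt; apply/orP; left; apply/eqP.
  apply: eq_bigr => i _.
  have intE j : fine (\int[Lb]_l (cos (2 * pi * phase (pt (k j) - pt (k i)) l))%:E)%E =
      if j == i then vol else 0.
    have -> : (j == i) = (k j - k i == 0).
      rewrite subr_eq0; apply/eqP/eqP => [->//|/matrixP e]; apply/matrixP => r s.
      by have := e r s; rewrite !mxE => -[] /ord_inj.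
    rewrite -[RHS]/(fine (_)%:E) -orth; congr (fine _); apply: eq_integral => l _.
    by rewrite /phase /coord_phase embB// !emb_pt -map_mxB.
  rewrite (bigD1 i)//= intE eqxx big1 ?addr0; first by rewrite -expr2 mulrC.
  by move=> j /negbTE ij; rewrite intE ij mulr0.
Qed.

End dominated_form.

(** * Fields on the Euclidean space *)

Lemma integer_grid {R : realType} {d : nat} (T : R) : 1 <= T ->
  exists (N : nat) (k : 'I_N -> 'rV[int]_d),
  [/\ N%:R <= 5 ^+ d * T ^+ d, forall m j, `|(k m 0 j)%:~R : R| <= T + 1 &
    forall z : 'rV[int]_d, (forall j, `|(z 0 j)%:~R : R| <= T + 1) -> exists m, k m = z].
Proof.
move=> T1; have T0 : 0 <= T by apply: le_trans T1.
(* As [T < K <= T + 1], the integers of absolute value at most [T + 1] are those in [[-K, K]]; there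
   are [2 K + 1 <= 5 T] of them. *)
pose K := (Num.truncn T).+1.
have K1 : K%:R <= T + 1 by rewrite /K -natr1 lerD2r truncn_le.
have K2 : T < K%:R by exact: truncnS_gt.
pose G := 'rV['I_(K.*2.+1)]_d.
pose g (x : G) : 'rV[int]_d := \row_j ((x 0 j)%:Z - K%:Z).
exists #|G|, (fun m => g (enum_val m)); split => [|m j|z hz].
- rewrite card_mx card_ord mul1n natrX -exprMn lerXn2r ?nnegrE ?mulr_ge0//.
  by rewrite -addnn -natr1 natrD; lra.
- rewrite mxE intrB -!pmulrn ler_norml; set x := enum_val m 0 j.
  have : (x%:R : R) <= K%:R + K%:R by rewrite -natrD ler_nat addnn -ltnS.
  have : (0 : R) <= x%:R by [].
  by move=> h1 h2; apply/andP; split; lra.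
- have zK j : `|z 0 j| <= K%:Z.
    have := hz j; rewrite -intr_norm => h.
    have : (`|z 0 j|%:~R : R) < (K%:Z + 1)%:~R by apply: le_lt_trans h _; rewrite intrD ltrD2r.
    by rewrite ltr_int ltzD1.
  have zlt j : (absz (z 0%R j + K%:Z)%R < K.*2.+1)%N.
    have := zK j; rewrite ler_norml => /andP[h1 h2].
    rewrite ltnS -addnn -lez_nat gez0_abs; last by rewrite -lerBlDr sub0r.
    by rewrite PoszD lerD2r.
  pose x : G := \row_j Ordinal (zlt j).
  exists (enum_rank x); rewrite enum_rankK; apply/rowP => j; rewrite !mxE/=.
  by rewrite gez0_abs ?addrK//; have := zK j; rewrite ler_norml -lerBlDr sub0r => /andP[].
Qed.

Section rational_points.
Context {R : realType} {d : nat}.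

Definition rat_point (q : 'rV[rat]_d) : 'rV[R]_d := map_mx ratr q.

Lemma rat_point_near (y : 'rV[R]_d) (e : R) : 0 < e ->
  exists q, forall j, `|rat_point q 0 j - y 0 j| < e.
Proof.
move=> e0; have /choice[p Hp] (j : 'I_d) : exists p : rat, `|ratr p - y 0 j| < e.
  have [p] : exists p : rat, ratr p \in `](y 0 j - e), (y 0 j + e)[.
    by apply: rat_in_itvoo; rewrite ltrD2l gtrN.
  by rewrite in_itv/= => hp; exists p; rewrite ltr_distl.
by exists (\row_j p j) => j; rewrite !mxE.
Qed.

Lemma continuous_neg_near (g : 'rV[R]_d -> R) (y : 'rV[R]_d) : continuous g -> g y < 0 ->
  exists2 e : R, 0 < e & forall x : 'rV[R]_d, (forall j, `|x 0 j - y 0 j| < e) -> g x < 0.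
Proof.
move=> cg gy; have : nbhs y [set x | g x < 0].
  by apply: (cg y [set z | z < 0]); apply: open_nbhs_nbhs; split => //; exact: open_lt.
move=> /nbhs_ballP[e /= e0 he]; exists e => // x hx; apply: he; split => // i j.
by rewrite !ord1 /ball/= distrC.
Qed.

Definition clip (t : R) : R := Num.max 0 (Num.min t 1).

Lemma clip_itv t : 0 <= clip t <= 1.
Proof.
by rewrite /clip le_max lexx/= ge_max ler01/= ge_min lexx orbT.
Qed.

Lemma clip_near (t y : R) : 0 <= y <= 1 -> `|clip t - y| <= `|t - y|.
Proof.
move=> /andP[y0 y1]; rewrite /clip; case: (leP t 1) => t1.
  case: (leP 0 t) => t0 //.
  by rewrite sub0r normrN (ger0_norm y0) distrC ger0_norm; lra.
by rewrite max_r// !ger0_norm; lra.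
Qed.

(** Clipping the coordinates turns an enumeration of all rational points into a sequence that stays
    in the unit cube; integers that encode no point are sent to 0. *)
Definition cube_point (i : nat) : 'rV[R]_d :=
  map_mx clip (rat_point (odflt 0 (unpickle i))).

Lemma cube_point_dense (g : 'rV[R]_d -> R) : continuous g -> (forall i, 0 <= g (cube_point i)) ->
  forall y : 'rV[R]_d, (forall j, 0 <= y 0 j <= 1) -> 0 <= g y.
Proof.
move=> cg gu y hy; rewrite leNgt; apply/negP => gy.
have [e e0 he] := continuous_neg_near cg gy.
have [q hq] := rat_point_near y e0.
have := gu (pickle q); rewrite leNgt => /negP; apply; apply: he => j.
by rewrite /cube_point pickleK/= mxE; apply: le_lt_trans (hq j); exact: clip_near.
Qed.

(** A boundary point is first shrunk by [1 - dl], which leaves room for a rational approximation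
    inside the closed ball. For [T = 0] the ball is the origin, itself rational. *)
Lemma rat_point_dense_ball (T : R) (g : 'rV[R]_d -> R) : (0 < d)%N -> continuous g ->
  (forall q, eball T (rat_point q) -> 0 <= g (rat_point q)) ->
  forall y, eball T y -> 0 <= g y.
Proof.
move=> d0 cg gq y hy; rewrite leNgt; apply/negP => gy.
have dR : 0 < d%:R :> R by rewrite ltr0n.
have [e e0 he] := continuous_neg_near cg gy.
have T0 : 0 <= T by case/eballP: hy.
have [T00|Tn0] := eqVneq T 0.
  have y0 : y = 0.
    by apply/rowP => j; have := coord_le_eball j hy; rewrite T00 normr_le0 mxE => /eqP.
  have r0 : rat_point 0 = y by rewrite y0; apply/rowP => j; rewrite !mxE rmorph0.
  by move: gy; rewrite ltNge -r0 => /negP; apply; apply: gq; rewrite r0.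
have Tp : 0 < T by rewrite lt_neqAle eq_sym Tn0.
pose dl := Num.min 1 (e / (2 * T)).
have dl0 : 0 < dl by rewrite lt_min ltr01 divr_gt0// mulr_gt0.
have dl1 : dl <= 1 by rewrite ge_min lexx.
have dle : dl * T <= e / 2.
  by rewrite -ler_pdivlMr// (le_trans (_ : dl <= e / (2 * T)))// ?ge_min ?lexx ?orbT// invfM mulrA.
have mn0 : 0 < Num.min (e / 2) (dl * T / d%:R) by rewrite lt_min !divr_gt0// mulr_gt0.
have [q hq] := rat_point_near ((1 - dl) *: y) mn0.
have qT : eball T (rat_point q).
  have -> : T = `|1 - dl| * T + d%:R * (dl * T / d%:R).
    by rewrite ger0_norm ?subr_ge0//; field; rewrite gt_eqF.
  rewrite -[rat_point q](addrNK ((1 - dl) *: y)) [X in eball _ X]addrC; apply: eballD; first exact: eballZ.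
  apply: eball_coord; first by rewrite divr_ge0 ?mulr_ge0 ?ltW.
  by move=> j; have := hq j; rewrite lt_min !mxE => /andP[_ /ltW].
have := gq q qT; rewrite leNgt => /negP; apply; apply: he => j.
have := hq j; rewrite lt_min => /andP[h _].
have := coord_le_eball j hy => hyj.
have -> : rat_point q 0 j - y 0 j = (rat_point q 0 j - ((1 - dl) *: y) 0 j) - dl * y 0 j.
  by rewrite !mxE; ring.
apply: le_lt_trans (ler_normB _ _) _; rewrite normrM (gtr0_norm dl0).
rewrite [e]splitr; apply: ltr_leD => //; apply: le_trans dle.
by rewrite ler_pM2l.
Qed.

End rational_points.

Section common.
Context {R : realType}.

Lemma box_null {d : nat} (a : R) (n : nat) (Lb : {finite_measure set (borel_rV R d) -> \bar R})
    (A : set (borel_rV R d)) :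
  (forall A : set (borel_rV R d), measurable A -> A `<=` box a (a + n%:R) -> lebesgue_rV A = Lb A) ->
  measurable A -> A `<=` box a (a + n%:R) -> Lb A = 0%E -> null_set (T := borel_rV R d) (@lebesgue_rV R d) A.
Proof.
move=> LbE mA AB A0 B mB BA; rewrite LbE//; last exact: subset_trans AB.
by apply/eqP; rewrite eq_le measure_ge0 andbT -A0 le_measure ?inE.
Qed.

Lemma measurable_bigcap_countable {dT} {T : measurableType dT} (I : countType) (D : set I)
    (F : I -> set T) : (forall i, measurable (F i)) -> measurable (\bigcap_(i in D) F i).
Proof.
move=> mF; rewrite -[X in measurable X]setCK setC_bigcap; apply: measurableC.
rewrite bigcup_mkcond; apply: countable_bigcupT_measurable; first exact: countableP.
by move=> i; case: ifP => _ //; exact: measurableC.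
Qed.

Lemma measurable_box {d : nat} (a b : R) : measurable (box a b : set (borel_rV R d)).
Proof.
rewrite (_ : box a b = \bigcap_(j in [set: 'I_d]) ((fun v : borel_rV R d => v 0 j) @^-1` `[a, b[%classic)).
  apply: (fin_bigcap_measurable finite_finset) => j _.
  by rewrite -[X in measurable X]setTI; exact: measurable_coord.
apply/seteqP; split => v h /=; first by move=> j _ /=; rewrite in_itv/=.
by move=> j; have := h j Logic.I; rewrite /= in_itv/=.
Qed.

Lemma ac_part_le {dT} {T : measurableType dT} (mu nu : {finite_measure set T -> \bar R}) leb A :
  ac_part mu nu leb -> measurable A -> (nu A <= mu A)%E.
Proof. by move=> [_ [sing [_ h]]] mA; rewrite h// leeDl. Qed.

End common.

Section euclidean_case.
Context {R : realType} {dOm : measure_display} {Om : measurableType dOm}.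
Variables (P : probability Om R) (d : nat).
Hypothesis d_gt0 : (0 < d)%N.
Variable f : 'rV[R]_d -> {RV P >-> R}.
Hypothesis cf : forall w, continuous (fun x => f x w).
Variable mu : {finite_measure set (borel_rV R d) -> \bar R}.

Let c : borel_rV R d -> 'rV[R]_d := id.
Let emb : 'rV[R]_d -> 'rV[R]_d := id.
Let mc j : measurable_fun setT (fun l => c l 0 j) := measurable_coord j.

(** Tightness of a finite measure: the sets of frequencies with a coordinate above [n.+1 / 2]
    decrease to the empty set. No rate is available, so [s] is not controlled in terms of [tau]. *)
Lemma euclidean_step (tau : R) : 0 < tau -> exists (s : R) (v : 'I_d -> 'rV[R]_d),
  [/\ 0 < s, s <= 1, forall j, emb (v j) = s *: delta_mx 0 j &
    (mu [set l | exists j, (1 / 2 < s * `|c l 0 j|)%R] <= tau%:E)%E].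
Proof.
move=> tau0.
pose A (n : nat) := [set l | exists j, 1 / 2 < n.+1%:R^-1 * `|c l 0 j|].
have mA n : measurable (A n).
  rewrite (_ : A n = \bigcup_(j in [set: 'I_d]) ((fun l => n.+1%:R^-1 * `|c l 0 j|) @^-1` `]1 / 2, +oo[%classic)).
    apply: (fin_bigcup_measurable finite_finset) => j _.
    rewrite -[X in measurable X]setTI; apply: measurable_funM => //.
    by apply: measurableT_comp => //; exact: mc.
  apply/seteqP; split => l; last first.
    by move=> [j _ /=]; rewrite in_itv/= andbT => h; exists j.
  by move=> [j h]; exists j => //=; rewrite in_itv/= andbT.
have niA : nonincreasing_seq A.
  apply/nonincreasing_seqP => n; apply/subsetPset => l [j hj]; exists j.
  by apply: lt_le_trans hj _; rewrite ler_wpM2r// lef_pV2 ?posrE// ler_nat.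
have A0 : \bigcap_n A n = set0.
  rewrite -subset0 => l h.
  have [K hK] : exists K : nat, 2 * \sum_j `|c l 0 j| <= K%:R.
    by exists (Num.truncn (2 * \sum_j `|c l 0 j|)).+1; rewrite ltW// truncnS_gt.
  have {}hK j : `|c l 0 j| <= K%:R / 2.
    have : `|c l 0 j| <= \sum_j `|c l 0 j| by rewrite (bigD1 j)//= lerDl sumr_ge0.
    by move: hK; set S := \sum_j _; lra.
  have [j] := h K Logic.I; rewrite ltNge => /negP; apply.
  by rewrite ler_pdivrMl// mul1r (le_trans (hK j))// ler_wpM2r// ler_nat.
have cvgA : mu \o A @ \oo --> mu (\bigcap_n A n).
  apply: nonincreasing_cvg_mu => //; first by rewrite ltey_eq fin_num_measure.
  by rewrite A0.
rewrite A0 measure0 in cvgA.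
have [n _ hn] : \forall n \near \oo, (mu (A n) < tau%:E)%E.
  apply: (cvgA [set z | (z < tau%:E)%E]).
  by apply: open_nbhs_nbhs; split; [exact: open_ereal_lt_ereal|rewrite /= lte_fin].
exists n.+1%:R^-1, (fun j => n.+1%:R^-1 *: delta_mx 0 j); split => //.
- by rewrite invf_le1// ler1n.
- exact/ltW/(hn n)/leqnn.
Qed.

Lemma euclidean_persist (T : R) :
  measurable [set w | forall x, emb_ball emb T x -> (0 <= f x w)%R].
Proof.
rewrite (_ : [set w | _] = \bigcap_(q in [set q : 'rV[rat]_d | eball T (rat_point q : 'rV[R]_d)])
    [set w | 0 <= f (rat_point q) w]).
  apply: measurable_bigcap_countable => q; exact: measurable_nonneg.
apply/seteqP; split => w h /=; first by move=> q hq; exact: h.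
by apply: (@rat_point_dense_ball R d T (fun x => f x w) d_gt0 (@cf w)) => q hq; exact: h.
Qed.

Lemma cube_point_bounded (w : Om) : exists B : R, forall i, `|f (cube_point i) w| <= B.
Proof.
have cK : compact [set v : 'rV[R]_d | forall i, `[(0 : R), 1]%classic (v ord0 i)].
  by apply: (@rV_compact R d (fun=> `[(0 : R), 1]%classic)) => i; exact: segment_compact.
have cI : compact ((fun x => f x w) @` [set v : 'rV[R]_d | forall i, `[(0 : R), 1]%classic (v ord0 i)]).
  by apply: continuous_compact => //; apply: continuous_subspaceT; exact: cf.
have [M [_ HM]] := compact_bounded cI.
exists (M + 1) => i; apply: (HM (M + 1)); first by rewrite ltrDl.
exists (cube_point i) => // j /=.
by rewrite in_itv/= mxE clip_itv.
Qed.

(** Each point is its integer part plus a point of the unit cube, where continuity extends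
    nonnegativity from [cube_point]. Coordinates stay below [(T + 1) + 1 <= 3 T]. *)
Lemma euclidean_cover (T : R) : 1 <= T -> exists (N : nat) (x : 'I_N -> 'rV[R]_d),
  [/\ N%:R <= 5 ^+ d * T ^+ d,
    [set w | forall (m : 'I_N) (i : nat), (0 <= f (x m + cube_point i)%R w)%R] `<=`
      [set w | forall x, emb_ball emb T x -> (0 <= f x w)%R] &
    forall m i, emb_ball emb (3 * d%:R * T) (x m + cube_point i)].
Proof.
move=> T1; have [N [k [hN hk kz]]] := integer_grid (d := d) T1.
exists N, (fun m => map_mx intr (k m)); split => // [w hw x xT|m i].
- pose z : 'rV[int]_d := \row_j Num.floor (x 0 j).
  have [j|m mz] := kz z.
    have := coord_le_eball j xT; rewrite /emb mxE !ler_norml => /andP[h1 h2].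
    have := ge_floor (x 0 j); have := floorD1_gt (x 0 j); rewrite intrD => h3 h4.
    by apply/andP; split; lra.
  pose y : 'rV[R]_d := x - map_mx intr z.
  have -> : x = map_mx intr (k m) + y by rewrite mz addrC subrK.
  apply: (@cube_point_dense R d (fun y => f (map_mx intr (k m) + y) w)).
  - move=> y'; apply: (@continuous_comp _ _ _ (fun y : 'rV[R]_d => map_mx intr (k m) + y) (fun x => f x w)); last exact: cf.
    move=> U /nbhs_ballP[e /= e0 eU]; apply/nbhs_ballP; exists e => // v [_ hv].
    apply: eU; split => // i j; rewrite !mxE /ball/= opprD addrACA subrr add0r.
    exact: hv.
  - by move=> i; exact: hw.
  - move=> j; rewrite !mxE.
    have := ge_floor (x 0 j); have := floorD1_gt (x 0 j); rewrite intrD => h3 h4.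
    by apply/andP; split; lra.
- have -> : 3 * d%:R * T = d%:R * (3 * T) by ring.
  apply: eball_coord => [|j]; first by rewrite mulr_ge0// (le_trans _ T1).
  rewrite !mxE; apply: le_trans (ler_normD _ _) _.
  have := hk m j; have /andP[c0 c1] := clip_itv (rat_point (odflt 0 (unpickle i)) 0 j : R).
  by rewrite mxE in c0 c1; rewrite (ger0_norm c0); lra.
Qed.

Lemma euclidean_boxes (mu_ac : {finite_measure set (borel_rV R d) -> \bar R}) :
  mu_ac setT <> 0%E -> exists2 n : nat, (0 < n)%N & mu_ac (box (- n%:R) n%:R) <> 0%E.
Proof.
move=> h0; apply: contrapT => h; apply: h0.
have : mu_ac.-negligible (\bigcup_n (box (- n.+1%:R) n.+1%:R : set (borel_rV R d))).
  apply: negligible_bigcup => n; apply/negligibleP; first exact: measurable_box.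
  by apply: contrapT => h'; apply: h; exists n.+1.
have -> : \bigcup_n (box (- n.+1%:R) n.+1%:R : set (borel_rV R d)) = setT.
  rewrite -subTset => v _; exists (Num.truncn (\sum_j `|(v : 'rV[R]_d) 0 j|)) => // j.
  have := truncnS_gt (\sum_j `|(v : 'rV[R]_d) 0 j|).
  have : `|(v : 'rV[R]_d) 0 j| <= \sum_j `|(v : 'rV[R]_d) 0 j| by rewrite (bigD1 j)//= lerDl sumr_ge0.
  have := ler_norm ((v : 'rV[R]_d) 0 j); have := ler_norm (- (v : 'rV[R]_d) 0 j); rewrite normrN.
  move: (\sum_j _) (_.+1%:R) => x y h1 h2 h3 h4; apply/andP; split; lra.
by move=> h'; exact/negligibleP.
Qed.

Lemma euclidean_power_growth (mu_ac : {finite_measure set (borel_rV R d) -> \bar R}) (alpha : R) :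
  0 < alpha -> alpha < d%:R -> SGF f ->
  spectral_rV (cov_kernel f) mu ->
  ac_part mu mu_ac (@lebesgue_rV R d) ->
  mu_ac setT <> 0%E ->
  ln (fine (mu (@eball R d delta))) / ln delta @[delta --> 0^'+] --> alpha ->
  power_growth (fun T => theta f (@eball R d T)) alpha.
Proof.
move=> a0 ad Sf [_ Kmu] ac ac0 Hball.
have [n n0 nbox] := euclidean_boxes ac0.
have n20 : (0 < n.*2)%N by rewrite double_gt0.
(* A cube of integer side [2 n] about the origin that meets the absolutely continuous part; an
   integer side keeps the exponentials orthogonal. *)
have [Lb [LbE LbI]] := @box_measure_exists R d (- n%:R) n.*2 n20.
have bE : (box (- n%:R) n%:R : set 'rV[R]_d) = box (- n%:R) (- n%:R + n.*2%:R).
  by congr (box _ _); rewrite -addnn natrD; ring.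
have acb (A : set (borel_rV R d)) : measurable A -> A `<=` box (- n%:R) n%:R -> Lb A = 0%E -> mu_ac A = 0%E.
  rewrite bE => mA AB A0; have [dom _] := ac.
  by apply: (dom A) => //; exact: box_null LbE mA AB A0.
have [nu [M [nu_le nu_dom nu0]]] := ac_dominated (measurable_box _ _) nbox acb.
have orth (k : 'rV[int]_d) : (\int[Lb]_l (cos (2 * pi * dotr (c l) (map_mx intr k)))%:E =
    (if k == 0 then n.*2%:R ^+ d else 0)%:E)%E.
  have := LbI k 0; rewrite cos0 mulr1 => <-.
  by apply: eq_integral => l _; rewrite addr0.
have embD x y : emb (x + y) = emb x + emb y by [].
have [A [M' [A0 M0 Hac]]] := lattice_points_form mc embD nu_dom (pt := fun k => map_mx intr k)
  (vol := n.*2%:R ^+ d) (fun k => erefl) (exprn_ge0 _ (ler0n _ _)) orth d_gt0.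
have KE x : cov_kernel f x = fine (\int[mu]_l (cos (2 * pi * coord_phase c emb x l))%:E)%E.
  by have [-> _] := Kmu x.
have nu_mu B : measurable B -> (nu B <= mu B)%E.
  by move=> mB; apply: le_trans (nu_le B mB) _; exact: ac_part_le ac mB.
have k0 : 0 < fine (nu setT).
  by rewrite fine_gt0// lt0e measure_ge0 andbT ltey_eq fin_num_measure//= andbT; apply/eqP.
have A1 : (1 : R) <= 3 * d%:R.
  have : 1 <= d%:R :> R by rewrite ler1n.
  lra.
have mph x : measurable_fun setT (coord_phase c emb x) by exact: measurable_coord_phase.
have phD := coord_phaseD c embD.
have mcb r : measurable (coord_ball c r) by exact: measurable_coord_ball.
exact: (abstract_power_growth Sf mph phD KE a0 mcb (@coord_ball_mono _ _ _ _ c) Hball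
  (@coord_phase_cos _ _ _ _ _ c emb) (coord_kernels mc embD d_gt0 euclidean_step)
  euclidean_persist A1 cube_point_bounded euclidean_cover (@emb_ball_mono _ _ _ emb)
  (emb_ballD embD) ad nu_mu k0 M0 A0 Hac).
Qed.

End euclidean_case.

(** * Fields on the lattice *)

Section nearest_residue.
Context {R : realType}.

(** The representative modulo 1 in [-1/2, 1/2). In these coordinates step [s = 1] keeps every
    frequency within 1/2, so the exceptional set of the kernels is empty. *)
Definition residue (y : R) : R := y - (Num.floor (y + 1 / 2))%:~R.

Lemma residue_itv y : - (1 / 2) <= residue y < 1 / 2.
Proof.
have /andP[h1] := floor_itv (y + 1 / 2); rewrite intrD /residue => h2.
by apply/andP; split; lra.
Qed.

Lemma residue_le_half y : `|residue y| <= 1 / 2.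
Proof. by have /andP[h1 h2] := residue_itv y; rewrite ler_norml h1 ltW. Qed.

Lemma residueD (y : R) (m : int) : residue (y + m%:~R) = residue y.
Proof.
rewrite /residue (_ : Num.floor (y + m%:~R + 1 / 2) = Num.floor (y + 1 / 2) + m).
  by rewrite intrD; ring.
apply: floor_def; have /andP[h1] := floor_itv (y + 1 / 2); rewrite !intrD => h2.
by apply/andP; split; lra.
Qed.

Lemma residue_le y : `|residue y| <= `|y|.
Proof.
have [h|h] := ltP `|y| (1 / 2); last exact: le_trans (residue_le_half y) h.
move: h; rewrite ltr_norml => /andP[h1 h2].
rewrite {1}/residue (_ : Num.floor (y + 1 / 2) = 0) ?subr0//.
by apply: floor_def; rewrite /= mulr1z; apply/andP; split; lra.
Qed.

(** At its jumps, the half-integers, [residue] takes the lower value -1/2; it is thus lower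
    semicontinuous, which is enough for measurability. *)
Lemma open_residue_gt (x : R) : open [set y | x < residue y].
Proof.
have [hx|hx] := ltP x (- (1 / 2)).
  rewrite (_ : [set y | _] = setT); first exact: openT.
  by rewrite -subTset => y _ /=; have /andP[h _] := residue_itv y; exact: lt_le_trans hx h.
rewrite (_ : [set y | _] = \bigcup_(k : int) `](k%:~R + x), (k%:~R + 1 / 2)[%classic).
  by apply: bigcup_open => k _; exact: itv_open.
apply/seteqP; split => y /=.
  have /andP[_ h] := residue_itv y; rewrite /residue in h * => hy.
  by exists (Num.floor (y + 1 / 2)) => //=; rewrite in_itv/=; apply/andP; split; lra.
move=> [k _ /=]; rewrite in_itv/= => /andP[h1 h2].
rewrite /residue (_ : Num.floor (y + 1 / 2) = k); first by lra.
by apply: floor_def; rewrite intrD; apply/andP; split; lra.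
Qed.

Lemma cos_add_period (x : R) (m : int) : cos (x + 2 * pi * m%:~R) = cos x.
Proof.
have := sin_add_period (x + pi / 2) m.
by rewrite addrAC !sinD cos_pihalf sin_pihalf !mulr0 !add0r !mulr1.
Qed.

End nearest_residue.

Section torus_coordinates.
Local Open Scope quotient_scope.
Context {R : realType} {d : nat}.
Implicit Types (u v : 'rV[R]_d) (t : torus R d).

Lemma to_torus_repr t : to_torus (torus_repr t) = t.
Proof. exact: (@reprK _ {eq_quot (@congZ_equiv R d)}). Qed.

Lemma congZP u v : reflect (exists z : 'rV[int]_d, u = v + map_mx intr z) (congZ u v).
Proof.
apply: (iffP forallP) => [h|[z ->] i].
  exists (\row_j Num.floor (u 0 j - v 0 j)); apply/rowP => j.
  by rewrite !mxE floorK// addrC subrK.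
by rewrite !mxE [X in X - _]addrC addrK intr_int.
Qed.

Lemma torus_reprK u : exists z : 'rV[int]_d, torus_repr (to_torus u) = u + map_mx intr z.
Proof.
have e : to_torus (torus_repr (to_torus u)) = to_torus u by exact: to_torus_repr.
by apply/congZP; move/eqmodP: e.
Qed.

Lemma to_torusD u (z : 'rV[int]_d) : to_torus (u + map_mx intr z) = to_torus u.
Proof. by apply/eqmodP; apply/congZP; exists z. Qed.

Definition torus_coord t : 'rV[R]_d := \row_j residue (torus_repr t 0 j).

Lemma torus_coordE u : torus_coord (to_torus u) = \row_j residue (u 0 j).
Proof.
have [z e] := torus_reprK u; apply/rowP => j.
by rewrite /torus_coord !mxE e !mxE residueD.
Qed.

Lemma torus_coordK t : to_torus (torus_coord t) = t.
Proof.
have -> : torus_coord t = torus_repr t + map_mx intr (\row_j - Num.floor (torus_repr t 0 j + 1 / 2)).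
  by apply/rowP => j; rewrite !mxE intrN.
by rewrite to_torusD to_torus_repr.
Qed.

Lemma measurable_torus_coord j :
  measurable_fun setT (fun t : borel_torus R d => torus_coord t 0 j).
Proof.
apply: (@measurable_open_lower R (torus R d)) => x.
have /continuousP h : continuous (fun v : 'rV[R]_d => v 0 j) by exact: coord_continuous.
have -> : [set t | x < torus_coord t 0 j] = [set t | x < residue (torus_repr t 0 j)].
  by apply/seteqP; split => t /=; rewrite mxE.
(* A set is open in the quotient when its preimage is. *)
suff : open (@to_torus R d @^-1` [set t | x < residue (torus_repr t 0 j)]) by [].
rewrite (_ : _ @^-1` _ = (fun u : 'rV[R]_d => u 0 j) @^-1` [set y | x < residue y]).
  exact: (h _ (@open_residue_gt R x)).
by apply/seteqP; split => u /=; have [z ->] := torus_reprK u; rewrite !mxE residueD.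
Qed.

Lemma measurable_to_torus : measurable_fun setT (@to_torus R d : borel_rV R d -> borel_torus R d).
Proof.
apply: (@measurability _ _ _ (borel_torus R d) setT _ (@open (torus R d)) erefl) => _ [U oU <-].
by rewrite setTI; apply: sub_sigma_algebra.
Qed.

(** Taking residues does not increase absolute values, so [torus_coord] is a shortest
    representative. *)
Lemma torus_ballE (r : R) : torus_ball r = coord_ball (torus_coord : borel_torus R d -> _) r.
Proof.
apply/seteqP; split => [_ [u /eballP[r0 hu] <-]|t ht]; last first.
  by exists (torus_coord t) => //; exact: torus_coordK.
apply/eballP; split => //; apply: le_trans hu; rewrite torus_coordE /dotr.
apply: ler_sum => j _; rewrite mxE -!expr2 -[leLHS]real_normK ?num_real// -[leRHS]real_normK ?num_real//.
by rewrite lerXn2r ?nnegrE// residue_le.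
Qed.

Lemma cos_dotr_int u (z k : 'rV[int]_d) :
  cos (2 * pi * dotr (u + map_mx intr z) (map_mx intr k)) = cos (2 * pi * dotr u (map_mx intr k)).
Proof.
rewrite (psdDl (@psd_dotr R d)) mulrDr.
have -> : dotr (map_mx intr z) (map_mx intr k) = (\sum_j z 0 j * k 0 j)%:~R :> R.
  rewrite /dotr (big_morph (fun m : int => m%:~R : R) (@intrD R) (erefl _)).
  by apply: eq_bigr => j _; rewrite !mxE intrM.
exact: cos_add_period.
Qed.

Lemma cos_torus_coord t (k : 'rV[int]_d) :
  cos (2 * pi * dotr (torus_coord t) (map_mx intr k)) =
  cos (2 * pi * dotr (torus_repr t) (map_mx intr k)).
Proof.
rewrite -(cos_dotr_int _ (\row_j Num.floor (torus_repr t 0 j + 1 / 2))).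
congr (cos (_ * dotr _ _)); apply/rowP => j; rewrite !mxE.
by rewrite /residue subrK.
Qed.

Lemma cos_to_torus u (k : 'rV[int]_d) :
  cos (2 * pi * dotr (torus_coord (to_torus u)) (map_mx intr k)) =
  cos (2 * pi * dotr u (map_mx intr k)).
Proof. by rewrite cos_torus_coord; have [z ->] := torus_reprK u; exact: cos_dotr_int. Qed.

End torus_coordinates.

Section torus_case.
Context {R : realType} {dOm : measure_display} {Om : measurableType dOm}.
Variables (P : probability Om R) (d : nat).
Hypothesis d_gt0 : (0 < d)%N.
Variable f : 'rV[int]_d -> {RV P >-> R}.
Variable mu : {finite_measure set (borel_torus R d) -> \bar R}.

Let c : borel_torus R d -> 'rV[R]_d := @torus_coord R d.
Let emb : 'rV[int]_d -> 'rV[R]_d := map_mx intr.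
Let mc j : measurable_fun setT (fun t => c t 0 j) := measurable_torus_coord j.

Lemma torus_step (tau : R) : 0 < tau -> exists (s : R) (v : 'I_d -> 'rV[int]_d),
  [/\ 0 < s, s <= 1, forall j, emb (v j) = s *: delta_mx 0 j &
    (mu [set l | exists j, (1 / 2 < s * `|c l 0 j|)%R] <= tau%:E)%E].
Proof.
move=> tau0; exists 1, (fun j => delta_mx 0 j); split => //.
  by move=> j; rewrite /emb map_delta_mx scale1r.
rewrite (_ : [set l | _] = set0) ?measure0 ?lee_fin ?ltW//.
rewrite -subset0 => l [j]; rewrite (mul1r `|_|) /c mxE ltNge => /negP; apply.
exact: residue_le_half.
Qed.

Lemma torus_persist (T : R) :
  measurable [set w | forall x, emb_ball emb T x -> (0 <= f x w)%R].
Proof.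
rewrite (_ : [set w | _] = \bigcap_(n in emb_ball emb T) [set w | 0 <= f n w]).
  by apply: measurable_bigcap_countable => q; exact: measurable_nonneg.
by apply/seteqP; split => w h.
Qed.

(** A cell is a single lattice point here: the sequence inside the cell is constantly 0. *)
Lemma torus_cover (T : R) : 1 <= T -> exists (N : nat) (x : 'I_N -> 'rV[int]_d),
  [/\ N%:R <= 5 ^+ d * T ^+ d,
    [set w | forall (m : 'I_N) (i : nat), (0 <= f (x m + 0)%R w)%R] `<=`
      [set w | forall x, emb_ball emb T x -> (0 <= f x w)%R] &
    forall (m : 'I_N) (i : nat), emb_ball emb (3 * d%:R * T) (x m + 0)].
Proof.
move=> T1; have [N [k [hN hk kz]]] := integer_grid (d := d) T1.
exists N, k; split => // [w hw x xT|m i].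
- have [j|m <-] := kz x; last by have := hw m 0%N; rewrite addr0.
  have := coord_le_eball j xT; rewrite /emb mxE => h; apply: le_trans h _.
  by rewrite lerDl.
- rewrite addr0 /emb_ball/=; have -> : 3 * d%:R * T = d%:R * (3 * T) by ring.
  apply: eball_coord => [|j]; first by rewrite mulr_ge0// (le_trans _ T1).
  by rewrite mxE; have := hk m j; lra.
Qed.

Lemma torus_power_growth (mu_ac : {finite_measure set (borel_torus R d) -> \bar R}) (alpha : R) :
  0 < alpha -> alpha < d%:R -> SGF f ->
  spectral_torus (cov_kernel f) mu ->
  ac_part mu mu_ac (@lebesgue_torus R d) ->
  mu_ac setT <> 0%E ->
  ln (fine (mu (@torus_ball R d delta))) / ln delta @[delta --> 0^'+] --> alpha ->
  power_growth (fun T => theta f (@lattice_eball R d T)) alpha.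
Proof.
move=> a0 ad Sf [_ Kmu] ac ac0 Hball.
have [Lb [LbE LbI]] := @box_measure_exists R d 0 1 isT.
have mtor := @measurable_to_torus R d.
have pfin : (pushforward Lb (@to_torus R d : borel_rV R d -> borel_torus R d) setT < +oo)%E.
  by rewrite /pushforward preimage_setT ltey_eq fin_num_measure.
(* Haar measure on the torus, as the image of Lebesgue measure on the unit cube. *)
have [Lt LtE LtI] := @finite_copy R _ (borel_torus R d)
  (pushforward Lb (@to_torus R d : borel_rV R d -> borel_torus R d)) pfin.
have act (A : set (borel_torus R d)) : measurable A -> A `<=` setT -> Lt A = 0%E -> mu_ac A = 0%E.
  move=> mA _ A0; have [dom _] := ac; apply: (dom A) => // B mB BA.
  have mpB : measurable (@to_torus R d @^-1` B : set (borel_rV R d)).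
    by rewrite -[X in measurable X]setTI; apply: (mtor).
  rewrite /lebesgue_torus (_ : [set u | _] = (box 0 1 : set (borel_rV R d)) `&` (@to_torus R d @^-1` B)).
    rewrite LbE; last 2 first.
    - by apply: measurableI => //; exact: measurable_box.
    - by move=> u [h _] i; rewrite mulr1n add0r; exact: h.
    apply/eqP; rewrite eq_le measure_ge0 andbT -A0 LtE.
    apply: le_measure; rewrite ?inE.
    - by apply: measurableI => //; exact: measurable_box.
    - by rewrite -[X in measurable X]setTI; apply: (mtor).
    - by move=> u [_ /BA].
  by [].
have [nu [M [nu_le nu_dom nu0]]] := ac_dominated measurableT ac0 act.
have orth (k : 'rV[int]_d) : (\int[Lt]_l (cos (2 * pi * dotr (c l) (map_mx intr k)))%:E =
    (if k == 0 then 1 else 0)%:E)%E.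
  have mcos : measurable_fun setT (fun l : borel_torus R d => cos (2 * pi * dotr (c l) (map_mx intr k))).
    apply: measurableT_comp; first exact: continuous_measurable_fun (@continuous_cos R).
    apply: measurable_funM => //.
    by apply: measurable_sum => j; apply: measurable_funM => //; exact: mc.
  have cos1 (x : R) : `|cos x| <= 1 by exact: cos_max.
  rewrite LtI integral_pushforward//; last 2 first.
  - exact/measurable_EFinP.
  - apply: (@bounded_integrable_of_finite _ _ _ Lb (fun u => cos (2 * pi * dotr (c (to_torus u)) (map_mx intr k))) 1) => //.
    exact: (measurableT_comp mcos mtor).
  have := LbI k 0; rewrite cos0 mulr1 expr1n => <-.
  by apply: eq_integral => u _; rewrite addr0 /= /c cos_to_torus.
have embD x y : emb (x + y) = emb x + emb y by rewrite /emb map_mxD.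
have [A [M' [A0 M0 Hac]]] := lattice_points_form mc embD nu_dom (pt := id)
  (vol := 1) (fun k => erefl) ler01 orth d_gt0.
have KE x : cov_kernel f x = fine (\int[mu]_l (cos (2 * pi * coord_phase c emb x l))%:E)%E.
  have [-> _] := Kmu x; congr (fine _); apply: eq_integral => t _.
  by rewrite /coord_phase /c cos_torus_coord.
have nu_mu B : measurable B -> (nu B <= mu B)%E.
  by move=> mB; apply: le_trans (nu_le B mB) _; exact: ac_part_le ac mB.
have k0 : 0 < fine (nu setT).
  by rewrite fine_gt0// lt0e measure_ge0 andbT ltey_eq fin_num_measure//= andbT; apply/eqP.
have A1 : (1 : R) <= 3 * d%:R.
  have : 1 <= d%:R :> R by rewrite ler1n.
  lra.
have Hb : ln (fine (mu (coord_ball c delta))) / ln delta @[delta --> 0^'+] --> alpha.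
  by under eq_fun do rewrite -torus_ballE.
have mph x : measurable_fun setT (coord_phase c emb x) by exact: measurable_coord_phase.
have phD := coord_phaseD c embD.
have mcb r : measurable (coord_ball c r) by exact: measurable_coord_ball.
have ub w : exists B : R, forall i : nat, `|f ((fun=> 0) i) w| <= B by exists `|f 0 w|.
exact: (abstract_power_growth Sf mph phD KE a0 mcb (@coord_ball_mono _ _ _ _ c) Hb
  (@coord_phase_cos _ _ _ _ _ c emb) (coord_kernels mc embD d_gt0 torus_step)
  torus_persist A1 ub torus_cover (@emb_ball_mono _ _ _ emb)
  (emb_ballD embD) ad nu_mu k0 M0 A0 Hac).
Qed.

End torus_case.

Theorem corollary1p4 (R : realType) (dOm : measure_display)
    (Om : measurableType dOm) (P : probability Om R)
    (d : nat) (alpha : R) (alpha_gt0 : 0 < alpha) (alpha_ltd : alpha < d%:R) :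
  (forall (f : 'rV[R]_d -> {RV P >-> R})
      (mu mu_ac : {finite_measure set (borel_rV R d) -> \bar R}),
    SGF f ->
    (forall w, continuous (fun x => f x w)) ->
    spectral_rV (cov_kernel f) mu ->
    ac_part mu mu_ac (@lebesgue_rV R d) ->
    mu_ac setT <> 0%E ->
    ln (fine (mu (@eball R d delta))) / ln delta @[delta --> 0^'+] --> alpha ->
    power_growth (fun T => theta f (@eball R d T)) alpha) /\
  (forall (f : 'rV[int]_d -> {RV P >-> R})
      (mu mu_ac : {finite_measure set (borel_torus R d) -> \bar R}),
    SGF f ->
    spectral_torus (cov_kernel f) mu ->
    ac_part mu mu_ac (@lebesgue_torus R d) ->
    mu_ac setT <> 0%E ->
    ln (fine (mu (@torus_ball R d delta))) / ln delta @[delta --> 0^'+]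
      --> alpha ->
    power_growth (fun T => theta f (@lattice_eball R d T)) alpha).
Proof.
have d0 : (0 < d)%N by rewrite -(ltr0n R); exact: lt_trans alpha_gt0 alpha_ltd.
split => [f mu mu_ac Sf cf sp ac ac0 Hb | f mu mu_ac Sf sp ac ac0 Hb].
  exact: (euclidean_power_growth d0 (@cf) alpha_gt0 alpha_ltd Sf sp ac ac0 Hb).
exact: (torus_power_growth d0 alpha_gt0 alpha_ltd Sf sp ac ac0 Hb).
Qed.
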